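(* Assume the following conditions. (1) There exists $\varepsilon\in(0,1)$ and, for each $\theta\in\Theta$, $y\in\mathcal{Y}$, there exists a measure $\mu_\theta(dx|y)$ on $\mathcal{X}$ such that $0<\mu_\theta(\mathcal{X}|y)<\infty$ and $\varepsilon\mu_\theta(B|y)\le\int_B r_\theta(y,x'|x)\mu(dx')\le\mu_\theta(B|y)/\varepsilon$ for all $x\in\mathcal{X}$, $B\in\mathcal{B}(\mathcal{X})$. (2) There exists a function $\psi:\mathcal{Y}\to[1,\infty)$ such that $|\partial_\theta^{\alpha}r_\theta(y,x'|x)|\le(\psi(y))^{|\alpha|}r_\theta(y,x'|x)$ for all $\theta\in\Theta$, $x,x'\in\mathcal{X}$, $y\in\mathcal{Y}$ and all $\alpha\in\mathbb{N}_0^d\setminus\{\mathbf{0}\}$ with $|\alpha|\le p$. (3) There exists a function $\phi:\mathcal{Y}\times\mathcal{X}\to[1,\infty)$ such that $r_\theta(y,x'|x)\le\phi(y,x')$ and $\int\phi(y,x'')\mu(dx'')<\infty$ for all $\theta\in\Theta$, $x,x'\in\mathcal{X}$, $y\in\mathcal{Y}$. (4) There exist a probability measure $\pi$ on $\mathcal{X}$ and real numbers $\delta\in(0,1)$, $K_0\in[1,\infty)$ such that $|P^n(x,B)-\pi(B)|\le K_0\delta^n$ for all $x\in\mathcal{X}$, $B\in\mathcal{B}(\mathcal{X})$, $n\ge0$. (5) There exists a function $\varphi:\mathcal{Y}\to[1,\infty)$ such that $|\log\mu_\theta(\mathcal{X}|y)|\le\varphi(y)$ for all $\theta\in\Theta$,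 $y\in\mathcal{Y}$, where $\mu_\theta(dx|y)$ is the measure in (1). (6) There exists $M_0\in[1,\infty)$ such that $\int\varphi(y)\psi^u(y)Q(x,dy)\le M_0$ and $\int\psi^v(y)Q(x,dy)\le M_0$ for all $x\in\mathcal{X}$, where $u=p(p+1)$, $v=2p(p+1)$. Then there exists a function $l:\Theta\to\mathbb{R}$ which is $p$-times differentiable on $\Theta$ and satisfies $l(\theta)=\lim_{n\to\infty}l_n(\theta,\lambda)$ for all $\theta\in\Theta$, $\lambda\in\mathcal{P}(\mathcal{X})$.
   Context: Integers $d,d_x,d_y,p\ge1$ are fixed; $\Theta\subset\mathbb{R}^d$ is a bounded open set; $\mathcal{X}\in\mathcal{B}(\mathbb{R}^{d_x})$, $\mathcal{Y}\in\mathcal{B}(\mathbb{R}^{d_y})$ ($\mathcal{B}(\cdot)$ denotes Borel sets); $\mu$, $\nu$ are measures on $\mathcal{X}$, $\mathcal{Y}$; $\mathcal{P}(\mathcal{X})$ is the set of probability measures on $\mathcal{X}$. $p_\theta(x'|x)$ and $q_\theta(y|x)$ are $[0,\infty)$-valued functions of $\theta\in\Theta$, $x,x'\in\mathcal{X}$, $y\in\mathcal{Y}$ with $\int p_\theta(x'|x)\mu(dx')=\int q_\theta(y|x)\nu(dy)=1$, $p$-times differentiable in $\theta$; $r_\theta(y,x'|x)=q_\theta(y|x')p_\theta(x'|x)$. All integrands are tacitly Borel measurable. For $\alpha\in\mathbb{N}_0^d$: $|\alpha|=\alpha_1+\cdots+\alpha_d$, $\partial_\theta^\alpha=\partial^{|\alpha|}/\partial\theta_1^{\alpha_1}\cdots\partial\theta_d^{\alpha_d}$;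 $\mathbf{0}$ is the zero multi-index. $P(x,dx')$ is a transition kernel on $\mathcal{X}$ ($P^n$ its $n$-step kernel) and $Q(x,dy)$ a conditional probability measure on $\mathcal{Y}$ given $x\in\mathcal{X}$. $\{(X_n,Y_n)\}_{n\ge0}$ is an $\mathcal{X}\times\mathcal{Y}$-valued stochastic process on a probability space $(\Omega,\mathcal{F},P)$ satisfying, almost surely, $$P((X_{n+1},Y_{n+1})\in B\mid X_{0:n},Y_{0:n})=\int I_B(x,y)Q(x,dy)P(X_n,dx)$$ for all $B\in\mathcal{B}(\mathcal{X}\times\mathcal{Y})$, $n\ge0$ (this process need not belong to the parametric family given by $p_\theta,q_\theta$). For $n\ge1$, $y_1,\dots,y_n\in\mathcal{Y}$, $\lambda\in\mathcal{P}(\mathcal{X})$, $$q_\theta^n(y_{1:n}|\lambda)=\int\cdots\int\int\left(\prod_{k=1}^n r_\theta(y_k,x_k|x_{k-1})\right)\mu(dx_n)\cdots\mu(dx_1)\lambda(dx_0),\qquad l_n(\theta,\lambda)=E\left(\frac1n\log q_\theta^n(Y_{1:n}|\lambda)\right).$$ *)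

(* Defs.v *)
From HB Require Import structures.
From mathcomp Require Import all_boot all_order all_algebra.
From mathcomp Require Import all_classical all_reals all_analysis.
From mathcomp Require Import measurable_realfun.

Set Implicit Arguments.
Unset Strict Implicit.
Unset Printing Implicit Defensive.

Import Order.TTheory GRing.Theory Num.Theory.
Import numFieldNormedType.Exports.

#[global] Open Scope classical_set_scope.
#[global] Open Scope ring_scope.

(* A subset A of a topological space as a measurable space: the elements of A
   with the Borel sigma-algebra of the induced topology. When A is Borel, this is
   the family of the Borel sets included in A. Measurable types are pointed,
   whence the proof that A is nonempty. *)
Definition borel_on {T : topologicalType} {A : set T} (A0 : A !=set0) : Type :=
  set_type A.

Section borel_on_instances.
Context {T : topologicalType} {A : set T} (A0 : A !=set0).

HB.instance Definition _ := Topological.on (borel_on A0).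
HB.instance Definition _ := isPointed.Build (borel_on A0)
  (exist _ (projT1 (cid A0)) (mem_set (projT2 (cid A0)))).
HB.instance Definition _ := @isMeasurable.Build
  (sigma_display (@open (borel_on A0))) (borel_on A0)
  <<s @open (borel_on A0) >>
  (@sigma_algebra0 _ setT _) (@sigma_algebraC _ _)
  (@sigma_algebra_bigcup _ setT _).

End borel_on_instances.

Section derivatives.
Context {R : realType} {d : nat}.
Implicit Types (f : 'rV[R]_d -> R) (Theta : set 'rV[R]_d).

Definition partial (i : 'I_d) f : 'rV[R]_d -> R :=
  fun th => 'D_(delta_mx ord0 i) f th.

Definition multi_deg (alpha : {ffun 'I_d -> nat}) : nat := (\sum_i alpha i)%N.

Definition multi_partial (alpha : {ffun 'I_d -> nat}) f : 'rV[R]_d -> R :=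
  foldr (fun i g => iter (alpha i) (partial i) g) f (enum 'I_d).

(* k-fold Frechet differentiability at every point of Theta, which is meant to
   be open: in finite dimension the total derivative is k times differentiable
   iff its components, the first-order partial derivatives, are. *)
Fixpoint differentiable_n (k : nat) f Theta : Prop :=
  if k is j.+1 then
    (forall th, Theta th -> differentiable f th) /\
    (forall i, differentiable_n j (partial i f) Theta)
  else True.

End derivatives.

Section likelihood.
Context {R : realType} {d : nat}.
Context {dX dY : measure_display}
  {X : measurableType dX} {Y : measurableType dY}.
Variable mu : {measure set X -> \bar R}.
(* pd th x' x is p_th(x'|x), and qd th y x is q_th(y|x) *)
Variables (pd : 'rV[R]_d -> X -> X -> R) (qd : 'rV[R]_d -> Y -> X -> R).

Definition rd (th : 'rV[R]_d) (y : Y) (x' x : X) : R :=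
  qd th y x' * pd th x' x.

(* int ... int F [:: x_1; ...; x_n] mu(dx_n) ... mu(dx_1) *)
Fixpoint iter_integral (n : nat) (F : seq X -> \bar R) : \bar R :=
  if n is m.+1 then (\int[mu]_x iter_integral m (fun s => F (x :: s)))%E
  else F [::].

(* q_th^n(y_{1:n}|lambda); only the values y 1, ..., y n are used *)
Definition qn (n : nat) (th : 'rV[R]_d) (y : nat -> Y)
    (lambda : probability X R) : \bar R :=
  (\int[lambda]_x0 iter_integral n (fun s =>
    (\prod_(1 <= k < n.+1)
       rd th (y k) (nth x0 (x0 :: s) k) (nth x0 (x0 :: s) k.-1))%:E))%E.

Definition ln_mean {dO : measure_display} {Omega : measurableType dO}
    (Pr : probability Omega R) (Y_ : nat -> Omega -> Y)
    (n : nat) (th : 'rV[R]_d) (lambda : probability X R) : \bar R :=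
  ('E_Pr[fun w => (n%:R^-1 * ln (fine (qn n th (Y_ ^~ w) lambda)))%R])%E.

End likelihood.

Section process.
Context {R : realType} {dX dY dO : measure_display}.
Context {X : measurableType dX} {Y : measurableType dY}
  {Omega : measurableType dO}.

Fixpoint kernel_pow (P : R.-pker X ~> X) (n : nat) (x : X) (B : set X)
    : \bar R :=
  if n is m.+1 then (\int[P x]_x' kernel_pow P m x' B)%E else \d_x B.

(* V is a version of the conditional probability Pr(A | G) *)
Definition is_cond_prob (Pr : probability Omega R) (G : set (set Omega))
    (A : set Omega) (V : Omega -> \bar R) : Prop :=
  [/\ forall B : set (\bar R), measurable B -> G (V @^-1` B),
      Pr.-integrable setT V
    & forall D, G D -> (\int[Pr]_(w in D) V w = Pr (A `&` D))%E].

(* sigma(X_0, ..., X_n, Y_0, ..., Y_n) *)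
Definition history (X_ : nat -> Omega -> X) (Y_ : nat -> Omega -> Y) (n : nat)
    : set (set Omega) :=
  <<s \bigcup_(k in [set k | (k <= n)%N])
        (preimage_set_system setT (X_ k) measurable `|`
         preimage_set_system setT (Y_ k) measurable) >>.

Definition hidden_markov (Pr : probability Omega R)
    (P : R.-pker X ~> X) (Q : R.-pker X ~> Y)
    (X_ : nat -> Omega -> X) (Y_ : nat -> Omega -> Y) : Prop :=
  forall (n : nat) (B : set (X * Y)), measurable B ->
    is_cond_prob Pr (history X_ Y_ n)
      [set w | B (X_ n.+1 w, Y_ n.+1 w)]
      (fun w => \int[P (X_ n w)]_x \int[Q x]_y (\1_B (x, y))%:E)%E.

End process.

(* Main.v *)
Require Import Defs.
From HB Require Import structures.
From mathcomp Require Import all_boot all_order all_algebra.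
From mathcomp Require Import all_classical all_reals all_analysis.
From mathcomp Require Import measurable_realfun ring lra.
Set Implicit Arguments.
Unset Strict Implicit.
Unset Printing Implicit Defensive.
Import Order.TTheory GRing.Theory Num.Theory.
Import numFieldNormedType.Exports.
Local Open Scope classical_set_scope.
Local Open Scope ring_scope.

(** Write [lik n y x th] for the likelihood of the observations [y 0], ...,
    [y n.-1] when the hidden chain starts at the state [x]. Dropping the oldest
    observation and restarting the chain at a fixed state [xs] changes the
    log-likelihood by
    [incr n y = ln (lik n.+1 y xs) - ln (lik n (fun i => y i.+1) xs)],
    so that a log-likelihood is a telescoping sum of increments, the [m]-th one
    being [incr] of the observations from the time [m] to the last one.

    For a given observation, the comparison with [mu_th (dx | y)] makes every
    density [r y x' x th] dominate a fixed fraction of [r y x' z th] for any other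
    state [z], hence the likelihoods forget the state of the chain at a geometric
    rate (Doeblin): [incr n.+1 y] and [incr n y] differ by a geometrically small
    quantity ([incr_contract_unit]). Under the hidden Markov law, the mean of
    [incr j] over the observations from the time [m] on is therefore
    geometrically Cauchy in [j]; by the ergodicity of the chain it is
    geometrically Cauchy in [m] ([predict_mixing_signed]). Let [l] be its limit
    along the diagonal [m = j]. The mean log-likelihood of [n] observations is the
    sum of the means over [m + j = n.-1], which is [n l + O(1)] ([mean_limit]).
    Another initial law changes the log-likelihood by a bounded amount
    ([ln_lik_average]), which disappears after the division by [n].

    For [l] to be [p] times differentiable, these estimates must hold together
    with the derivatives up to the order [p]. This is achieved without any formula
    for the derivatives of the likelihoods. The seminorm [jet_norm tau p f th]
    adds up the absolute values of the iterated partial derivatives of [f] at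
    [th], of order up to [p] and with multiplicity, a derivative of order [k]
    being weighted by [tau ^+ k]; by Leibniz' rule it is submultiplicative, like
    an absolute value. The bounds on the derivatives of the densities say that
    [jet_norm tau p (r y x' x) th <= r y x' x th * (1 + d tau psi y) ^+ p],
    so for [tau] small with respect to the inverses of the [psi (y k)] the density
    [r] is, in this seminorm, a small relative perturbation of its value frozen
    at [th]. The frozen densities are nonnegative and contract oscillations as in
    the case without derivatives, the seminorm passes through integrals
    ([jet_norm_integral]), and the contraction survives the perturbation
    ([doeblin_osc], [step_cone], [growth_contract]). Going back to [tau = 1]
    costs a factor [tau^-1 ^+ p], of the order of the largest [psi (y k) ^+ p]; it
    is bounded by their sum, whose mean grows only linearly with the number of
    observations by the moment conditions and is absorbed by the geometric factor.

    The integrability of [phi] makes the reference measure finite, since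
    [phi >= 1], and [phi] dominates all the integrands, whence the differentiation
    under the integral signs. *)

(** * Calculus on an open set *)

Section gradient.
Context {R : realType} {d : nat}.
Implicit Types (f g : 'rV[R]_d -> R) (a : 'I_d -> R) (x h : 'rV[R]_d).

Definition pairing a h : R := \sum_i h ord0 i * a i.

Lemma pairing_is_linear a : linear (pairing a).
Proof.
move=> k u v; rewrite /pairing scaler_sumr -big_split/=.
by apply: eq_bigr => i _; rewrite !mxE mulrDl -mulrA.
Qed.

HB.instance Definition _ a :=
  GRing.isLinear.Build R 'rV[R]_d R _ (pairing a) (pairing_is_linear a).

Lemma pairing_delta a i : pairing a (delta_mx ord0 i) = a i.
Proof.
rewrite /pairing (bigD1 i)//= mxE !eqxx mul1r big1 ?addr0// => j ji.
by rewrite mxE/= (negPf ji) mul0r.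
Qed.

Lemma pairing_le a h : `|pairing a h| <= `|h| * \sum_i `|a i|.
Proof.
apply: le_trans (ler_norm_sum _ _ _) _.
rewrite mulr_sumr ler_sum// => i _; rewrite normrM ler_wpM2r//.
by rewrite [leRHS]/Num.norm/= mx_normrE; apply/bigmax_geP; right; exists (ord0, i).
Qed.

Lemma pairing_continuous a : continuous (pairing a).
Proof.
have p0 : pairing a 0 = 0 by exact: linear0.
suff p_cvg : pairing a x @[x --> (0 : 'rV[R]_d)] --> pairing a 0.
  exact: continuousfor0_continuous.
rewrite p0.
apply/(@cvgr0Pnorm_lt _ _ _ (nbhs (0 : 'rV[R]_d))) => e e0.
have S0 : 0 < 1 + \sum_i `|a i| by rewrite ltr_pwDl// sumr_ge0.
near=> h; apply: le_lt_trans (pairing_le _ _) _.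
apply: (@le_lt_trans _ _ (`|h| * (1 + \sum_i `|a i|))).
  by rewrite ler_wpM2l// lerDr.
rewrite -ltr_pdivlMr//; near: h.
by apply: (@nbhs0_lt R 'rV[R]_d); rewrite divr_gt0.
Unshelve. all: by end_near. Qed.

(** Total differentiability with an explicit linear part, in epsilon-delta form:
    the negation yields a sequence of increments, along which dominated
    convergence applies. *)
Definition has_gradient f a x := forall e, 0 < e -> exists2 r, 0 < r &
  forall h, `|h| < r -> `|f (x + h) - f x - pairing a h| <= e * `|h|.

Lemma has_gradient_differentiable f a x :
  has_gradient f a x -> differentiable f x /\ forall i, partial i f x = a i.
Proof.
move=> fa.
have fx e : 0 < e -> \forall h \near (0 : 'rV[R]_d),
    `|(f \o shift x - (cst (f x) + pairing a)) h| <= e * `|h|.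
  move=> e0; have [r r0 H] := fa _ e0; near=> h.
  have -> : (f \o shift x - (cst (f x) + pairing a)) h =
      f (x + h) - f x - pairing a h.
    by rewrite [x + h]addrC -[_ - _ - _]addrA -opprD.
  by apply: H; near: h; exact: (@nbhs0_lt R 'rV[R]_d).
have da : 'd f x = pairing a :> (_ -> _).
  by apply: diff_unique; [exact: pairing_continuous|exact/eqaddoP].
have df : differentiable f x.
  apply/diff_locallyP; rewrite da; split; first exact: pairing_continuous.
  exact/eqaddoP.
by split=> // i; rewrite /partial deriveE// da pairing_delta.
Unshelve. all: by end_near. Qed.

Lemma diff_pairing f x h : differentiable f x ->
  'd f x h = pairing (fun i => partial i f x) h.
Proof.
move=> df; rewrite [in LHS](row_sum_delta h) linear_sum; apply: eq_bigr => i _.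
by rewrite linearZ/= /partial deriveE.
Qed.

Lemma differentiable_has_gradient f x :
  differentiable f x -> has_gradient f (fun i => partial i f x) x.
Proof.
move=> df; have /diff_locally/eqaddoP fx := df.
move=> e /fx /nbhs0P/nbhs_ballP[r r0 H]; exists r => // h hr.
have := H h; rewrite -ball_normE/= sub0r normrN add0r => /(_ hr)/=.
have -> : (f \o shift x - (cst (f x) + 'd f x)) h = f (x + h) - f x - 'd f x h.
  by rewrite [x + h]addrC -[_ - _ - _]addrA -opprD.
by rewrite diff_pairing.
Qed.

End gradient.

Section mean_value.
Context {R : realType} {d : nat}.
Implicit Types (f g : 'rV[R]_d -> R) (x h : 'rV[R]_d).

Lemma is_derive_line f x h (t : R) : differentiable f (x + t *: h) ->
  is_derive t 1 (fun s : R => f (x + s *: h))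
    (pairing (fun i => partial i f (x + t *: h)) h).
Proof.
move=> df; have D := @diff_derivable _ _ _ _ _ h df.
have E : (fun s : R => s^-1 *: (f (x + (s *: (1 : R) + t) *: h) - f (x + t *: h)))
    = (fun s : R => s^-1 *: (f (s *: h + (x + t *: h)) - f (x + t *: h))).
  apply/funext => s; congr (_ *: (f _ - _)).
  by rewrite scalerDl -[s *: 1]/(s * 1) mulr1 addrCA.
have -> : pairing (fun i => partial i f (x + t *: h)) h = 'D_h f (x + t *: h).
  by rewrite deriveE// diff_pairing.
apply: DeriveDef.
- by move: D; rewrite /derivable /= E.
- by rewrite /derive /= E.
Qed.

Lemma mean_value_unit (phi dphi : R -> R) b :
  (forall t : R, 0 <= t <= 1 -> is_derive t 1 phi (dphi t)) ->
  (forall t : R, 0 <= t <= 1 -> `|dphi t| <= b) -> `|phi 1 - phi 0| <= b.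
Proof.
move=> dp pb; have [||t t01] := @MVT R phi dphi 0 1 ltr01.
- move=> t; rewrite in_itv/= => /andP[/ltW t0 /ltW t1].
  by apply: dp; rewrite t0.
- apply: derivable_within_continuous => t; rewrite in_itv/= => t01.
  by have [] := dp _ t01.
rewrite subr0 mulr1 => ->.
by apply: pb; move: t01; rewrite in_itv/= => /andP[/ltW -> /ltW ->].
Qed.

Lemma mean_value_line f x h b :
  (forall t : R, 0 <= t <= 1 -> differentiable f (x + t *: h)) ->
  (forall t : R, 0 <= t <= 1 ->
     `|pairing (fun i => partial i f (x + t *: h)) h| <= b) ->
  `|f (x + h) - f x| <= b.
Proof.
move=> df fb.
have := @mean_value_unit (fun t => f (x + t *: h))
  (fun t => pairing (fun i => partial i f (x + t *: h)) h) b.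
rewrite scale1r scale0r addr0; apply => // t t01.
by apply: is_derive_line; exact: df.
Qed.

End mean_value.

Section open_domain.
Context {R : realType} {d : nat}.
Variable (Theta : set 'rV[R]_d).
Hypothesis Theta_open : open Theta.
Implicit Types (f g : 'rV[R]_d -> R) (x h th : 'rV[R]_d).

Lemma open_ball_subset th : Theta th ->
  exists2 r, 0 < r & forall h, `|h| < r -> Theta (th + h).
Proof.
move=> Tth; have /nbhs_ballP[r r0 H] := open_nbhs_nbhs (conj Theta_open Tth).
exists r => // h hr; apply: H; rewrite -ball_normE/=.
by rewrite opprD addNKr normrN.
Qed.

(** For an integrand, this dominates the difference quotients by a bound on the
    derivatives. *)
Lemma mean_value_ball th r f b :
  (forall h, `|h| < r -> Theta (th + h)) ->
  (forall t, Theta t -> differentiable f t) ->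
  (forall t, Theta t -> \sum_i `|partial i f t| <= b) ->
  forall h, `|h| < r -> `|f (th + h) - f th| <= b * `|h|.
Proof.
move=> thr df fb h hr.
have th_in (t : R) : 0 <= t <= 1 -> Theta (th + t *: h).
  move=> /andP[t0 t1]; apply: thr; apply: le_lt_trans hr.
  by rewrite normrZ ger0_norm// ler_piMl.
apply: mean_value_line => t t01; first exact: df (th_in _ t01).
apply: le_trans (pairing_le _ _) _; rewrite mulrC ler_wpM2r//.
exact: fb (th_in _ t01).
Qed.

Lemma near_Theta (P : 'rV[R]_d -> Prop) th : Theta th ->
  (forall t, Theta t -> P t) -> \forall t \near th, P t.
Proof.
by move=> Tth H; apply: filterS (open_nbhs_nbhs (conj Theta_open Tth)).
Qed.

Lemma partial_ext i f g : (forall t, Theta t -> f t = g t) ->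
  forall t, Theta t -> partial i f t = partial i g t.
Proof. by move=> fg t Tt; apply: near_eq_derive; exact: near_Theta. Qed.

Lemma differentiable_ext f g th : Theta th ->
  (forall t, Theta t -> f t = g t) -> differentiable f th -> differentiable g th.
Proof.
move=> Tth fg /differentiable_has_gradient df.
have [r r0 Tr] := open_ball_subset Tth.
have [] // := @has_gradient_differentiable _ _ g (fun i => partial i f th) th.
move=> e /df[s s0 H]; exists (Num.min r s); first by rewrite lt_min r0.
by move=> h; rewrite lt_min => /andP[hr hs]; rewrite -!fg//; [exact: H|exact: Tr].
Qed.

Local Notation dn := (fun k f => differentiable_n k f Theta).

Lemma dn_ext k f g : (forall t, Theta t -> f t = g t) -> dn k f -> dn k g.
Proof.
elim: k f g => //= k IH f g fg [df pf]; split.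
  by move=> t Tt; apply: differentiable_ext (df _ Tt).
by move=> i; apply: IH (pf i); exact: partial_ext.
Qed.

Lemma dnW k f : dn k.+1 f -> dn k f.
Proof.
elim: k f => //= k IH f [df pf]; split=> // i.
by apply: IH; exact: pf.
Qed.

Lemma dn_le j k f : (j <= k)%N -> dn k f -> dn j f.
Proof.
move=> /subnK <-; elim: (k - j)%N => // n IH; rewrite addSn => /dnW; exact: IH.
Qed.

Lemma dn_partial k i f : dn k.+1 f -> dn k (partial i f).
Proof. by case=> _; exact. Qed.

Lemma partial_cst i (c : R) th : partial i (fun=> c) th = 0.
Proof. exact: derive_cst. Qed.

Lemma dn_cst k c : dn k (fun=> c).
Proof.
elim: k c => //= k IH c; split; first by move=> t _; exact: differentiable_cst.
by move=> i; apply: (@dn_ext _ (fun=> 0)) => // t _; rewrite partial_cst.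
Qed.

Lemma partialD i f g t : differentiable f t -> differentiable g t ->
  partial i (fun x => f x + g x) t = partial i f t + partial i g t.
Proof. by move=> df dg; apply: deriveD; exact: diff_derivable. Qed.

Lemma partialB i f g t : differentiable f t -> differentiable g t ->
  partial i (fun x => f x - g x) t = partial i f t - partial i g t.
Proof. by move=> df dg; apply: deriveB; exact: diff_derivable. Qed.

Lemma partialM i f g t : differentiable f t -> differentiable g t ->
  partial i (fun x => f x * g x) t = partial i f t * g t + f t * partial i g t.
Proof.
move=> df dg; rewrite /partial deriveM; [|exact: diff_derivable..].
by rewrite addrC mulrC.
Qed.

Lemma dnD k f g : dn k f -> dn k g -> dn k (fun x => f x + g x).
Proof.
elim: k f g => //= k IH f g [df pf] [dg pg]; split.
  by move=> t Tt; apply: differentiableD; [exact: df|exact: dg].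
move=> i; apply: dn_ext (IH _ _ (pf i) (pg i)) => t Tt.
by rewrite partialD//; [exact: df|exact: dg].
Qed.

Lemma dnM k f g : dn k f -> dn k g -> dn k (fun x => f x * g x).
Proof.
elim: k f g => //= k IH f g df dg; split.
  move=> t Tt; apply: differentiableM; [exact: df.1|exact: dg.1].
move=> i; have h1 := IH _ _ (df.2 i) (dnW dg).
have h2 := IH _ _ (dnW df) (dg.2 i).
apply: dn_ext (dnD h1 h2) => t Tt.
by rewrite partialM//; [exact: df.1|exact: dg.1].
Qed.

Lemma dnZ k c f : dn k f -> dn k (fun x => c * f x).
Proof. exact: dnM (dn_cst k c). Qed.

Lemma dnB k f g : dn k f -> dn k g -> dn k (fun x => f x - g x).
Proof.
move=> df dg; apply: dn_ext (dnD df (dnZ (-1) dg)) => t _.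
by rewrite mulN1r.
Qed.

Lemma differentiable_inv f t : f t != 0 -> differentiable f t ->
  differentiable (fun x => (f x)^-1%R) t.
Proof. by move=> f0 df; apply: differentiableV. Qed.

Lemma partialV i f t : f t != 0 -> differentiable f t ->
  partial i (fun x => (f x)^-1%R) t = - partial i f t * ((f t)^-1 * (f t)^-1).
Proof.
move=> f0 df; rewrite /partial deriveV//; last exact: diff_derivable.
by rewrite mulNr -[_ *: _]/(_ * _) mulNr -invfM -expr2 mulrC.
Qed.

Lemma dnV k f : (forall t, Theta t -> f t != 0) -> dn k f ->
  dn k (fun x => (f x)^-1%R).
Proof.
move=> f0; elim: k => //= k IH df; split.
  by move=> t Tt; apply: differentiable_inv; [exact: f0|exact: df.1].
move=> i; have hV := IH (dnW df).
apply: dn_ext (dnM (dnZ (-1) (df.2 i)) (dnM hV hV)) => t Tt.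
by rewrite partialV//; [rewrite mulN1r|exact: f0|exact: df.1].
Qed.

Lemma differentiable_ln_comp f t : 0 < f t -> differentiable f t ->
  differentiable (fun x => ln (f x)) t /\
  forall i, partial i (fun x => ln (f x)) t = partial i f t * (f t)^-1.
Proof.
move=> f0 df; have l1 : is_derive (f t) 1 (@ln R) (f t)^-1%R by exact: is_derive1_ln.
have dl : differentiable (@ln R) (f t) by apply/derivable1_diffP; case: l1.
split; first exact: differentiable_comp.
have dE (u : R) : 'd (@ln R) (f t) u = u * (f t)^-1%R.
  rewrite -[u in LHS]mulr1 -[u * 1]/(u *: (1 : R)) linearZ/= -deriveE//.
  by case: l1 => _ ->.
move=> i; rewrite /partial deriveE; last exact: differentiable_comp.
by rewrite diff_comp//= dE -deriveE.
Qed.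

Lemma dn_ln k f : (forall t, Theta t -> 0 < f t) -> dn k f ->
  dn k (fun x => ln (f x)).
Proof.
move=> f0; case: k => //= k df; split.
  by move=> t Tt; apply: (differentiable_ln_comp (f0 _ Tt) (df.1 _ Tt)).1.
have hV : dn k (fun x => (f x)^-1%R).
  by apply: dnV (dnW df) => t /f0/lt0r_neq0.
move=> i; apply: dn_ext (dnM (df.2 i) hV) => t Tt.
by rewrite (differentiable_ln_comp (f0 _ Tt) (df.1 _ Tt)).2.
Qed.

End open_domain.

(** * A submultiplicative seminorm on jets *)

Section jet_norm.
Context {R : realType} {d : nat}.
Variable (Theta : set 'rV[R]_d).
Hypothesis Theta_open : open Theta.
Implicit Types (f g : 'rV[R]_d -> R) (tau : R) (th : 'rV[R]_d).

Local Notation dn := (fun k f => differentiable_n k f Theta).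

(** An iterated partial derivative of order [j <= k] enters with the weight
    [tau ^+ j * 'C(k, j)], the binomial coefficient counting the places where the
    recursion does not differentiate. For these weights the seminorm is
    submultiplicative. *)
Fixpoint jet_norm tau k f th : R :=
  if k is j.+1 then
    jet_norm tau j f th + tau * \sum_i jet_norm tau j (partial i f) th
  else `|f th|.

Lemma jet_norm_ge0 tau k f th : 0 <= tau -> 0 <= jet_norm tau k f th.
Proof.
move=> t0; elim: k f => //= k IH f.
by rewrite addr_ge0// mulr_ge0// sumr_ge0.
Qed.

Lemma jet_norm_ext tau k f g th : Theta th ->
  (forall t, Theta t -> f t = g t) -> jet_norm tau k f th = jet_norm tau k g th.
Proof.
move=> Tth; elim: k f g => /= [|k IH] f g fg; first by rewrite fg.
congr (_ + _ * _); first exact: IH.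
by apply: eq_bigr => i _; apply: IH; exact: partial_ext.
Qed.

Lemma jet_norm_leS tau k f th : 0 <= tau ->
  jet_norm tau k f th <= jet_norm tau k.+1 f th.
Proof.
by move=> t0 /=; rewrite lerDl mulr_ge0// sumr_ge0// => i _; exact: jet_norm_ge0.
Qed.

Lemma jet_norm_partial tau k f th : 0 <= tau ->
  tau * \sum_i jet_norm tau k (partial i f) th <= jet_norm tau k.+1 f th.
Proof. by move=> t0 /=; rewrite lerDr jet_norm_ge0. Qed.

Lemma normr_jet_norm tau k f th : 0 <= tau -> `|f th| <= jet_norm tau k f th.
Proof.
move=> t0; elim: k => // k IH; apply: le_trans IH _; exact: jet_norm_leS.
Qed.

Lemma jet_norm_cst tau k (c : R) th : Theta th -> jet_norm tau k (fun=> c) th = `|c|.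
Proof.
move=> Tth; elim: k c => //= k IH c; rewrite IH big1 ?mulr0 ?addr0// => i _.
rewrite (@jet_norm_ext _ _ _ (fun=> 0))//; first by rewrite IH normr0.
by move=> t _; rewrite partial_cst.
Qed.

Lemma jet_normD tau k f g th : 0 <= tau -> Theta th -> dn k f -> dn k g ->
  jet_norm tau k (fun x => f x + g x) th <= jet_norm tau k f th + jet_norm tau k g th.
Proof.
move=> t0 Tth; elim: k f g => /= [|k IH] f g df dg; first exact: ler_normD.
rewrite addrACA; apply: lerD; first by apply: IH; exact: dnW.
rewrite -mulrDr ler_wpM2l// -big_split/= ler_sum// => i _.
apply: le_trans (IH _ _ (df.2 i) (dg.2 i)).
rewrite (@jet_norm_ext _ _ _ (fun x => partial i f x + partial i g x))// => t Tt.
by rewrite partialD//; [exact: df.1|exact: dg.1].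
Qed.

(** Leibniz' rule: one more order adds [tau * (sf * ng + nf * sg)] to the bound,
    which is dominated by the expansion of [(nf + tau * sf) * (ng + tau * sg)]. *)
Lemma jet_normM tau k f g th : 0 <= tau -> Theta th -> dn k f -> dn k g ->
  jet_norm tau k (fun x => f x * g x) th <= jet_norm tau k f th * jet_norm tau k g th.
Proof.
move=> t0 Tth; elim: k f g => /= [|k IH] f g df dg; first by rewrite normrM.
have dfk := dnW df; have dgk := dnW dg.
set nf := jet_norm tau k f th; set ng := jet_norm tau k g th.
set sf := \sum_i jet_norm tau k (partial i f) th.
set sg := \sum_i jet_norm tau k (partial i g) th.
have nf0 : 0 <= nf by exact: jet_norm_ge0.
have ng0 : 0 <= ng by exact: jet_norm_ge0.
have sf0 : 0 <= sf by apply: sumr_ge0 => i _; exact: jet_norm_ge0.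
have sg0 : 0 <= sg by apply: sumr_ge0 => i _; exact: jet_norm_ge0.
have H : \sum_i jet_norm tau k (partial i (fun x => f x * g x)) th <=
    sf * ng + nf * sg.
  rewrite mulr_suml mulr_sumr -big_split/= ler_sum// => i _.
  rewrite (@jet_norm_ext _ _ _
    (fun x => partial i f x * g x + f x * partial i g x))//; last first.
    by move=> t Tt; rewrite partialM//; [exact: df.1|exact: dg.1].
  have h1 := dnM Theta_open (df.2 i) dgk; have h2 := dnM Theta_open dfk (dg.2 i).
  apply: le_trans (jet_normD t0 Tth h1 h2) _.
  by rewrite lerD// IH//; [exact: df.2|exact: dg.2].
have H1 := IH _ _ dfk dgk.
apply: le_trans (lerD H1 (ler_wpM2l t0 H)) _.
have : 0 <= tau * sf * (tau * sg) by rewrite !mulr_ge0.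
by rewrite -/nf -/ng; nra.
Qed.

Lemma jet_normZ tau k (c : R) f th : 0 <= tau -> Theta th -> dn k f ->
  jet_norm tau k (fun x => c * f x) th <= `|c| * jet_norm tau k f th.
Proof.
move=> t0 Tth df; rewrite -(jet_norm_cst tau k c Tth).
by apply: (@jet_normM _ _ (fun=> c)) => //; exact: dn_cst.
Qed.

Lemma jet_normB tau k f g th : 0 <= tau -> Theta th -> dn k f -> dn k g ->
  jet_norm tau k (fun x => f x - g x) th <= jet_norm tau k f th + jet_norm tau k g th.
Proof.
move=> t0 Tth df dg.
rewrite (@jet_norm_ext _ _ _ (fun x => f x + -1 * g x))//; last first.
  by move=> t _; rewrite mulN1r.
apply: le_trans (jet_normD t0 Tth df (dnZ Theta_open (-1) dg)) _.
by rewrite lerD2l (le_trans (jet_normZ (-1) t0 Tth dg))// normrN normr1 mul1r.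
Qed.

Lemma jet_norm_distC tau k f g th : 0 <= tau -> Theta th -> dn k f -> dn k g ->
  jet_norm tau k (fun x => f x - g x) th = jet_norm tau k (fun x => g x - f x) th.
Proof.
move=> t0 Tth; suff H u v : dn k u -> dn k v -> jet_norm tau k (fun x => u x - v x) th
    <= jet_norm tau k (fun x => v x - u x) th.
  by move=> df dg; apply/eqP; rewrite eq_le !H.
move=> du dv; rewrite (@jet_norm_ext _ _ _ (fun x => -1 * (v x - u x)))//.
  apply: le_trans (jet_normZ (-1) t0 Tth (dnB Theta_open dv du)) _.
  by rewrite normrN normr1 mul1r.
by move=> t _; rewrite mulN1r opprB.
Qed.

Lemma jet_norm_triangle tau k f g h th : 0 <= tau -> Theta th ->
  dn k f -> dn k g -> dn k h ->
  jet_norm tau k (fun x => f x - h x) th <=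
  jet_norm tau k (fun x => f x - g x) th + jet_norm tau k (fun x => g x - h x) th.
Proof.
move=> t0 Tth df dg dh.
rewrite (@jet_norm_ext _ _ _ (fun x => (f x - g x) + (g x - h x)))//; last first.
  by move=> t _; rewrite addrA subrK.
by apply: jet_normD => //; exact: dnB.
Qed.

(** The bound of the Neumann series: [f^-1 = 1 - (f - 1) * f^-1], so the norm
    [n] of [f^-1] satisfies [n <= 1 + s * n]. *)
Lemma jet_norm_inv_near1 tau k f s th : 0 <= tau -> Theta th -> dn k f ->
  (forall t, Theta t -> f t != 0) ->
  jet_norm tau k (fun x => f x - 1) th <= s -> s < 1 ->
  jet_norm tau k (fun x => (f x)^-1%R) th <= (1 - s)^-1.
Proof.
move=> t0 Tth df f0 fs s1.
have dV := dnV Theta_open f0 df.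
have df1 := dnB Theta_open df (dn_cst Theta_open k 1).
set n := jet_norm tau k _ th.
have n0 : 0 <= n by exact: jet_norm_ge0.
have : n <= 1 + s * n.
  rewrite {1}/n (@jet_norm_ext _ _ _ (fun x => 1 - (f x - 1) * (f x)^-1))//.
    have h := dnM Theta_open df1 dV.
    apply: le_trans (jet_normB t0 Tth (dn_cst Theta_open k 1) h) _.
    rewrite jet_norm_cst// normr1 lerD2l.
    by apply: le_trans (jet_normM t0 Tth df1 dV) _; rewrite ler_wpM2r.
  by move=> t Tt; rewrite mulrBl mulfV ?f0// mul1r opprB addrCA subrr addr0.
move=> H; rewrite -[leRHS]mul1r ler_pdivlMr ?subr_gt0//; lra.
Qed.

(** Obtained by differentiating [f^-1] into [- f' * f^-1 * f^-1] once more at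
    every order. *)
Fixpoint inv_bound k (A B : R) : R :=
  if k is j.+1 then inv_bound j A B + B * (inv_bound j A B * inv_bound j A B)
  else A.

Lemma inv_bound_ge0 k A B : 0 <= A -> 0 <= B -> 0 <= inv_bound k A B.
Proof. by move=> A0 B0; elim: k => //= k IH; rewrite addr_ge0// !mulr_ge0. Qed.

Lemma jet_norm_inv tau k f A B th : 0 <= tau -> Theta th -> dn k f ->
  (forall t, Theta t -> f t != 0) ->
  `|(f th)^-1| <= A -> jet_norm tau k f th <= B ->
  jet_norm tau k (fun x => (f x)^-1%R) th <= inv_bound k A B.
Proof.
move=> t0 Tth + f0 fA; elim: k => //= k IH df fB.
have A0 : 0 <= A by apply: le_trans fA.
have dV := dnV Theta_open f0 (dnW df).
have s0 : 0 <= \sum_i jet_norm tau k (partial i f) th.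
  by apply: sumr_ge0 => i _; exact: jet_norm_ge0.
have fB1 : jet_norm tau k f th <= B.
  by apply: le_trans fB; rewrite lerDl mulr_ge0.
have fB2 : tau * \sum_i jet_norm tau k (partial i f) th <= B.
  by apply: le_trans fB; rewrite lerDr jet_norm_ge0.
have B0 : 0 <= B by apply: le_trans fB1; exact: jet_norm_ge0.
have n0 : 0 <= jet_norm tau k (fun x => (f x)^-1%R) th by exact: jet_norm_ge0.
have {}IH := IH (dnW df) fB1.
rewrite lerD//.
apply: (@le_trans _ _ (tau * (\sum_i jet_norm tau k (partial i f) th) *
   (inv_bound k A B * inv_bound k A B))); last first.
  by rewrite ler_wpM2r// mulr_ge0// inv_bound_ge0.
rewrite -mulrA ler_wpM2l// mulr_suml ler_sum// => i _.
have p0 : 0 <= jet_norm tau k (partial i f) th by exact: jet_norm_ge0.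
rewrite (@jet_norm_ext _ _ _ (fun x => (-1 * partial i f x) * ((f x)^-1 * (f x)^-1)))//.
  have h2 := dnM Theta_open dV dV.
  have h1 := dnZ Theta_open (-1) (df.2 i).
  apply: le_trans (jet_normM t0 Tth h1 h2) _.
  apply: ler_pM => //; [exact: jet_norm_ge0|exact: jet_norm_ge0| |].
    by rewrite (le_trans (jet_normZ (-1) t0 Tth (df.2 i)))// normrN normr1 mul1r.
  apply: le_trans (jet_normM t0 Tth dV dV) _.
  by apply: ler_pM.
by move=> t Tt; rewrite partialV//; [rewrite mulN1r|exact: f0|exact: df.1].
Qed.

(** Only the value of [ln f] is not controlled by the jets of [f - 1] and
    [f^-1]: its derivatives are products of those of [f - 1] with [f^-1]. *)
Lemma jet_norm_ln tau k f th : 0 <= tau -> Theta th -> dn k f ->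
  (forall t, Theta t -> 0 < f t) ->
  jet_norm tau k (fun x => ln (f x)) th <= `|ln (f th)| +
    k%:R * (jet_norm tau k (fun x => f x - 1) th *
            jet_norm tau k (fun x => (f x)^-1%R) th).
Proof.
move=> t0 Tth + f0; have fn0 t : Theta t -> f t != 0 by move/f0/lt0r_neq0.
elim: k => [|k IH] df; first by rewrite mul0r addr0.
have dfk := dnW df; have dV := dnV Theta_open fn0 df.
have df1 := dnB Theta_open df (dn_cst Theta_open k.+1 1).
rewrite [leLHS]/= -natr1 mulrDl mul1r addrA lerD//.
  apply: le_trans (IH dfk) _; rewrite lerD2l ler_wpM2l//.
  by apply: ler_pM; do ?exact: jet_norm_ge0; exact: jet_norm_leS.
apply: (@le_trans _ _ ((tau * \sum_i jet_norm tau k (partial i (fun x => f x - 1)) th)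
    * jet_norm tau k (fun x => (f x)^-1%R) th)); last first.
  apply: ler_pM; rewrite ?jet_norm_ge0//; last exact: jet_norm_leS.
    by rewrite mulr_ge0// sumr_ge0// => i _; exact: jet_norm_ge0.
  exact: jet_norm_partial.
rewrite -mulrA ler_wpM2l// mulr_suml ler_sum// => i _.
rewrite (@jet_norm_ext _ _ _ (fun x => partial i (fun x => f x - 1) x * (f x)^-1))//.
  by apply: jet_normM => //; [exact: df1.2|exact: dnW].
move=> t Tt; rewrite (differentiable_ln_comp (f0 _ Tt) (df.1 _ Tt)).2; congr (_ * _).
have dc := @differentiable_cst _ _ R (-1) t.
by rewrite (partialD i (df.1 t Tt) dc) partial_cst addr0.
Qed.

Lemma jet_norm_rescale tau k f th : 0 < tau <= 1 ->
  jet_norm 1 k f th <= (tau^-1) ^+ k * jet_norm tau k f th.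
Proof.
move=> /andP[t0 t1]; have ti1 : 1 <= tau^-1 by rewrite invf_ge1.
elim: k f => /= [|k IH] f; first by rewrite expr0 mul1r.
rewrite mul1r mulrDr lerD//.
  apply: le_trans (IH f) _; rewrite ler_wpM2r//; last exact: ler_weXn2l.
  by apply: jet_norm_ge0; exact: ltW.
rewrite mulrA exprS [_ * tau]mulrC mulrA mulfV ?lt0r_neq0// mul1r mulr_sumr.
by rewrite ler_sum.
Qed.

Lemma jet_norm_le_tau tau tau' k f th : 0 <= tau <= tau' ->
  jet_norm tau k f th <= jet_norm tau' k f th.
Proof.
move=> /andP[t0 t1]; elim: k f => //= k IH f; rewrite lerD// ler_pM//.
  by rewrite sumr_ge0// => i _; exact: jet_norm_ge0.
by rewrite ler_sum.
Qed.

Definition word_partial (w : seq 'I_d) f := foldr (@partial R d) f w.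

(** The binomial formula: the words of length [j] number [d ^ j], and each enters
    with the weight [tau ^+ j * 'C(k, j)]. *)
Lemma jet_norm_words tau k f th a b : 0 <= tau -> 0 <= a -> 0 <= b ->
  (forall w, (size w <= k)%N -> `|word_partial w f th| <= a * b ^+ size w) ->
  jet_norm tau k f th <= a * (1 + d%:R * tau * b) ^+ k.
Proof.
move=> t0 + b0; elim: k f a => [|k IH] f a a0 H.
  by have := H [::] isT; rewrite /= !expr0.
rewrite /= exprS mulrCA mulrDl mul1r lerD//.
  by apply: IH => // w wk; apply: H; rewrite (leq_trans wk).
apply: (@le_trans _ _ (tau * \sum_(i < d) (a * b) * (1 + d%:R * tau * b) ^+ k)).
  rewrite ler_wpM2l// ler_sum// => i _; apply: IH; first exact: mulr_ge0.
  move=> w wk; have := H (rcons w i); rewrite size_rcons ltnS => /(_ wk).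
  by rewrite /word_partial foldr_rcons exprS mulrA.
rewrite sumr_const card_ord -mulr_natl.
rewrite le_eqVlt; apply/orP; left; apply/eqP; ring.
Qed.

End jet_norm.

(** * Symmetry of the partial derivatives *)

Section symmetry.
Context {R : realType} {d : nat}.
Variable (Theta : set 'rV[R]_d).
Hypothesis Theta_open : open Theta.
Implicit Types (f g : 'rV[R]_d -> R) (th : 'rV[R]_d) (i j : 'I_d).

Local Notation dn := (fun k f => differentiable_n k f Theta).
Local Notation e_ := (fun i => delta_mx ord0 i : 'rV[R]_d).

Lemma norm_delta_le i : `|e_ i| <= 1.
Proof.
rewrite [leLHS]/Num.norm/= mx_normrE; apply: bigmax_le => // -[a b] _ /=.
by rewrite mxE; case: (_ && _); rewrite ?normr1 ?normr0.
Qed.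

(** The second difference quotient tends to the mixed derivative. Only the
    differentiability of the first derivatives at the point is available, not
    their continuity, so the mean value inequality is applied to the difference
    of [f] along two parallel segments, corrected by the expected value. *)
Lemma second_difference f th i j e : dn 2 f -> Theta th -> 0 < e ->
  exists2 r, 0 < r & forall t, 0 < t < r ->
  `|(f (th + t *: e_ j + t *: e_ i) - f (th + t *: e_ i))
    - (f (th + t *: e_ j) - f th)
    - t ^+ 2 * partial j (partial i f) th| <= e * t ^+ 2.
Proof.
move=> df Tth e0; have [r0 r00 Tr] := open_ball_subset Theta_open Tth.
pose g := partial i f; have dg : differentiable g th := (df.2 i).1 th Tth.
have e3 : 0 < e / 3 by rewrite divr_gt0.
have [r1 r10 H] := differentiable_has_gradient dg e3.
(* The points below lie within [2 * t] of [th]. *)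
pose r := Num.min r0 r1 / 2; have r_gt0 : 0 < r.
  by rewrite divr_gt0// lt_min r00.
exists r => // t /andP[t0 tr]; set c := partial j _ th.
have t_small : 2 * t < r0 /\ 2 * t < r1.
  move: tr; rewrite /r ltr_pdivlMr// mulrC lt_min => /andP[-> ->]//.
pose y (s : R) := th + s *: (t *: e_ i).
have ys_norm s : 0 <= s <= 1 -> `|s *: (t *: e_ i)| <= t.
  move=> /andP[s0 s1]; rewrite normrZ ger0_norm// normrZ (ger0_norm (ltW t0)).
  by rewrite mulrCA ger_pMr// mulr_ile1// norm_delta_le.
have yt_norm s : 0 <= s <= 1 -> `|s *: (t *: e_ i) + t *: e_ j| <= 2 * t.
  move=> s01; apply: le_trans (ler_normD _ _) _; rewrite mulr_natl mulr2n.
  rewrite lerD ?ys_norm// normrZ (ger0_norm (ltW t0)) ler_piMr ?norm_delta_le//.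
  exact: ltW.
have yT s : 0 <= s <= 1 -> Theta (y s).
  move=> s01; apply: Tr; apply: le_lt_trans (ys_norm _ s01) _.
  by apply: lt_trans t_small.1; lra.
have ytT s : 0 <= s <= 1 -> Theta (th + t *: e_ j + s *: (t *: e_ i)).
  move=> s01; rewrite -addrA [t *: _ + _]addrC; apply: Tr.
  exact: le_lt_trans (yt_norm _ s01) t_small.1.
have pe (a : 'I_d -> R) k (u : R) : pairing a (u *: e_ k) = u * a k.
  by rewrite linearZ/= pairing_delta.
(* The derivative in [s] of the difference between the two parallel segments,
   from which the expected value is removed. *)
pose dphi s := t * g (th + t *: e_ j + s *: (t *: e_ i)) - t * g (y s) - t ^+ 2 * c.
have := @mean_value_unit R
  (fun s => f (th + t *: e_ j + s *: (t *: e_ i)) - f (y s) - s * (t ^+ 2 * c))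
  dphi (e * t ^+ 2).
rewrite /y !scale1r !scale0r !addr0 mul0r subr0 mul1r => M.
rewrite [leLHS](_ : _ = `|f (th + t *: e_ j + t *: e_ i) - f (th + t *: e_ i) -
  t ^+ 2 * c - (f (th + t *: e_ j) - f th)|); last by rewrite addrAC.
apply: M => s s01.
- have d1 := is_derive_line (df.1 _ (ytT _ s01)).
  have d2 := is_derive_line (df.1 _ (yT _ s01)).
  have d3 : is_derive s 1 (fun s : R => s * (t ^+ 2 * c)) (t ^+ 2 * c).
    have h : is_derive s 1 (@id R) 1 := is_derive_id s 1.
    have -> : (fun s : R => s * (t ^+ 2 * c)) = (t ^+ 2 * c) \*: @id R.
      by apply/funext => u; rewrite /= mulrC.
    by apply: is_derive_eq; rewrite -[_ *: _]/(_ * _) mulr1.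
  have d12 := is_deriveB d1 d2; have d123 := is_deriveB d12 d3.
  by rewrite !pe in d123.
- have H1 := H _ (le_lt_trans (yt_norm _ s01) t_small.2).
  have t1 : t < r1 by apply: lt_trans t_small.2; lra.
  have H2 := H _ (le_lt_trans (ys_norm _ s01) t1).
  rewrite linearD/= !scalerA !pe -/c in H1; rewrite !scalerA !pe in H2.
  rewrite addrA addrAC in H1.
  have n1 := yt_norm _ s01; have n2 := ys_norm _ s01; rewrite !scalerA in n1 n2.
  rewrite /dphi /y !scalerA.
  move: H1 H2 n1 n2; set A := g _; set B := g (_ + (s * t) *: e_ i).
  set G := g th; set N1 := `|_ *: _ + _ *: _|; set N2 := `|_ *: _|; set k := s * t * _.
  move=> H1 H2 n1 n2.
  have -> : t * A - t * B - t ^+ 2 * c =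
    t * ((A - G - (k + t * c)) - (B - G - k)) by ring.
  rewrite normrM (ger0_norm (ltW t0)) expr2 mulrCA ler_wpM2l ?(ltW t0)//.
  apply: le_trans (ler_normB _ _) _.
  apply: le_trans (lerD H1 H2) _; rewrite -mulrDr.
  have : N1 + N2 <= 3 * t by lra.
  move: (N1 + N2) => N HN; have := ler_wpM2l (ltW e3) HN; lra.
Qed.

(** The second difference is symmetric in [i] and [j]. *)
Lemma partialC i j f th : dn 2 f -> Theta th ->
  partial i (partial j f) th = partial j (partial i f) th.
Proof.
move=> df Tth; apply/eqP; rewrite -subr_eq0 -normr_le0.
apply/ler_addgt0Pl => e e0; rewrite addr0.
have e2 : 0 < e / 2 by rewrite divr_gt0.
have [r r0 H1] := second_difference i j df Tth e2.
have [s s0 H2] := second_difference j i df Tth e2.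
pose t := Num.min r s / 2; have t0 : 0 < t by rewrite divr_gt0// lt_min r0.
have trs : t < r /\ t < s.
  have : Num.min r s <= r /\ Num.min r s <= s by rewrite !ge_min !lexx orbT.
  by rewrite /t => -[m1 m2]; split; have := t0; rewrite /t; lra.
have {}H1 := H1 t; rewrite t0 trs.1 in H1; have {}H1 := H1 isT.
have {}H2 := H2 t; rewrite t0 trs.2 in H2; have {}H2 := H2 isT.
rewrite [th + t *: _ + t *: delta_mx ord0 j]addrAC in H2.
move: H1 H2; set a := partial j _ th; set b := partial i _ th.
set F11 := f (_ + _ + _); set F10 := f _; set F01 := f _; set F00 := f th.
set D := F11 - F10 - (F01 - F00).
rewrite (_ : F11 - F01 - (F10 - F00) = D); last by rewrite /D; ring.
move=> H1 H2.
have t2 : 0 < t ^+ 2 by rewrite exprn_gt0.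
rewrite -(ler_pM2l t2) -{1}(ger0_norm (ltW t2)) -normrM.
have -> : t ^+ 2 * (b - a) = (D - t ^+ 2 * a) - (D - t ^+ 2 * b) by ring.
apply: le_trans (ler_normB _ _) _; apply: le_trans (lerD H1 H2) _.
by rewrite le_eqVlt; apply/orP; left; apply/eqP; field.
Qed.

Local Notation iterp := (fun n i f => iter n (@partial R d i) f).
(** The expression that defines [multi_partial], over an arbitrary list of
    directions, so as to allow an induction on that list. *)
Definition partial_seq s (al : 'I_d -> nat) f :=
  foldr (fun i g => iter (al i) (@partial R d i) g) f s.
Local Notation mp := partial_seq.

Lemma partial_seq_cons i s al f : mp (i :: s) al f = iterp (al i) i (mp s al f).
Proof. by []. Qed.

Lemma iter_partial_ext n i f g : (forall t, Theta t -> f t = g t) ->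
  forall t, Theta t -> iterp n i f t = iterp n i g t.
Proof.
by move=> fg; elim: n => //= n IH; apply: (partial_ext Theta_open).
Qed.

Lemma dn_iter_partial n k i f : dn (n + k)%N f -> dn k (iterp n i f).
Proof.
elim: n k => [//|n IH] k df; rewrite iterS; apply: dn_partial.
by apply: IH; rewrite addnS -addSn.
Qed.

Lemma dn_multi s al k f : dn (\sum_(i <- s) al i + k)%N f -> dn k (mp s al f).
Proof.
elim: s k => [|i s IH] k; first by rewrite big_nil.
rewrite big_cons partial_seq_cons => df; apply: dn_iter_partial; apply: IH.
by rewrite addnCA addnA.
Qed.

Lemma partial_iterC n i j f : dn n.+1 f ->
  forall t, Theta t -> partial i (iterp n j f) t = iterp n j (partial i f) t.
Proof.
elim: n => [//|n IH] df t Tt; rewrite !iterS.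
rewrite partialC//; last by apply: dn_iter_partial; rewrite addn2.
by apply: (partial_ext Theta_open) => // u Tu; apply: IH => //; exact: dnW.
Qed.

Lemma partial_multiC s al i f : dn (\sum_(i <- s) al i).+1 f ->
  forall t, Theta t -> partial i (mp s al f) t = mp s al (partial i f) t.
Proof.
elim: s => [//|j s IH] df t Tt; rewrite big_cons in df.
rewrite partial_seq_cons partial_iterC//; last first.
  by apply: dn_multi; rewrite addnS addnC.
apply: iter_partial_ext => // u Tu; apply: IH => //.
by apply: dn_le df; rewrite ltnS leq_addl.
Qed.

Lemma multi_add_partial s al be i f : uniq s -> i \in s ->
  (forall j, be j = al j + (j == i))%N ->
  dn (\sum_(i <- s) al i).+1 f ->
  forall t, Theta t -> mp s be f t = mp s al (partial i f) t.
Proof.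
move=> + + beE; elim: s => [//|j s IH]; rewrite cons_uniq => /andP[js us].
rewrite inE big_cons !partial_seq_cons.
have [ij _ df t Tt|ij i_s df t Tt] := eqVneq i j; last first.
  rewrite beE eq_sym (negPf ij) addn0; apply: iter_partial_ext => // u Tu.
  by apply: IH => //; apply: dn_le df; rewrite ltnS leq_addl.
move: js df; rewrite -ij => js df.
rewrite beE eqxx addn1 iterSr; apply: iter_partial_ext => // u Tu.
have -> : mp s be f = mp s al f.
  elim: s js {us IH df} => [//|k s IH]; rewrite !partial_seq_cons inE negb_or => /andP[ik /IH->].
  by rewrite beE eq_sym (negPf ik) addn0.
by apply: partial_multiC => //; apply: dn_le df; rewrite ltnS leq_addl.
Qed.

Lemma multi_deg_count (w : seq 'I_d) :
  multi_deg [ffun i => count_mem i w] = size w.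
Proof.
rewrite /multi_deg; elim: w => [|i w IH] /=; first by rewrite big1// => i _; rewrite ffunE.
rewrite -IH (eq_bigr (fun j => (i == j) + [ffun j => count_mem j w] j)%N); last first.
  by move=> j _; rewrite !ffunE.
by rewrite big_split/= (bigD1 i)//= eqxx big1 ?addn0 ?add1n// => j; rewrite eq_sym => /negPf->.
Qed.

(** A seminorm built by recursion sees the derivatives as words of directions,
    whereas the conditions on the model are about sorted multi-indices. *)
Lemma word_partial_multi k f w : dn k f -> (size w <= k)%N ->
  forall t, Theta t -> word_partial w f t = multi_partial [ffun i => count_mem i w] f t.
Proof.
elim: w k f => [|i w IH] k f df wk t Tt.
  rewrite /multi_partial /= .
  elim: (enum _) => //= i s ->; by rewrite ffunE.
case: k df wk => [//|k] df wk; rewrite -[word_partial _ _]/(partial i (word_partial w f)).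
rewrite (@partial_ext _ _ _ Theta_open _ _ (multi_partial [ffun i => count_mem i w] f))//; last first.
  by apply: (IH k.+1) => //; rewrite ltnW.
have S : (\sum_(j <- enum 'I_d) [ffun i => count_mem i w] j = size w)%N.
  by rewrite -multi_deg_count /multi_deg big_enum.
rewrite /multi_partial -!/(mp _ _ _) partial_multiC//; last by rewrite S; apply: dn_le df.
apply/esym; apply: multi_add_partial => //; rewrite ?enum_uniq ?mem_enum//.
  by move=> j; rewrite !ffunE/= addnC eq_sym.
by rewrite S; apply: dn_le df.
Qed.

End symmetry.

(** * Differentiation under the integral *)

Section real_integrals.
Context {R : realType} {dT : measure_display} {T : measurableType dT}.
Variable mu : {measure set T -> \bar R}.
Implicit Types f g b : T -> R.

Lemma integrable_dominated f b : measurable_fun setT f ->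
  (forall z, `|f z| <= b z) -> mu.-integrable setT (EFin \o b) ->
  mu.-integrable setT (EFin \o f).
Proof.
move=> mf fb ib; apply: le_integrable ib => //; first exact/measurable_EFinP.
by move=> z _ /=; rewrite lee_fin (le_trans (fb z))// ler_norm.
Qed.

Lemma integrable_measurable f : mu.-integrable setT (EFin \o f) ->
  measurable_fun setT f.
Proof. by case/integrableP => /measurable_EFinP. Qed.

Lemma integrableDr f g : mu.-integrable setT (EFin \o f) ->
  mu.-integrable setT (EFin \o g) ->
  mu.-integrable setT (EFin \o (fun z => f z + g z)).
Proof. by move=> fi gi; exact: (integrableD measurableT fi gi). Qed.

Lemma integrableBr f g : mu.-integrable setT (EFin \o f) ->
  mu.-integrable setT (EFin \o g) ->
  mu.-integrable setT (EFin \o (fun z => f z - g z)).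
Proof. by move=> fi gi; exact: (integrableB measurableT fi gi). Qed.

Lemma integrableZlr c f : mu.-integrable setT (EFin \o f) ->
  mu.-integrable setT (EFin \o (fun z => c * f z)).
Proof. by move=> fi; exact: (integrableZl measurableT c fi). Qed.

Lemma integrable_sumr I (s : seq I) (F : I -> T -> R) :
  (forall i, mu.-integrable setT (EFin \o F i)) ->
  mu.-integrable setT (EFin \o (fun z => \sum_(i <- s) F i z)).
Proof.
move=> Fi; elim: s => [|i s IH].
  under [X in EFin \o X]funext do rewrite big_nil; exact: integrable0.
under [X in EFin \o X]funext do rewrite big_cons; exact: integrableDr.
Qed.

Lemma Rintegral_sum I (s : seq I) (F : I -> T -> R) :
  (forall i, mu.-integrable setT (EFin \o F i)) ->
  \int[mu]_z (\sum_(i <- s) F i z) = \sum_(i <- s) \int[mu]_z F i z.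
Proof.
move=> Fi; elim: s => [|i s IH].
  under eq_Rintegral do rewrite big_nil.
  by rewrite big_nil /Rintegral integral0.
under eq_Rintegral do rewrite big_cons.
by rewrite big_cons -IH RintegralD//; exact: integrable_sumr.
Qed.

Lemma Rintegral_dominated_cvg (f_ : nat -> T -> R) f b :
  (forall n, measurable_fun setT (f_ n)) ->
  (forall z, f_ ^~ z @ \oo --> f z) ->
  (forall n z, `|f_ n z| <= b z) -> mu.-integrable setT (EFin \o b) ->
  (fun n => \int[mu]_z f_ n z) @ \oo --> \int[mu]_z f z.
Proof.
move=> mf_ f_f f_b ib.
have mf : measurable_fun setT f by apply: measurable_fun_cvg => // z _; exact: f_f.
have [] := @dominated_convergence _ T R mu setT measurableT (fun n => EFin \o f_ n)
  (EFin \o f) (EFin \o b).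
- by move=> n; exact/measurable_EFinP.
- exact/measurable_EFinP.
- apply: aeW => z _; apply: cvg_EFin; last exact: f_f.
  by apply: nearW.
- exact: ib.
- by apply: aeW => z n _; rewrite /= lee_fin.
move=> fi _ cv; rewrite /Rintegral; apply: fine_cvg.
rewrite fineK//; exact: integrable_fin_num.
Qed.

End real_integrals.

Lemma Rintegral_probability_cst (R : realType) dT (T : measurableType dT)
    (m : probability T R) (c : R) :
  \int[m]_x c = c.
Proof.
have m1 : m setT = 1%E := probability_setT m.
by rewrite Rintegral_cst// [X in fine X]m1 mulr1.
Qed.

Section under_integral.
Context {R : realType} {d : nat}.
Variable (Theta : set 'rV[R]_d).
Hypothesis Theta_open : open Theta.
Context {dT : measure_display} {T : measurableType dT}.
Variable mu : {measure set T -> \bar R}.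
Implicit Types (h : T -> 'rV[R]_d -> R) (b : T -> R) (th : 'rV[R]_d).

Local Notation dn := (fun k f => differentiable_n k f Theta).

(** The hypotheses of the differentiation under the integral, up to the order
    [k], of [h] depending on the parameter and on the integration variable: one
    integrable bound serves all the derivatives and all the parameters. *)
Definition dominated_family k h b :=
  [/\ forall z, dn k (h z),
      forall th, Theta th -> measurable_fun setT (fun z => h z th),
      forall z th, Theta th -> jet_norm 1 k (h z) th <= b z
    & mu.-integrable setT (EFin \o b)].

Lemma dominated_familyW k h b : dominated_family k.+1 h b -> dominated_family k h b.
Proof.
case=> dh mh hb ib; split => // [z|z th Tth]; first exact: dnW.
by apply: le_trans (hb z th Tth); exact: jet_norm_leS.
Qed.

(** A partial derivative is a pointwise limit of difference quotients. *)
Lemma measurable_partial i h th : Theta th ->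
  (forall z, differentiable (h z) th) ->
  (forall th, Theta th -> measurable_fun setT (fun z => h z th)) ->
  measurable_fun setT (fun z => partial i (h z) th).
Proof.
move=> Tth dh mh; have [r r0 Tr] := open_ball_subset Theta_open Tth.
(* The shift by [N] keeps all the increments inside [Theta]. *)
pose N := (Num.trunc r^-1).+1.
pose v n : 'rV[R]_d := ((n + N).+1%:R^-1 : R) *: delta_mx ord0 i.
have Nr n : (n + N).+1%:R^-1 < r.
  rewrite invf_plt ?posrE//; apply: lt_le_trans (truncnS_gt _) _.
  by rewrite ler_nat -/N leqW// leq_addl.
have vn n : `|v n| <= (n + N).+1%:R^-1.
  rewrite normrZ ger0_norm// ler_piMr//; exact: norm_delta_le.
apply: (@measurable_fun_cvg _ _ _ _
  (fun n z => (n + N).+1%:R * (h z (th + v n) - h z th))).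
  move=> n; apply: measurable_funM => //; apply: measurable_funB; apply: mh => //.
  by apply: Tr; exact: le_lt_trans (vn n) (Nr n).
move=> z _; apply/cvgrPdist_le => e e0.
have [s s0 H] := differentiable_has_gradient (dh z) e0.
exists (Num.trunc s^-1).+1 => //= n /= sn.
have vs : `|v n| < s.
  apply: le_lt_trans (vn n) _; rewrite invf_plt ?posrE//.
  apply: lt_le_trans (truncnS_gt _) _.
  by rewrite ler_nat (leq_trans sn)// ltnW// ltnS leq_addr.
have {H} := H _ vs; rewrite /v linearZ/= pairing_delta => H.
rewrite distrC.
have n0 : (n + N).+1%:R != 0 :> R by rewrite pnatr_eq0.
set D := h z _ - h z th in H *.
rewrite (_ : _ * D - _ = (n + N).+1%:R * (D - (n + N).+1%:R^-1 *
    partial i (h z) th)); last by rewrite [RHS]mulrBr mulVKf.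
rewrite normrM ger0_norm// -ler_pdivlMl ?ltr0n//.
apply: le_trans H _; rewrite mulrC ler_wpM2r ?(ltW e0)//; exact: vn.
Qed.

Lemma sum_partial_le k h b z th : dominated_family k.+1 h b -> Theta th ->
  \sum_i `|partial i (h z) th| <= b z.
Proof.
case=> dh mh hb ib Tth; apply: le_trans (hb z th Tth).
apply: le_trans (jet_norm_partial _ _ _ ler01); rewrite mul1r ler_sum// => i _.
exact: normr_jet_norm.
Qed.

Lemma dominated_family_partial k i h b :
  dominated_family k.+1 h b -> dominated_family k (fun z => partial i (h z)) b.
Proof.
case=> dh mh hb ib; split => // [z|th Tth|z th Tth].
- exact: (dh z).2.
- by apply: measurable_partial => // z; exact: (dh z).1.
- apply: le_trans (hb z th Tth).
  apply: le_trans (jet_norm_partial _ _ _ ler01); rewrite mul1r (bigD1 i)//=.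
  by rewrite lerDl sumr_ge0// => j _; exact: jet_norm_ge0.
Qed.

Lemma dominated_family_integrable k h b th : dominated_family k h b -> Theta th ->
  mu.-integrable setT (EFin \o (fun z => h z th)).
Proof.
case=> dh mh hb ib Tth; apply: integrable_dominated ib; first exact: mh.
move=> z; apply: le_trans (hb z th Tth); exact: normr_jet_norm.
Qed.

(** By contradiction: if the remainder is not [o(v)], there are increments [v n]
    that tend to 0 along which it is not, while the normalized remainders under
    the integral tend to 0 pointwise and are dominated by [2 * b], by the mean
    value inequality. *)
Lemma has_gradient_integral k h b th : dominated_family k.+1 h b -> Theta th ->
  has_gradient (fun th => \int[mu]_z h z th)
    (fun i => \int[mu]_z partial i (h z) th) th.
Proof.
move=> H Tth; have [dh mh hb ib] := H.
have ih t : Theta t -> mu.-integrable setT (EFin \o (fun z => h z t)).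
  exact: dominated_family_integrable H.
have ip i : mu.-integrable setT (EFin \o (fun z => partial i (h z) th)).
  exact: dominated_family_integrable (dominated_family_partial i H) Tth.
have [r r0 Tr] := open_ball_subset Theta_open Tth.
move=> e e0; apply: contrapT => nH.
have {nH} /choice[v vP] (n : nat) : exists v : 'rV[R]_d,
    [/\ `|v| < r, `|v| < n.+1%:R^-1 & e * `|v| <
    `|\int[mu]_z h z (th + v) - \int[mu]_z h z th -
      pairing (fun i => \int[mu]_z partial i (h z) th) v|].
  apply: contrapT => nv; apply: nH; exists (Num.min r n.+1%:R^-1).
    by rewrite lt_min r0 invr_gt0 ltr0n.
  move=> v; rewrite lt_min => /andP[vr vn]; rewrite leNgt; apply/negP => lt.
  by apply: nv; exists v.
pose phi n z := `|h z (th + v n) - h z th -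
  pairing (fun i => partial i (h z) th) (v n)| / `|v n|.
have v0 n : 0 < `|v n|.
  have [_ _ L] := vP n; rewrite lt_neqAle normr_ge0 andbT eq_sym.
  apply/negP => /eqP/normr0_eq0 E; move: L; rewrite E normr0 mulr0 addr0 subrr.
  by rewrite add0r normrN /pairing big1 ?normr0 ?ltxx// => i _; rewrite mxE mul0r.
have phi_le n z : `|phi n z| <= 2 * b z.
  rewrite ger0_norm ?divr_ge0// ler_pdivrMr//.
  apply: le_trans (ler_normB _ _) _; rewrite mulr_natl mulr2n mulrDl lerD//.
    apply: mean_value_ball (Tr) _ _ _ _ => //; last by case: (vP n).
    - by move=> t Tt; exact: (dh z).1.
    - by move=> t Tt; exact: sum_partial_le H Tt.
  apply: le_trans (pairing_le _ _) _; rewrite mulrC ler_wpM2r//.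
  exact: sum_partial_le H Tth.
have mphi n : measurable_fun setT (phi n).
  apply: measurable_funM => //; apply: measurableT_comp => //.
  apply: measurable_funB.
    by apply: measurable_funB; apply: mh => //; apply: Tr; case: (vP n).
  apply: measurable_sum => i; apply: measurable_funM => //.
  by have [_ m _ _] := dominated_family_partial i H; exact: m.
have phi0 z : phi ^~ z @ \oo --> 0.
  apply/cvgrPdist_le => a a0.
  have [s s0 G] := differentiable_has_gradient ((dh z).1 th Tth) a0.
  exists (Num.trunc s^-1).+1 => //= n /= sn.
  rewrite sub0r normrN ger0_norm ?divr_ge0// ler_pdivrMr//; apply: G.
  have [_ vn _] := vP n; apply: lt_le_trans vn _.
  rewrite invf_ple ?posrE ?ltr0n//; apply: le_trans (ltW (truncnS_gt _)) _.
  by rewrite ler_nat ltnW.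
have := @Rintegral_dominated_cvg _ _ _ mu phi (fun=> 0) (fun z => 2 * b z)
  mphi phi0 phi_le (integrableZlr 2 ib).
rewrite {2}/Rintegral integral0 => /cvgrPdist_lt/(_ e e0)[n _ /(_ n (leqnn n))].
rewrite /= sub0r normrN; apply/negP; rewrite -leNgt.
apply: (@le_trans _ _ (\int[mu]_z phi n z)); last exact: ler_norm.
have [vr _ L] := vP n.
have iphi : mu.-integrable setT (EFin \o phi n).
  by apply: integrable_dominated (integrableZlr 2 ib).
have ihv := ih _ (Tr _ vr).
have iD := integrableBr ihv (ih _ Tth).
have iP : mu.-integrable setT
    (EFin \o (fun z => pairing (fun i => partial i (h z) th) (v n))).
  by apply: integrable_sumr => i; exact: integrableZlr.
have E : \int[mu]_z h z (th + v n) - \int[mu]_z h z th -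
    pairing (fun i => \int[mu]_z partial i (h z) th) (v n) =
  \int[mu]_z (h z (th + v n) - h z th - pairing (fun i => partial i (h z) th) (v n)).
  rewrite [RHS](RintegralB measurableT iD iP).
  rewrite (RintegralB measurableT ihv (ih _ Tth)).
  rewrite [in RHS]/pairing Rintegral_sum; last by move=> i; exact: integrableZlr.
  by congr (_ - _); apply: eq_bigr => i _; rewrite RintegralZl.
rewrite -(ler_pM2r (v0 n)); apply: le_trans (ltW L) _; rewrite E.
apply: le_trans (le_normr_Rintegral _ _) _ => //; first exact: integrableBr.
rewrite -RintegralZr//; apply: le_Rintegral => //.
- by have := integrable_norm (integrableBr iD iP).
- rewrite (_ : _ \o _ = EFin \o (fun z => `|v n| * phi n z)).
    exact: integrableZlr.
  by apply/funext => z /=; rewrite mulrC.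
- by move=> z _; rewrite /phi divfK ?lt0r_neq0.
Qed.

Lemma dn_integral k h b : dominated_family k h b ->
  dn k (fun th => \int[mu]_z h z th).
Proof.
elim: k h => // k IH h H; split.
  by move=> th Tth; have [] := has_gradient_differentiable (has_gradient_integral H Tth).
move=> i; apply: (dn_ext Theta_open _ (IH _ (dominated_family_partial i H))) => t Tt.
by have [_ ->] := has_gradient_differentiable (has_gradient_integral H Tt).
Qed.

Lemma partial_integral k h b i th : dominated_family k.+1 h b -> Theta th ->
  partial i (fun th => \int[mu]_z h z th) th = \int[mu]_z partial i (h z) th.
Proof.
by move=> H Tth; have [_ ->] := has_gradient_differentiable (has_gradient_integral H Tth).
Qed.

Lemma measurable_jet_norm tau k h b th : dominated_family k h b -> Theta th ->
  measurable_fun setT (fun z => jet_norm tau k (h z) th).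
Proof.
move=> + Tth; elim: k h => [|k IH] h H.
  by case: H => _ mh _ _; apply: measurableT_comp => //; exact: mh.
apply: measurable_funD; first exact: IH (dominated_familyW H).
apply: measurable_funM => //; apply: measurable_sum => i.
exact: IH (dominated_family_partial i H).
Qed.

Lemma integrable_jet_norm tau k h b th : 0 <= tau <= 1 -> dominated_family k h b ->
  Theta th -> mu.-integrable setT (EFin \o (fun z => jet_norm tau k (h z) th)).
Proof.
move=> /[dup] t01 /andP[t0 t1] H Tth; have [dh mh hb ib] := H.
apply: integrable_dominated ib; first exact: measurable_jet_norm H Tth.
move=> z; rewrite ger0_norm ?jet_norm_ge0//.
by apply: le_trans (hb z th Tth); exact: jet_norm_le_tau.
Qed.

(** The triangle inequality for integrals, at every order of differentiation. *)
Lemma jet_norm_integral tau k h b th : 0 <= tau <= 1 -> dominated_family k h b ->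
  Theta th -> jet_norm tau k (fun th => \int[mu]_z h z th) th <=
    \int[mu]_z jet_norm tau k (h z) th.
Proof.
move=> /[dup] t01 /andP[t0 t1] + Tth; elim: k h => [|k IH] h H.
  by apply: le_normr_Rintegral => //; exact: dominated_family_integrable H Tth.
have ij i := integrable_jet_norm t01 (dominated_family_partial i H) Tth.
rewrite [leLHS]/= [leRHS]/= RintegralD//; last 2 first.
- exact: integrable_jet_norm t01 (dominated_familyW H) Tth.
- by apply: integrableZlr; exact: integrable_sumr.
rewrite lerD//; first exact: IH (dominated_familyW H).
rewrite RintegralZl//; last exact: integrable_sumr.
rewrite Rintegral_sum// ler_wpM2l// ler_sum// => i _.
apply: le_trans (IH _ (dominated_family_partial i H)).
rewrite le_eqVlt; apply/orP; left; apply/eqP; apply: (jet_norm_ext Theta_open) => // t Tt.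
exact: partial_integral H Tt.
Qed.

End under_integral.

(** * Doeblin contraction for families of smooth functions *)

Section jet_norm_extra.
Context {R : realType} {d : nat}.
Variable (Theta : set 'rV[R]_d).
Hypothesis Theta_open : open Theta.

Lemma partial_subcst i (f : 'rV[R]_d -> R) c t : differentiable f t ->
  partial i (fun x => f x - c) t = partial i f t.
Proof.
move=> df; have dc := @differentiable_cst _ _ R (- c) t.
by rewrite (partialD i df dc) partial_cst addr0.
Qed.

(** A constant affects only the value: a function and its increment from [th]
    have the same derivatives. *)
Lemma jet_norm_subcst tau k f c th : Theta th -> differentiable_n k f Theta ->
  jet_norm tau k (fun x => f x - c) th =
  `|f th - c| + (jet_norm tau k f th - `|f th|).
Proof.
move=> Tth; elim: k => [|k IH] df /=; first by rewrite subrr addr0.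
rewrite IH; last exact: dnW.
under eq_bigr => i _ do rewrite (jet_norm_ext Theta_open (g := partial i f) _ _ Tth
  (fun t Tt => partial_subcst i c (df.1 t Tt))).
ring.
Qed.

End jet_norm_extra.

Section bounded_families.
Context {R : realType} {d : nat}.
Variable (Theta : set 'rV[R]_d).
Hypothesis Theta_open : open Theta.
Context {dX : measure_display} {X : measurableType dX}.
Variable p : nat.
Implicit Types (h : X -> 'rV[R]_d -> R) (th : 'rV[R]_d).

Local Notation dn := (fun k f => differentiable_n k f Theta).

(** The families of functions that are test functions for the integral operators
    below: smooth in the parameter, with jets bounded uniformly in the state. *)
Definition bounded_family h :=
  [/\ forall x, dn p (h x),
      forall th, Theta th -> measurable_fun setT (fun x => h x th)
    & exists C, forall x th, Theta th -> jet_norm 1 p (h x) th <= C].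

Lemma bounded_family_cst c : bounded_family (fun _ _ => c).
Proof.
split=> [x|th Tth|]; [exact: dn_cst|exact: measurable_cst|].
by exists `|c| => x th Tth; rewrite (jet_norm_cst Theta_open).
Qed.

Lemma bounded_family_at h x : bounded_family h -> bounded_family (fun _ => h x).
Proof.
case=> dh mh [C hC]; split=> [_|th Tth|]; [exact: dh|exact: measurable_cst|].
by exists C => _ th; exact: hC.
Qed.

Lemma bounded_family_weight (w : X -> R) C : measurable_fun setT w ->
  (forall x, `|w x| <= C) -> bounded_family (fun x _ => w x).
Proof.
move=> mw wC; split=> [x|th Tth|]; [exact: dn_cst|exact: mw|].
by exists C => x th Tth; rewrite (jet_norm_cst Theta_open).
Qed.

Lemma bounded_familyM h h' : bounded_family h -> bounded_family h' ->
  bounded_family (fun x t => h x t * h' x t).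
Proof.
case=> dh mh [C hC] [dh' mh' [C' hC']]; split=> [x|th Tth|].
- exact: dnM.
- by apply: measurable_funM; [exact: mh|exact: mh'].
- exists (C * C') => x th Tth.
  apply: le_trans (jet_normM Theta_open ler01 Tth (dh x) (dh' x)) _.
  by apply: ler_pM; rewrite ?jet_norm_ge0 ?hC ?hC'.
Qed.

Lemma bounded_familyB h h' : bounded_family h -> bounded_family h' ->
  bounded_family (fun x t => h x t - h' x t).
Proof.
case=> dh mh [C hC] [dh' mh' [C' hC']]; split=> [x|th Tth|].
- exact: dnB.
- by apply: measurable_funB; [exact: mh|exact: mh'].
- exists (C + C') => x th Tth.
  apply: le_trans (jet_normB Theta_open ler01 Tth (dh x) (dh' x)) _.
  by rewrite lerD ?hC ?hC'.
Qed.

Lemma bounded_familyV h low : 0 < low ->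
  (forall x th, Theta th -> low <= h x th) ->
  bounded_family h -> bounded_family (fun x t => (h x t)^-1%R).
Proof.
move=> l0 hl [dh mh [C hC]].
have hn0 x t : Theta t -> h x t != 0.
  by move=> Tt; rewrite gt_eqF// (lt_le_trans l0)// hl.
split=> [x|th Tth|].
- by apply: dnV => // t; exact: hn0.
- apply: (eq_measurable_fun (fun x => expR (- ln (h x th)))).
    by move=> x _; rewrite expRN lnK// posrE (lt_le_trans l0)// hl.
  apply: measurableT_comp => //; apply: measurableT_comp => //.
  by apply: measurableT_comp; [exact: measurable_ln|exact: mh].
- exists (inv_bound p low^-1 C) => x th Tth.
  apply: (jet_norm_inv Theta_open ler01 Tth (dh x)) => //.
  + exact: hn0.
  + rewrite ger0_norm ?invr_ge0 ?(le_trans (ltW l0)) ?hl//.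
    by rewrite lef_pV2 ?posrE ?hl// (lt_le_trans l0)// hl.
  + exact: hC.
Qed.

Lemma dominated_familyM (mu : {measure set X -> \bar R}) h h' b :
  dominated_family Theta mu p h b -> bounded_family h' ->
  exists b', dominated_family Theta mu p (fun x t => h x t * h' x t) b'.
Proof.
case=> dh mh hb ib [dh' mh' [C' hC']].
exists (fun x => `|C'| * b x); split=> [x|th Tth|x th Tth|].
- exact: dnM.
- by apply: measurable_funM; [exact: mh|exact: mh'].
- apply: le_trans (jet_normM Theta_open ler01 Tth (dh x) (dh' x)) _.
  rewrite mulrC; apply: ler_pM; rewrite ?jet_norm_ge0 ?hb//.
  by rewrite (le_trans (hC' x th Tth))// ler_norm.
- exact: integrableZlr.
Qed.

Lemma dominated_familyB (mu : {measure set X -> \bar R}) h h' b b' :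
  dominated_family Theta mu p h b -> dominated_family Theta mu p h' b' ->
  dominated_family Theta mu p (fun x t => h x t - h' x t) (fun x => b x + b' x).
Proof.
case=> dh mh hb ib [dh' mh' hb' ib']; split=> [x|th Tth|x th Tth|].
- exact: dnB.
- by apply: measurable_funB; [exact: mh|exact: mh'].
- apply: le_trans (jet_normB Theta_open ler01 Tth (dh x) (dh' x)) _.
  by rewrite lerD ?hb ?hb'.
- exact: integrableDr.
Qed.

Lemma bounded_family_freeze h th : Theta th -> bounded_family h ->
  bounded_family (fun x _ => h x th).
Proof.
move=> Tth [dh mh [C hC]]; apply: (bounded_family_weight (C := C)); first exact: mh.
by move=> x; apply: le_trans (hC x th Tth); exact: normr_jet_norm.
Qed.

Lemma dominated_family_weight (mu : {measure set X -> \bar R}) (w : X -> R) :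
  mu.-integrable setT (EFin \o w) ->
  dominated_family Theta mu p (fun x _ => w x) (fun x => `|w x|).
Proof.
move=> iw; split=> [x|th Tth|x th Tth|]; first exact: dn_cst.
- exact: integrable_measurable iw.
- by rewrite (jet_norm_cst Theta_open).
- by have := integrable_norm iw.
Qed.

Lemma jet_norm_weighted (mu : {measure set X -> \bar R}) (w : X -> R) h tau be th :
  0 <= tau <= 1 -> Theta th -> mu.-integrable setT (EFin \o w) ->
  bounded_family h -> (forall x, jet_norm tau p (h x) th <= be) ->
  jet_norm tau p (fun t => \int[mu]_x (w x * h x t)) th <=
    (\int[mu]_x `|w x|) * be.
Proof.
move=> /[dup] t01 /andP[t0 t1] Tth iw bh hbe.
have [b H] := dominated_familyM (dominated_family_weight iw) bh.
apply: le_trans (jet_norm_integral Theta_open t01 H Tth) _.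
have iaw : mu.-integrable setT (EFin \o (fun x => `|w x|)) by have := integrable_norm iw.
rewrite -RintegralZr//; apply: le_Rintegral => //.
- exact: (integrable_jet_norm Theta_open t01 H Tth).
- rewrite (_ : _ \o _ = EFin \o (fun x => be * `|w x|)); first exact: integrableZlr.
  by apply/funext => x /=; rewrite mulrC.
- move=> x _; have [dh _ _] := bh.
  apply: le_trans (jet_normZ Theta_open _ t0 Tth (dh x)) _.
  by rewrite ler_wpM2l.
Qed.

(** [H x] is the integral of [h] against the perturbation [k0 x + E x] of a
    Markov density. Since [k0 x] dominates the fraction [m] of the fixed
    density [k0 xs], it is a mixture of that density and of the probability
    density [w x], so only the weight [1 - m] of the latter carries the
    oscillation from [h] to [H]. The perturbation adds an error proportional to
    its relative size [nu]. *)
Section contraction.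
Variable mu : {measure set X -> \bar R}.
Variables (tau : R) (th : 'rV[R]_d).
Hypotheses (t01 : 0 <= tau <= 1) (Tth : Theta th).
Variables (m nu om be : R) (xs : X).
Hypothesis (m01 : 0 < m < 1).
Variables (k0 : X -> X -> R) (E : X -> X -> 'rV[R]_d -> R) (h : X -> 'rV[R]_d -> R).
Hypotheses (k0_ge0 : forall x x', 0 <= k0 x x')
  (k0_int : forall x, mu.-integrable setT (EFin \o k0 x))
  (k0_1 : forall x, \int[mu]_x' k0 x x' = 1)
  (k0_min : forall x, {ae mu, forall x', m * k0 xs x' <= k0 x x'}).
Hypotheses (bh : bounded_family h)
  (E_dn : forall x x', dn p (E x x'))
  (E_dom : forall x, exists b,
     dominated_family Theta mu p (fun x' t => E x x' t * h x' t) b)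
  (E_small : forall x x', jet_norm tau p (E x x') th <= nu * k0 x x')
  (h_osc : forall x z, jet_norm tau p (fun t => h x t - h z t) th <= om)
  (h_bnd : forall x, jet_norm tau p (h x) th <= be).

Let N f := jet_norm tau p f th.
Let t0 : 0 <= tau. Proof. by case/andP : t01. Qed.
Let P x t := \int[mu]_x' (k0 x x' * h x' t).
Let w x x' := (1 - m)^-1 * (k0 x x' - m * k0 xs x').
Let Q x t := \int[mu]_x' (w x x' * h x' t).
Let B x t := \int[mu]_x' (E x x' t * h x' t).
Let H x t := P x t + B x t.

Let m1 : 0 < 1 - m. Proof. by rewrite subr_gt0; case/andP : m01. Qed.

Let iwh (v : X -> R) t : mu.-integrable setT (EFin \o v) -> Theta t ->
  mu.-integrable setT (EFin \o (fun x' => v x' * h x' t)).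
Proof.
move=> iv Tt; have [b Hb] := dominated_familyM (dominated_family_weight iv) bh.
exact: dominated_family_integrable Hb Tt.
Qed.

Let dwh (v : X -> R) : mu.-integrable setT (EFin \o v) ->
  dn p (fun t => \int[mu]_x' (v x' * h x' t)).
Proof.
move=> iv; have [b Hb] := dominated_familyM (dominated_family_weight iv) bh.
exact: (dn_integral Theta_open Hb).
Qed.

Let iw x : mu.-integrable setT (EFin \o w x).
Proof. by apply: integrableZlr; apply: integrableBr => //; exact: integrableZlr. Qed.

Let w1 x : \int[mu]_x' w x x' = 1.
Proof.
rewrite RintegralZl//; last by apply: integrableBr => //; exact: integrableZlr.
rewrite RintegralB ?RintegralZl ?k0_1 ?mulr1//; last exact: integrableZlr.
by rewrite mulVf// lt0r_neq0.
Qed.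

Let wa1 x : \int[mu]_x' `|w x x'| = 1.
Proof.
rewrite -(w1 x) /Rintegral; congr fine; apply: ae_eq_integral => //.
- by have /integrableP[] := integrable_norm (iw x).
- by have /integrableP[] := iw x.
- have := k0_min x; apply: filterS => x' kx _ /=.
  by rewrite ger0_norm// mulr_ge0 ?invr_ge0 ?(ltW m1)// subr_ge0.
Qed.

Let bhB z : bounded_family (fun x' t => h x' t - h z t).
Proof. by apply: bounded_familyB => //; exact: bounded_family_at. Qed.

Let dP x : dn p (P x). Proof. exact: dwh. Qed.
Let dQ x : dn p (Q x). Proof. exact: dwh. Qed.
Let dB x : dn p (B x). Proof. by have [b Hb] := E_dom x; exact: (dn_integral Theta_open Hb). Qed.
Let dh x : dn p (h x). Proof. by case: bh. Qed.

(** Subtracting a constant under an average of total mass 1: this replaces the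
    size of [h] by its oscillation. *)
Let average_shift v s t : mu.-integrable setT (EFin \o v) -> Theta t ->
  \int[mu]_x' v x' = 1 ->
  \int[mu]_x' (v x' * h x' t) - s = \int[mu]_x' (v x' * (h x' t - s)).
Proof.
move=> iv Tt v1; rewrite -[X in _ - X]mul1r -v1 -RintegralZr// -RintegralB//.
- by apply: eq_Rintegral => x' _; rewrite mulrBr.
- exact: iwh.
- rewrite (_ : _ \o _ = EFin \o (fun x' => s * v x')); first exact: integrableZlr.
  by apply/funext => x' /=; rewrite mulrC.
Qed.

Let NP x z : N (fun t => P x t - h z t) <= om.
Proof.
rewrite /N (jet_norm_ext Theta_open _ _ Tth (g := fun t => \int[mu]_x' (k0 x x' * (h x' t - h z t))))//.
  have ki : mu.-integrable setT (EFin \o k0 x) by [].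
  apply: le_trans (@jet_norm_weighted mu _ _ _ om _ t01 Tth ki (bhB z) _) _; first by move=> x'.
  under eq_Rintegral do rewrite ger0_norm//.
  by rewrite k0_1 mul1r.
by move=> t Tt; rewrite -average_shift.
Qed.

Let NB x : N (B x) <= nu * be.
Proof.
have [b Hb] := E_dom x.
have be0 : 0 <= be by apply: le_trans (h_bnd xs); exact: jet_norm_ge0.
apply: le_trans (jet_norm_integral Theta_open t01 Hb Tth) _.
apply: (@le_trans _ _ (\int[mu]_x' (nu * be * k0 x x'))); last first.
  by rewrite RintegralZl// k0_1 mulr1.
apply: le_Rintegral => //; [exact: (integrable_jet_norm Theta_open t01 Hb Tth)|exact: integrableZlr|].
move=> x' _; apply: le_trans (jet_normM Theta_open t0 Tth (E_dn x x') (dh x')) _.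
by rewrite mulrAC; apply: ler_pM => //; exact: jet_norm_ge0.
Qed.

Let NQ x x' : N (fun t => h x' t - Q x t) <= om.
Proof.
rewrite /N (jet_norm_distC Theta_open t0 Tth) ?dQ//.
rewrite (jet_norm_ext Theta_open _ _ Tth (g := fun t => \int[mu]_z (w x z * (h z t - h x' t))))//.
  apply: le_trans (@jet_norm_weighted mu _ _ _ om _ t01 Tth (iw x) (bhB x') _) _; first by move=> z.
  by rewrite wa1 mul1r.
by move=> t Tt; rewrite -average_shift.
Qed.

Let NQQ x z : N (fun t => Q x t - Q z t) <= om.
Proof.
(* [Q x] averages [h] minus the constant [Q z], which [NQ] bounds pointwise. *)
have bQ : bounded_family (fun _ => Q z).
  split=> [_|t Tt|]; [exact: dQ|exact: measurable_cst|].
  have [_ _ [C hC]] := bh.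
  exists ((\int[mu]_x' `|w z x'|) * C) => _ t Tt.
  by apply: jet_norm_weighted => //; rewrite ?ler01 ?lexx// => x'; exact: hC.
have bS : bounded_family (fun x' t => h x' t - Q z t) by exact: bounded_familyB.
rewrite /N (jet_norm_ext Theta_open _ _ Tth (g := fun t => \int[mu]_x' (w x x' * (h x' t - Q z t))))//.
  apply: le_trans (@jet_norm_weighted mu _ _ _ om _ t01 Tth (iw x) bS _) _; first by move=> x'; exact: NQ.
  by rewrite wa1 mul1r.
by move=> t Tt; rewrite -average_shift.
Qed.

(** The decomposition of Doeblin. *)
Let PQ x t : Theta t -> P x t = (1 - m) * Q x t + m * P xs t.
Proof.
move=> Tt; rewrite -!RintegralZl//; [|exact: iwh..].
rewrite -RintegralD//; [|apply: integrableZlr; exact: iwh..].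
apply: eq_Rintegral => x' _; rewrite /w; field; exact: lt0r_neq0.
Qed.

Lemma doeblin_osc x z :
  jet_norm tau p (fun t => H x t - H z t) th <= (1 - m) * om + 2 * (nu * be).
Proof.
rewrite (jet_norm_ext Theta_open _ _ Tth (g := fun t => (1 - m) * (Q x t - Q z t) + (B x t - B z t)))//; last first.
  by move=> t Tt; rewrite /H (PQ x Tt) (PQ z Tt); move: (P xs t) (Q x t) (Q z t) (B x t) (B z t) => *; ring.
have dQQ := dnB Theta_open (dQ x) (dQ z); have dBB := dnB Theta_open (dB x) (dB z).
apply: le_trans (jet_normD Theta_open t0 Tth (dnZ Theta_open _ dQQ) dBB) _.
apply: lerD.
  apply: le_trans (jet_normZ Theta_open _ t0 Tth dQQ) _.
  rewrite ger0_norm ?(ltW m1)// ler_wpM2l ?(ltW m1)//; exact: NQQ.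
apply: le_trans (jet_normB Theta_open t0 Tth (dB x) (dB z)) _.
by rewrite mulr_natl mulr2n; apply: lerD; exact: NB.
Qed.

Lemma doeblin_dist x z :
  jet_norm tau p (fun t => H x t - h z t) th <= om + nu * be.
Proof.
rewrite (jet_norm_ext Theta_open _ _ Tth (g := fun t => (P x t - h z t) + B x t))//; last first.
  by move=> t Tt; rewrite /H addrAC.
apply: le_trans (jet_normD Theta_open t0 Tth (dnB Theta_open (dP x) (dh z)) (dB x)) _.
by apply: lerD; [exact: NP|exact: NB].
Qed.

End contraction.
End bounded_families.

(** * Disintegration along transition kernels *)

Section kernel_precomposition.
Context {R : realType} {dX dY dZ : measure_display}.
Context {X : measurableType dX} {Y : measurableType dY} {Z : measurableType dZ}.
Variables (f : Z -> X) (mf : measurable_fun setT f) (k : R.-pker X ~> Y).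

(** The proof of measurability is an argument so that the kernel structure can
    be attached to the definition. *)
Definition kernel_precomp (_ : measurable_fun setT f) (z : Z) :
  {measure set Y -> \bar R} := k (f z).

Let measurable_precomp U : measurable U ->
  measurable_fun setT (kernel_precomp mf ^~ U).
Proof.
by move=> mU; apply: (measurableT_comp (measurable_kernel k U mU)).
Qed.

HB.instance Definition _ := isKernel.Build _ _ _ _ _ (kernel_precomp mf)
  measurable_precomp.

Let precomp_prob z : kernel_precomp mf z setT = 1%E.
Proof. exact: prob_kernel. Qed.

HB.instance Definition _ := Kernel_isProbability.Build _ _ _ _ _
  (kernel_precomp mf) precomp_prob.

Lemma measurable_integral_precomp (F : Z * Y -> \bar R) :
  (forall z, (0 <= F z)%E) -> measurable_fun setT F ->
  measurable_fun setT (fun z => \int[k (f z)]_y F (z, y))%E.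
Proof.
move=> F0 mF.
exact: (measurable_fun_integral_sfinite_kernel F (kernel_precomp mf)).
Qed.

End kernel_precomposition.

Section kernel_disintegration.
Context {R : realType} {d0 d1 dX dY dO : measure_display}.
Context {T : measurableType d0} {W : measurableType d1} {X : measurableType dX}
  {Y : measurableType dY} {Omega : measurableType dO}.
Variables (Pr : probability Omega R) (P : R.-pker W ~> X) (Q : R.-pker X ~> Y).
Variables (a : {mfun Omega >-> T}) (U : T -> W) (V : {mfun Omega >-> (X * Y)%type}).
Hypothesis mU : measurable_fun setT U.
Hypothesis rect : forall D B, measurable D -> measurable B ->
  Pr ([set w | B (V w)] `&` (a @^-1` D)) =
  (\int[Pr]_(w in a @^-1` D) \int[P (U (a w))]_x \int[Q x]_y (\1_B (x, y))%:E)%E.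

Let mU2 : measurable_fun setT (fun z : unit * T => U z.2).
Proof. exact: measurableT_comp. Qed.
Let mX2 : measurable_fun setT (fun z : (unit * T) * X => z.2).
Proof. exact: measurable_snd. Qed.
Let mre : measurable_fun setT (fun z : ((unit * T) * X) * Y => (z.1.1.2, (z.1.2, z.2))).
Proof.
apply: measurable_fun_pair.
  do 2 apply: measurableT_comp => //.
by apply: measurable_fun_pair => //; exact: measurableT_comp.
Qed.

Let law_a : unit -> pprobability T R := fun=> distribution Pr a.
Let mlaw : measurable_fun setT law_a. Proof. exact: measurable_cst. Qed.

(** The law of the pair of [a] and of a transition drawn from it; [unit] and the
    constant kernel [law_a] are the initial point that composition of kernels
    requires. *)
Let joint : {measure set (T * (X * Y)) -> \bar R} :=
  (kprobability mlaw \; (kernel_precomp P mU2 \;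
     (kernel_precomp Q mX2 \; kdirac mre)))%E tt.

Let jointE (H : T * (X * Y) -> \bar R) : (forall z, (0 <= H z)%E) ->
  measurable_fun setT H ->
  (\int[joint]_z H z =
   \int[Pr]_w \int[P (U (a w))]_x \int[Q x]_y H (a w, (x, y)))%E.
Proof.
move=> H0 mH; rewrite /joint integral_kcomp//.
transitivity (\int[distribution Pr a]_t \int[P (U t)]_x \int[Q x]_y H (t, (x, y)))%E.
  apply: eq_integral => t _; rewrite integral_kcomp//.
  apply: eq_integral => x _; rewrite integral_kcomp//.
  by apply: eq_integral => y _; rewrite integral_dirac ?diracT ?mul1e.
rewrite ge0_integral_pushforward//.
- pose G (z : (T * X) * Y) := H (z.1.1, (z.1.2, z.2)).
  have mG : measurable_fun setT G.
    apply: measurableT_comp => //; apply: measurable_fun_pair.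
      by do 2 apply: measurableT_comp => //.
    by apply: measurable_fun_pair => //; exact: measurableT_comp.
  have m1 : measurable_fun setT (fun z : T * X => \int[Q z.2]_y G (z, y))%E.
    by apply: measurable_integral_precomp => // z; exact: H0.
  apply: (@measurable_integral_precomp _ _ _ _ _ _ _ _ mU P _ _ m1) => z.
  by apply: integral_ge0 => y _; exact: H0.
- move=> t _; apply: integral_ge0 => x _; apply: integral_ge0 => y _; exact: H0.
Qed.

Let joint_rect D B : measurable D -> measurable B ->
  joint (D `*` B) = Pr ([set w | B (V w)] `&` (a @^-1` D)).
Proof.
move=> mD mB; rewrite rect// -[LHS]mul1e.
have mDB : measurable (D `*` B) by exact: measurableX.
transitivity (\int[joint]_z (\1_(D `*` B) z)%:E)%E.
  by rewrite integral_indic// setIT mul1e.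
have m1 : measurable_fun setT (fun z : T * (X * Y) => (\1_(D `*` B) z)%:E : \bar R).
  exact/measurable_EFinP/measurable_indic.
rewrite (@jointE (fun z => (\1_(D `*` B) z)%:E) _ m1); last by move=> z; rewrite lee_fin.
rewrite [RHS]integral_mkcond; apply: eq_integral => w _; rewrite patchE.
case: ifPn => [/set_mem /= Dw|Dw].
  apply: eq_integral => x _; apply: eq_integral => y _; congr _%:E.
  rewrite !indicE; suff -> : ((x, y) \in B) = ((a w, (x, y)) \in D `*` B) by [].
  by apply/idP/idP; rewrite !inE/=; tauto.
apply: integral0_eq => x _; apply: integral0_eq => y _.
by rewrite indicE memNset//= => -[/mem_set]; rewrite (negPf (Dw : a w \notin D)).
Qed.

Let mpair : measurable_fun setT (fun w => (a w, V w)).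
Proof. exact: measurable_fun_pair. Qed.

Let pairV : {mfun Omega >-> (T * (X * Y))%type} :=
  HB.pack (fun w => (a w, V w)) (isMeasurableFun.Build _ _ _ _ _ mpair).

(** The conditional law of [V] is prescribed on rectangles only; these form a
    pi-system, so the two laws of the pair of [a] and [V] coincide. *)
Lemma disintegration (H : T * (X * Y) -> \bar R) : (forall z, (0 <= H z)%E) ->
  measurable_fun setT H ->
  (\int[Pr]_w H (a w, V w) =
   \int[Pr]_w \int[P (U (a w))]_x \int[Q x]_y H (a w, (x, y)))%E.
Proof.
move=> H0 mH; rewrite -jointE//.
transitivity (\int[distribution Pr pairV]_z H z)%E.
  by rewrite ge0_integral_pushforward.
apply: eq_measure_integral => A mA _.
pose C : set (set (T * (X * Y))) :=
  [set C | exists D, measurable D /\ exists B, measurable B /\ C = D `*` B].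
apply: (measure_unique C (fun=> setT)) => //.
- rewrite measurable_prod_measurableType //; congr (<<s _ >>).
  rewrite predeqE; split => [[D mD [B mB <-]]|[D [mD [B [mB ->]]]]].
    by exists D; split => //; exists B.
  by exists D => //; exists B.
- move=> /= _ _ [X1 [mX1 [X2' [mX2' ->]]]] [Y1 [mY1 [Y2 [mY2 ->]]]].
  rewrite -setXI; exists (X1 `&` Y1); split; first exact: measurableI.
  by exists (X2' `&` Y2); split => //; exact: measurableI.
- move=> _; exists setT; split => //; exists setT; split => //.
  by rewrite setXTT.
- by rewrite bigcup_const//; exists 0%N.
- move=> _ [D [mD [B [mB ->]]]]; rewrite joint_rect//.
  rewrite /distribution/= /pushforward; congr (Pr _).
  by apply/seteqP; split => w /=; tauto.
- by move=> k; rewrite /= probability_setT ltry.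
Qed.

End kernel_disintegration.

(** * Prediction of the observations *)

Section observation_kernels.
Context {R : realType} {dX dY : measure_display}.
Context {X : measurableType dX} {Y : measurableType dY}.
Variables (P : R.-pker X ~> X) (Q : R.-pker X ~> Y).
Local Open Scope ereal_scope.

Definition cons_seq (y : Y) (s : nat -> Y) (i : nat) : Y :=
  if i is j.+1 then s j else y.

(** Measurability of a functional of an observation sequence, tested along
    measurable families of sequences; the sigma-algebra generated by the
    coordinates is thus never formed. *)
Definition seq_measurable dA (A : measurableType dA) (F : A -> (nat -> Y) -> \bar R) :=
  forall dT (T : measurableType dT) (b : T -> A) (Z : nat -> T -> Y),
    measurable_fun setT b -> (forall i, measurable_fun setT (Z i)) ->
    measurable_fun setT (fun t => F (b t) (fun i => Z i t)).

(** The expectation of [F] over the next [n] observations, from the state [x].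
    The later observations are replaced by [point], in agreement with [cut]
    below, so that no measure on infinite sequences is involved. *)
Fixpoint predict n (F : (nat -> Y) -> \bar R) (x : X) : \bar R :=
  if n is k.+1 then
    \int[P x]_x' \int[Q x']_y predict k (fun s => F (cons_seq y s)) x'
  else F (fun=> point).

Lemma predict_ge0 n F x : (forall s, 0 <= F s) -> 0 <= predict n F x.
Proof.
elim: n F x => [|n IH] F x F0 /=; first exact: F0.
by apply: integral_ge0 => x' _; apply: integral_ge0 => y _; apply: IH => s.
Qed.

Lemma seq_measurable_cons dA (A : measurableType dA) (F : A -> (nat -> Y) -> \bar R) :
  seq_measurable F ->
  seq_measurable (fun z : A * Y => fun s => F z.1 (cons_seq z.2 s)).
Proof.
move=> mF dT T b Z mb mZ.
pose Z' i t := if i is j.+1 then Z j t else (b t).2.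
rewrite (_ : (fun t => _) = fun t => F (b t).1 (fun i => Z' i t)).
  apply: mF; first exact: measurableT_comp.
  by case=> [|i]; [exact: measurableT_comp|exact: mZ].
by apply/funext => t; congr F; apply/funext => -[].
Qed.

Lemma measurable_predict n dA (A : measurableType dA) (F : A -> (nat -> Y) -> \bar R) :
  seq_measurable F -> (forall a s, 0 <= F a s) ->
  measurable_fun setT (fun z : A * X => predict n (F z.1) z.2).
Proof.
elim: n dA A F => [|n IH] dA A F mF F0 /=; first exact: mF.
have mF' := seq_measurable_cons mF.
have H := IH _ _ _ mF' (fun z s => F0 z.1 _).
pose G (z : (A * X) * Y) := predict n (fun s => F z.1.1 (cons_seq z.2 s)) z.1.2.
have mG : measurable_fun setT G.
  apply: (@measurableT_comp _ _ _ _ _ _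
    (fun z : (A * Y) * X => predict n (fun s => F z.1.1 (cons_seq z.1.2 s)) z.2) _
    (fun z : (A * X) * Y => ((z.1.1, z.2), z.1.2))) => //.
  apply: measurable_fun_pair; last exact: measurableT_comp.
  by apply: measurable_fun_pair => //; do 2 apply: measurableT_comp => //.
have m1 : measurable_fun setT (fun z : A * X => \int[Q z.2]_y G (z, y)).
  apply: measurable_integral_precomp => // z; exact: predict_ge0.
pose G1 (z : (A * X) * X) := \int[Q z.2]_y G ((z.1.1, z.2), y).
have mG1 : measurable_fun setT G1.
  apply: (@measurableT_comp _ _ _ _ _ _ (fun z : A * X => \int[Q z.2]_y G (z, y)) _
    (fun z : (A * X) * X => (z.1.1, z.2))) => //.
  by apply: measurable_fun_pair => //; exact: measurableT_comp.
have m2 : measurable_fun setT (fun z : A * X => z.2) := measurable_snd.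
have := @measurable_integral_precomp _ _ _ _ _ _ _ _ m2 P G1 _ mG1.
by apply=> z; apply: integral_ge0 => y _; exact: predict_ge0.
Qed.

Lemma measurable_predict1 n F : seq_measurable (fun _ : unit => F) ->
  (forall s, 0 <= F s) -> measurable_fun setT (predict n F).
Proof.
move=> mF F0; have := measurable_predict n mF (fun _ => F0).
move=> H; apply: (@measurableT_comp _ _ _ _ _ _ (fun z : unit * X => predict n F z.2) _
  (fun x => (tt, x))) => //.
exact: measurable_fun_pair.
Qed.

Lemma kernel_integral_cst dU dV (U : measurableType dU) (V : measurableType dV)
  (k : R.-pker U ~> V) x (C : R) : \int[k x]_v C%:E = C%:E.
Proof. by rewrite integral_cst// prob_kernel mule1. Qed.

Lemma kernel_integral_le dU dV (U : measurableType dU) (V : measurableType dV)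
  (k : R.-pker U ~> V) x (f : V -> \bar R) (C : R) : measurable_fun setT f ->
  (forall v, 0 <= f v) -> (forall v, f v <= C%:E) -> \int[k x]_v f v <= C%:E.
Proof.
by move=> mf f0 fC; rewrite -(kernel_integral_cst k x C); exact: ge0_le_integral.
Qed.

Lemma seq_measurable_consl (F : (nat -> Y) -> \bar R) (y : Y) :
  seq_measurable (fun _ : unit => F) ->
  seq_measurable (fun _ : unit => fun s => F (cons_seq y s)).
Proof.
move=> mF dT T b Z mb mZ.
have mb' : measurable_fun setT (fun _ : T => (tt, y)) by exact: measurable_cst.
exact: (seq_measurable_cons mF mb' mZ).
Qed.

Lemma measurable_predict_obs n (F : (nat -> Y) -> \bar R) :
  seq_measurable (fun _ : unit => F) -> (forall s, 0 <= F s) ->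
  measurable_fun setT (fun z : X * Y => predict n (fun s => F (cons_seq z.2 s)) z.1).
Proof.
move=> mF F0.
have := measurable_predict n (seq_measurable_cons mF) (fun z s => F0 (cons_seq z.2 s)).
move=> m1; apply: (@measurableT_comp _ _ _ _ _ _
  (fun z : (unit * Y) * X => predict n (fun s => F (cons_seq z.1.2 s)) z.2) _
  (fun z : X * Y => ((tt, z.2), z.1))) => //.
by do 2 apply: measurable_fun_pair => //.
Qed.

Lemma measurable_predict_step n (F : (nat -> Y) -> \bar R) :
  seq_measurable (fun _ : unit => F) -> (forall s, 0 <= F s) ->
  measurable_fun setT (fun x => \int[Q x]_y predict n (fun s => F (cons_seq y s)) x).
Proof.
move=> mF F0; have mid : measurable_fun setT (@id X) by exact: measurable_id.
have G0 (z : X * Y) : 0 <= predict n (fun s => F (cons_seq z.2 s)) z.1.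
  by apply: predict_ge0.
exact: (measurable_integral_precomp mid Q G0 (measurable_predict_obs n mF F0)).
Qed.

Lemma measurable_predict_obs1 n (F : (nat -> Y) -> \bar R) x :
  seq_measurable (fun _ : unit => F) -> (forall s, 0 <= F s) ->
  measurable_fun setT (fun y => predict n (fun s => F (cons_seq y s)) x).
Proof.
move=> mF F0; have m1 : measurable_fun setT (fun y : Y => (x, y)) by exact: measurable_fun_pair.
exact: (measurableT_comp (measurable_predict_obs n mF F0) m1).
Qed.

Lemma predict_leZ n (F G : (nat -> Y) -> \bar R) x (c : R) : (0 <= c)%R ->
  seq_measurable (fun _ : unit => F) -> seq_measurable (fun _ : unit => G) ->
  (forall s, 0 <= F s) -> (forall s, 0 <= G s) -> (forall s, F s <= c%:E * G s) ->
  predict n F x <= c%:E * predict n G x.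
Proof.
move=> c0; elim: n F G x => [|n IH] F G x mF mG F0 G0 FG /=; first exact: FG.
have cons0 (H : (nat -> Y) -> \bar R) x' y : (forall s, 0 <= H s) ->
    0 <= predict n (fun s => H (cons_seq y s)) x' by move=> H0; exact: predict_ge0.
have int0 (H : (nat -> Y) -> \bar R) x' : (forall s, 0 <= H s) ->
    0 <= \int[Q x']_y predict n (fun s => H (cons_seq y s)) x'.
  by move=> H0; apply: integral_ge0 => y _; exact: cons0.
rewrite -ge0_integralZl//; last 2 first.
- exact: measurable_predict_step.
- by move=> x' _; exact: int0.
apply: ge0_le_integral => //.
- by move=> x' _; exact: int0.
- exact: measurable_predict_step.
- by apply: measurable_funeM; exact: measurable_predict_step.
move=> x' _; rewrite -ge0_integralZl//; last 2 first.
- exact: measurable_predict_obs1.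
- by move=> y _; exact: cons0.
apply: ge0_le_integral => //.
- by move=> y _; exact: cons0.
- exact: measurable_predict_obs1.
- by apply: measurable_funeM; exact: measurable_predict_obs1.
by move=> y _; apply: IH => //; exact: seq_measurable_consl.
Qed.

(** The observations are bounded one at a time, uniformly in the hidden state.
    The constant [a] accumulates the observations that are already known. *)
Lemma predict_sum_le n (c : nat -> Y -> R) (M : nat -> R) (a : R) x : (0 <= a)%R ->
  (forall k, measurable_fun setT (c k)) -> (forall k y, (0 <= c k y)%R) ->
  (forall k x, \int[Q x]_y (c k y)%:E <= (M k)%:E) ->
  predict n (fun s => (a + \sum_(k < n) c k (s k))%:E) x <=
    (a + \sum_(k < n) M k)%:E.
Proof.
move=> + mc c0 cM; have M0 k : (0 <= M k)%R.
  by rewrite -lee_fin (le_trans _ (cM k x))// integral_ge0// => y _; rewrite lee_fin.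
elim: n c M a x mc c0 cM M0 => [|n IH] c M a x mc c0 cM M0 a0.
  by rewrite /= !big_ord0.
(* The absolute value makes the functional nonnegative for all values of the
   parameter, as the measurability of predictions requires. *)
pose F' (a' : R) (s : nat -> Y) : \bar R := (`|a'| + \sum_(k < n) c k.+1 (s k))%:E.
have F'0 a' s : 0 <= F' a' s by rewrite lee_fin addr_ge0// sumr_ge0.
have mS : seq_measurable F'.
  move=> dT T b Z mb mZ; apply/measurable_EFinP; apply: measurable_funD.
    exact: measurableT_comp.
  by apply: measurable_sum => k; exact: measurableT_comp.
have E y : (fun s => (a + \sum_(k < n.+1) c k (cons_seq y s k))%:E) = F' (a + c 0%N y)%R.
  apply/funext => s; rewrite big_ord_recl addrA /F' ger0_norm//.
  by rewrite addr_ge0.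
pose S := (a + \sum_(k < n) M k.+1)%R.
have S0 : (0 <= S)%R by rewrite addr_ge0// sumr_ge0.
have mpred : measurable_fun setT (fun z : X * Y => predict n (F' (a + c 0%N z.2)%R) z.1).
  apply: (@measurableT_comp _ _ _ _ _ _ (fun z : R * X => predict n (F' z.1) z.2) _
    (fun z : X * Y => ((a + c 0%N z.2)%R, z.1))).
    exact: measurable_predict.
  by apply: measurable_fun_pair => //; apply: measurable_funD => //; exact: measurableT_comp.
have inner x' : \int[Q x']_y predict n (F' (a + c 0%N y)%R) x' <= (S + M 0%N)%:E.
  apply: (@le_trans _ _ (\int[Q x']_y (S%:E + (c 0%N y)%:E))).
    apply: ge0_le_integral => //.
    - by move=> y _; exact: predict_ge0.
    - have m1 : measurable_fun setT (fun y : Y => (x', y)) by exact: measurable_fun_pair.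
      exact: (measurableT_comp mpred m1).
    - by apply: emeasurable_funD => //; exact/measurable_EFinP.
    - move=> y _; rewrite -EFinD /S addrAC.
      have ac0 : (0 <= a + c 0%N y)%R by rewrite addr_ge0.
      have := IH (fun k => c k.+1) (fun k => M k.+1) _ x'
        (fun k => mc k.+1) (fun k => c0 k.+1) (fun k => cM k.+1) (fun k => M0 k.+1) ac0.
      by rewrite /F' ger0_norm.
  rewrite ge0_integralD//.
  - by rewrite kernel_integral_cst (EFinD S); apply: leeD2l; exact: cM.
  - by move=> y _; rewrite lee_fin.
  - exact/measurable_EFinP.
rewrite [predict _ _ _]/=.
under eq_integral => x' _ do under eq_integral => y _ do rewrite E.
rewrite big_ord_recl addrCA addrC.
apply: kernel_integral_le => //.
- have mid : measurable_fun setT (@id X) by exact: measurable_id.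
  have G0 (z : X * Y) : 0 <= predict n (F' (a + c 0%N z.2)%R) z.1 by exact: predict_ge0.
  exact: (measurable_integral_precomp mid Q G0 mpred).
- by move=> x'; apply: integral_ge0 => y _; exact: predict_ge0.
Qed.

End observation_kernels.

(** * Integrals and total variation *)

Section total_variation.
Context {R : realType}.

(** The sum counts the positive integers up to [a], which are all at most [n]: it
    is the integer part of [a]. *)
Lemma count_steps (n : nat) (a : R) : 0 <= a <= n%:R ->
  \sum_(k < n) (k.+1%:R <= a)%R%:R <= a <= \sum_(k < n) (k.+1%:R <= a)%R%:R + 1.
Proof.
elim: n => [|n IH] /andP[a0 an].
  by rewrite big_ord0 a0 add0r (le_trans an).
rewrite big_ord_recr/=; have [an'|na] := leP a n%:R.
  rewrite (_ : (n.+1%:R <= a) = false) ?addr0; first by apply: IH; rewrite a0.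
  by apply/negbTE; rewrite -ltNge (le_lt_trans an')// ltr_nat.
rewrite (eq_bigr (fun=> 1)); last first.
  by move=> k _; rewrite (le_trans _ (ltW na))// ler_nat.
rewrite sumr_const card_ord; have [n1a|an1] := leP n.+1%:R a.
  by rewrite -natrD addn1 n1a (le_trans an)// lerDl.
by rewrite addr0 (ltW na)/= (le_trans an)// -natr1.
Qed.

Context {dT : measure_display} {T : measurableType dT}.

(** The layer-cake formula for a step function: it expresses the integral, up to
    an arbitrarily small error, through the measures of level sets. *)
Lemma integral_step_approx (m : {measure set T -> \bar R}) (f : T -> R) (N : nat) :
  m setT = 1%E -> measurable_fun setT f -> (forall x, 0 <= f x <= 1) ->
  \sum_(k < N.+1) N.+1%:R^-1 * fine (m [set x | k.+1%:R <= N.+1%:R * f x])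
  <= \int[m]_x f x <=
  \sum_(k < N.+1) N.+1%:R^-1 * fine (m [set x | k.+1%:R <= N.+1%:R * f x]) + N.+1%:R^-1.
Proof.
move=> m1 mf f01; set S := \sum_(k < _) _; pose A k := [set x | k.+1%:R <= N.+1%:R * f x].
have mA k : measurable (A k).
  have mNf : measurable_fun setT (fun x => N.+1%:R * f x) by exact: measurable_funM.
  by rewrite /A -[X in measurable X]setTI; apply: measurable_fun_le.
have fin : m setT != +oo%E by rewrite m1.
have icst c : m.-integrable setT (EFin \o (fun=> c : R)).
  apply/integrableP; split; first exact/measurable_EFinP.
  by rewrite integral_cst// m1 mule1 ltry.
have ib (g : T -> R) C : measurable_fun setT g -> (forall x, `|g x| <= C) ->
    m.-integrable setT (EFin \o g).
  by move=> mg gC; exact: integrable_dominated mg gC (icst C).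
have iI k : m.-integrable setT (EFin \o (fun x => N.+1%:R^-1 * \1_(A k) x : R)).
  apply: integrableZlr; apply: (ib _ 1); first exact: measurable_indic.
  by move=> x; rewrite indicE; case: (_ \in _); rewrite ?normr1 ?normr0.
have fi : m.-integrable setT (EFin \o f).
  by apply: (ib _ 1) => // x; have /andP[f0 f1] := f01 x; rewrite ger0_norm.
have SE : S = \int[m]_x (\sum_(k < N.+1) N.+1%:R^-1 * \1_(A k) x).
  rewrite Rintegral_sum//; apply: eq_bigr => k _.
  rewrite RintegralZl//.
    by rewrite /Rintegral integral_indic// setIT.
  apply: (ib _ 1); first exact: measurable_indic.
  by move=> x; rewrite indicE; case: (_ \in _); rewrite ?normr1 ?normr0.
have pt x : \sum_(k < N.+1) N.+1%:R^-1 * \1_(A k) x <= f x <=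
    \sum_(k < N.+1) N.+1%:R^-1 * \1_(A k) x + N.+1%:R^-1.
  have /andP[f0 f1] := f01 x.
  have N0 : 0 < N.+1%:R :> R by rewrite ltr0n.
  have := @count_steps N.+1 (N.+1%:R * f x).
  rewrite mulr_ge0//= ler_piMr// => /(_ isT).
  rewrite -mulr_sumr (eq_bigr (fun k : 'I_N.+1 => \1_(A k) x)); last first.
    move=> k _; rewrite indicE; congr (nat_of_bool _)%:R.
    by apply/idP/idP; rewrite inE.
  move: (\sum_(k < N.+1) _) => s /andP[s1 s2]; apply/andP; split.
    by rewrite ler_pdivrMl.
  by rewrite -[X in _ + X]mulr1 -mulrDr ler_pdivlMl.
have iS := integrable_sumr (index_enum 'I_N.+1) iI.
rewrite SE; apply/andP; split.
  by apply: le_Rintegral => // x _; case/andP: (pt x).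
apply: (@le_trans _ _ (\int[m]_x (\sum_(k < N.+1) N.+1%:R^-1 * \1_(A k) x + N.+1%:R^-1))).
  by apply: le_Rintegral => // [|x _]; [exact: integrableDr|case/andP: (pt x)].
by rewrite RintegralD// Rintegral_cst// m1 mulr1.
Qed.

(** A uniform bound on the differences of the measures of sets gives, by the
    layer-cake formula, the same bound on the differences of the integrals of
    functions with values in the unit interval; [B] enters by rescaling. *)
Lemma bounded_integral_dist (m1 m2 : {measure set T -> \bar R}) (f : T -> R) (B c : R) :
  m1 setT = 1%E -> m2 setT = 1%E ->
  (forall A, measurable A -> `|fine (m1 A) - fine (m2 A)| <= c) ->
  measurable_fun setT f -> (forall x, 0 <= f x <= B) ->
  `|\int[m1]_x f x - \int[m2]_x f x| <= c * B.
Proof.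
move=> m11 m21 mc mf f0B.
have c0 : 0 <= c by apply: le_trans (mc set0 measurable0).
have B0 : 0 <= B by have /andP[f0 fB] := f0B point; exact: le_trans f0 fB.
move: B0; rewrite le_eqVlt => /predU1P[B0|B0].
  have f0 x : f x = 0 by apply/eqP; rewrite eq_le andbC {2}B0.
  rewrite (_ : f = cst 0); last exact/funext.
  by rewrite /Rintegral !integral0 subrr normr0 -B0 mulr0.
have g01 x : 0 <= B^-1 * f x <= 1.
  have /andP[f0 fB] := f0B x.
  by rewrite mulr_ge0 ?invr_ge0 ?(ltW B0)//= ler_pdivrMl// mulr1.
have mg : measurable_fun setT (fun x => B^-1 * f x) by exact: measurable_funM.
have fi (m : {measure set T -> \bar R}) : m setT = 1%E -> m.-integrable setT (EFin \o f).
  move=> m_1; apply: (@integrable_dominated _ _ _ m f (fun=> B)) => //.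
    by move=> x; have /andP[f0 fB] := f0B x; rewrite ger0_norm.
  apply/integrableP; split; first exact/measurable_EFinP.
  by rewrite integral_cst// m_1 mule1 ltry.
suff : `|\int[m1]_x (B^-1 * f x) - \int[m2]_x (B^-1 * f x)| <= c.
  rewrite !RintegralZl ?fi// -mulrBr normrM ger0_norm ?invr_ge0 ?(ltW B0)//.
  by rewrite ler_pdivrMl// mulrC.
apply/ler_addgt0Pl => e e0; pose N := Num.trunc e^-1.
have Ne : N.+1%:R^-1 < e by rewrite invf_plt ?posrE//; exact: truncnS_gt.
have := integral_step_approx N m11 mg g01; have := integral_step_approx N m21 mg g01.
set S2 := \sum_(k < _) _; set S1 := \sum_(k < _) _ => /=.
have S12 : `|S1 - S2| <= c.
  rewrite /S1 /S2 -sumrB; apply: le_trans (ler_norm_sum _ _ _) _.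
  apply: (@le_trans _ _ (\sum_(k < N.+1) N.+1%:R^-1 * c)).
    apply: ler_sum => k _; rewrite -mulrBr normrM ger0_norm// ler_wpM2l//; apply: mc.
    have mNf : measurable_fun setT (fun x => N.+1%:R * (B^-1 * f x)) by exact: measurable_funM.
    by rewrite -[X in measurable X]setTI; apply: measurable_fun_le.
  by rewrite sumr_const card_ord -[_ *+ _]mulr_natl mulrA mulfV ?mul1r// pnatr_eq0.
move: S12; rewrite !ler_norml => /andP[a1 a2] /andP[b1 b2] /andP[c1 c2].
move: (\int[m1]_x _) (\int[m2]_x _) S1 S2 (N.+1%:R^-1) Ne a1 a2 b1 b2 c1 c2.
by move=> I1 I2 s1 s2 n Ne a1 a2 b1 b2 c1 c2; apply/andP; split; lra.
Qed.

End total_variation.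

(** * Mixing of a hidden Markov process *)

Section hidden_markov_process.
Context {R : realType} {dX dY dO : measure_display}.
Context {X : measurableType dX} {Y : measurableType dY} {Omega : measurableType dO}.
Variables (Pr : probability Omega R) (P : R.-pker X ~> X) (Q : R.-pker X ~> Y).
Variables (X_ : nat -> {mfun Omega >-> X}) (Y_ : nat -> {mfun Omega >-> Y}).
Hypothesis XY_hmm : hidden_markov Pr P Q X_ Y_.
Local Open Scope ereal_scope.

Definition history_gen m : set (set Omega) :=
  \bigcup_(k in [set k | (k <= m)%N])
    (preimage_set_system setT (X_ k) measurable `|`
     preimage_set_system setT (Y_ k) measurable).

(** The sample space with the sigma-algebra of the history up to the time [m]: a
    measurable function on it is a quantity that is known at that time. *)
Definition past m := g_sigma_algebraType (history_gen m).

Lemma past_measurableE m : @measurable _ (past m) = history X_ Y_ m.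
Proof. by []. Qed.

Lemma past_id_measurable m : measurable_fun setT (fun w : Omega => w : past m).
Proof.
move=> _ B mB; rewrite setTI preimage_id.
move: B mB; rewrite past_measurableE; apply: smallest_sub.
  exact: sigma_algebra_measurable.
move=> A [k _] [] [C mC <-]; rewrite setTI.
- by rewrite -[X in measurable X]setTI; exact: measurable_funP.
- by rewrite -[X in measurable X]setTI; exact: measurable_funP.
Qed.

Lemma past_le_measurable m n : (m <= n)%N ->
  measurable_fun setT (fun w : past n => w : past m).
Proof.
move=> mn _ B mB; rewrite setTI preimage_id.
move: B mB; rewrite !past_measurableE; apply: sub_smallest2r.
  exact: smallest_sigma_algebra.
move=> A [k km HA]. exists k => //=.
exact: leq_trans km mn.
Qed.

Lemma past_X_measurable m k : (k <= m)%N ->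
  measurable_fun setT (fun w : past m => X_ k w).
Proof.
move=> km _ B mB; rewrite setTI past_measurableE; apply: sub_sigma_algebra.
by exists k => //; left; exists B => //; rewrite setTI.
Qed.

Lemma past_Y_measurable m k : (k <= m)%N ->
  measurable_fun setT (fun w : past m => Y_ k w).
Proof.
move=> km _ B mB; rewrite setTI past_measurableE; apply: sub_sigma_algebra.
by exists k => //; right; exists B => //; rewrite setTI.
Qed.

(** The Markov property in integrated form. The functional may depend on the
    whole past, which is what the induction over the observations requires. *)
Lemma one_step m (H : past m * (X * Y) -> \bar R) : (forall z, 0 <= H z) ->
  measurable_fun setT H ->
  \int[Pr]_w H (w, (X_ m.+1 w, Y_ m.+1 w)) =
  \int[Pr]_w \int[P (X_ m w)]_x \int[Q x]_y H (w, (x, y)).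
Proof.
move=> H0 mH.
have mV : measurable_fun setT (fun w => (X_ m.+1 w, Y_ m.+1 w)).
  by apply: measurable_fun_pair; exact: measurable_funP.
pose a : {mfun Omega >-> past m} :=
  HB.pack (fun w : Omega => w : past m) (isMeasurableFun.Build _ _ _ _ _ (@past_id_measurable m)).
pose V : {mfun Omega >-> (X * Y)%type} :=
  HB.pack (fun w => (X_ m.+1 w, Y_ m.+1 w)) (isMeasurableFun.Build _ _ _ _ _ mV).
apply: (@disintegration _ _ _ _ _ _ _ _ _ _ _ Pr P Q a (X_ m) V
  (past_X_measurable (leqnn m)) _ H H0 mH).
move=> D B mD mB; have [_ _ HD] := XY_hmm m mB.
by rewrite -HD.
Qed.

Definition next_obs m (w : Omega) (i : nat) : Y := Y_ (m + i).+1 w.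

(** A functional of finitely many observations is read on sequences that are
    constant from some time on, like those on which [predict] evaluates it. *)
Definition cut n (s : nat -> Y) (i : nat) : Y := if (i < n)%N then s i else point.

Lemma cut_cut m n (s : nat -> Y) :
  (n <= m)%N -> cut n (cut m s) = cut n s.
Proof.
move=> nm; apply/funext => i; rewrite /cut; case: ltnP => // il.
by rewrite (leq_trans il).
Qed.

Lemma cut_next n m w :
  cut n.+1 (next_obs m w) = cons_seq (Y_ m.+1 w) (cut n (next_obs m.+1 w)).
Proof.
apply/funext => -[|i]; rewrite /cut /next_obs/= ?addn0// ltnS.
by rewrite addSnnS.
Qed.

(** The first observation enters the past before the induction hypothesis is
    used, and the Markov property then removes it. *)
Lemma predict_expectation_past n m (F : past m -> (nat -> Y) -> \bar R) :
  seq_measurable F -> (forall a s, 0 <= F a s) ->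
  \int[Pr]_w F w (cut n (next_obs m w)) =
  \int[Pr]_w predict P Q n (F w) (X_ m w).
Proof.
elim: n m F => [|n IH] m F mF F0.
  apply: eq_integral => w _ /=; congr (F w _); exact/funext.
pose F' (w : past m.+1) s := F w (cons_seq (Y_ m.+1 w) s).
have mF' : seq_measurable F'.
  move=> dT T b Z mb mZ.
  have mb' : measurable_fun setT (fun t => (b t : past m, Y_ m.+1 (b t))).
    apply: measurable_fun_pair.
      exact: (measurableT_comp (past_le_measurable (leqnSn m)) mb).
    exact: (measurableT_comp (past_Y_measurable (leqnn m.+1)) mb).
  exact: (seq_measurable_cons mF mb' mZ).
under eq_integral do rewrite cut_next.
rewrite (IH m.+1 F' mF' (fun a s => F0 _ _)).
pose H (z : past m * (X * Y)) := predict P Q n (fun s => F z.1 (cons_seq z.2.2 s)) z.2.1.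
have H0 z : 0 <= H z by apply: predict_ge0 => s; exact: F0.
have mH : measurable_fun setT H.
  have := @measurable_predict _ _ _ _ _ P Q n _ _ _ (seq_measurable_cons mF) (fun z s => F0 z.1 _).
  move=> m1; apply: (@measurableT_comp _ _ _ _ _ _
    (fun z : (past m * Y) * X => predict P Q n (fun s => F z.1.1 (cons_seq z.1.2 s)) z.2) _
    (fun z : past m * (X * Y) => ((z.1, z.2.2), z.2.1))) => //.
  apply: measurable_fun_pair; last exact: measurableT_comp.
  by apply: measurable_fun_pair => //; exact: measurableT_comp.
exact: (one_step H0 mH).
Qed.

Lemma predict_expectation n m (F : (nat -> Y) -> \bar R) :
  seq_measurable (fun _ : unit => F) -> (forall s, 0 <= F s) ->
  \int[Pr]_w F (cut n (next_obs m w)) = \int[Pr]_w predict P Q n F (X_ m w).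
Proof.
move=> mF F0; apply: (@predict_expectation_past n m (fun _ => F)) => // dT T b Z mb mZ.
have mt : measurable_fun setT (fun _ : T => tt) by exact: measurable_cst.
exact: (mF _ _ _ _ mt mZ).
Qed.

Lemma kernel_pow_ge0 n x B : 0 <= kernel_pow P n x B.
Proof. by elim: n x => //= n IH x; exact: integral_ge0. Qed.

Lemma measurable_kernel_pow n B : measurable B ->
  measurable_fun setT (fun x => kernel_pow P n x B).
Proof.
move=> mB; elim: n => [|n IH] /=.
  exact/measurable_EFinP/measurable_indic.
apply: measurable_fun_integral_kernel => //.
  by move=> U mU; exact: measurable_kernel.
by move=> z; exact: kernel_pow_ge0.
Qed.

Lemma state_law k m B : measurable B ->
  \int[Pr]_w kernel_pow P k (X_ m w) B = \int[Pr]_w kernel_pow P (m + k) (X_ 0%N w) B.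
Proof.
move=> mB; elim: m k => [//|m IH] k.
rewrite addSnnS -IH.
have mH : measurable_fun setT (fun z : past m * (X * Y) => kernel_pow P k z.2.1 B).
  apply: (measurableT_comp (measurable_kernel_pow k mB)).
  exact: measurableT_comp.
rewrite (one_step (fun z => kernel_pow_ge0 k z.2.1 B) mH).
apply: eq_integral => w _ /=; apply: eq_integral => x _.
by rewrite integral_cst// prob_kernel mule1.
Qed.

Lemma seq_cut_measurable n m (F : (nat -> Y) -> R) :
  seq_measurable (fun _ : unit => EFin \o F) ->
  measurable_fun setT (fun w => F (cut n (next_obs m w))).
Proof.
move=> mF; apply/measurable_EFinP.
have mt : measurable_fun setT (fun _ : Omega => tt) by exact: measurable_cst.
apply: (mF _ _ _ (fun i w => cut n (next_obs m w) i) mt) => i; rewrite /cut.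
by case: (i < n)%N; [exact: measurable_funP|exact: measurable_cst].
Qed.

Section domination.
Variables (n : nat) (b : (nat -> Y) -> R) (B : R).
Hypotheses (mb : seq_measurable (fun _ : unit => EFin \o b))
  (b0 : forall s, (0 <= b s)%R)
  (bB : forall x, predict P Q n (EFin \o b) x <= B%:E).

Lemma predict_integral_le m : \int[Pr]_w (b (cut n (next_obs m w)))%:E <= B%:E.
Proof.
have b0' s : 0 <= (EFin \o b) s by rewrite lee_fin.
have := predict_expectation n m mb b0'; rewrite /comp => ->.
rewrite -(@mule1 _ B%:E) -[1]/(1%:E) -(@probability_setT _ _ _ Pr) -integral_cst//.
apply: ge0_le_integral => //.
- by move=> w _; exact: predict_ge0.
- apply: (measurableT_comp (measurable_predict1 P Q n mb b0')).
  exact: measurable_funP.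
Qed.

Lemma predict_integrable m (F : (nat -> Y) -> R) :
  seq_measurable (fun _ : unit => EFin \o F) -> (forall s, (`|F s| <= b s)%R) ->
  Pr.-integrable setT (EFin \o (fun w => F (cut n (next_obs m w)))).
Proof.
move=> mF Fb; apply: (@integrable_dominated _ _ _ _ _ (fun w => b (cut n (next_obs m w)))).
- exact: seq_cut_measurable.
- by move=> w; exact: Fb.
- apply/integrableP; split; first exact/measurable_EFinP/seq_cut_measurable.
  under eq_integral => w _ do rewrite /comp gee0_abs ?lee_fin//.
  exact: le_lt_trans (predict_integral_le m) (ltry _).
Qed.

Lemma predict_Rintegral_le m : (\int[Pr]_w b (cut n (next_obs m w)) <= B)%R.
Proof.
rewrite -lee_fin /Rintegral fineK; first exact: predict_integral_le.
rewrite ge0_fin_numE; first exact: le_lt_trans (predict_integral_le m) (ltry _).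
by apply: integral_ge0 => w _; rewrite lee_fin.
Qed.

End domination.

Section mixing.
Variables (pi : probability X R) (delta K0 : R).
Hypotheses (delta01 : (0 < delta < 1)%R) (K0_ge1 : (1 <= K0)%R).
Hypothesis P_ergodic : forall x B (n : nat), measurable B ->
  `|kernel_pow P n x B - pi B| <= (K0 * delta ^+ n)%:E.

Lemma state_lawE m A : measurable A ->
  \int[Pr]_w kernel_pow P 0 (X_ m w) A = distribution Pr (X_ m) A.
Proof.
move=> mA; have mXA : measurable (X_ m @^-1` A).
  by rewrite -[X in measurable X]setTI; exact: measurable_funP.
by rewrite /distribution /pushforward -[X in Pr X]setIT -integral_indic.
Qed.

(** The law at the time [m] is the average of the [m]-step kernel over the
    initial state, and each of these kernels is close to [pi]. *)
Lemma state_law_ergodic m A : measurable A ->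
  (`|fine (distribution Pr (X_ m) A) - fine (pi A)| <= K0 * delta ^+ m)%R.
Proof.
move=> mA; have := state_law 0 m mA; rewrite addn0 state_lawE// => E.
have K1 : (0 <= K0 * delta ^+ m)%R.
  by case/andP: delta01 => d0 _; rewrite mulr_ge0 ?exprn_ge0 ?(ltW d0) ?(le_trans _ K0_ge1).
have piA : pi A = (fine (pi A))%:E by rewrite fineK// fin_num_measure.
have lawA : distribution Pr (X_ m) A = (fine (distribution Pr (X_ m) A))%:E.
  by rewrite fineK// fin_num_measure.
have pi0 : (0 <= fine (pi A))%R by rewrite fine_ge0.
have key x : exists2 r, kernel_pow P m x A = r%:E &
    (`|r - fine (pi A)| <= K0 * delta ^+ m)%R.
  have := P_ergodic x m mA; rewrite piA; have := kernel_pow_ge0 m x A.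
  case: (kernel_pow P m x A) => [r _ H|_ /=|]; [|by rewrite leye_eq|by []].
  by exists r => //; rewrite -lee_fin.
have mk : measurable_fun setT (fun w => kernel_pow P m (X_ 0%N w) A).
  by apply: (measurableT_comp (measurable_kernel_pow m mA)); exact: measurable_funP.
have up : distribution Pr (X_ m) A <= (fine (pi A) + K0 * delta ^+ m)%:E.
  rewrite E -[leRHS]mule1 -[1]/(1%:E) -(@probability_setT _ _ _ Pr) -integral_cst//.
  apply: ge0_le_integral => //.
  - by move=> w _; exact: kernel_pow_ge0.
  - move=> w _; have [r -> H] := key (X_ 0%N w); rewrite lee_fin.
    by move: H; rewrite ler_norml => /andP[_]; rewrite lerBlDl.
have lo : (fine (pi A))%:E <= distribution Pr (X_ m) A + (K0 * delta ^+ m)%:E.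
  rewrite E -[leLHS]mule1 -[1]/(1%:E) -(@probability_setT _ _ _ Pr) -integral_cst//.
  rewrite -[X in _ <= _ + X]mule1 -[1]/(1%:E) -(@probability_setT _ _ _ Pr) -integral_cst//.
  rewrite -ge0_integralD//; last by move=> w _; exact: kernel_pow_ge0.
  apply: ge0_le_integral => //; first exact: emeasurable_funD.
  move=> w _; have [r -> H] := key (X_ 0%N w); rewrite -EFinD lee_fin.
  by move: H; rewrite ler_norml => /andP[+ _]; lra.
move: up lo; rewrite lawA -EFinD !lee_fin => up lo.
by rewrite ler_norml; apply/andP; split; lra.
Qed.

Lemma state_mixing m (f : X -> R) (B : R) : measurable_fun setT f ->
  (forall x, (0 <= f x <= B)%R) ->
  (`|\int[Pr]_w f (X_ m w) - \int[Pr]_w f (X_ m.+1 w)| <= 2 * K0 * delta ^+ m * B)%R.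
Proof.
move=> mf f0B.
have E k : (\int[Pr]_w f (X_ k w) = \int[distribution Pr (X_ k)]_x f x)%R.
  rewrite /Rintegral ge0_integral_pushforward//; first exact/measurable_EFinP.
  by move=> x _; rewrite lee_fin; case/andP: (f0B x).
rewrite !E; apply: bounded_integral_dist => //; try exact: probability_setT.
move=> A mA; have h1 := state_law_ergodic m mA; have h2 := state_law_ergodic m.+1 mA.
have /andP[d0 d1] := delta01.
have h3 : (K0 * delta ^+ m.+1 <= K0 * delta ^+ m)%R.
  rewrite ler_wpM2l ?(le_trans _ K0_ge1)// exprS ler_piMl ?exprn_ge0// ltW//.
move: h1 h2; rewrite !ler_norml => /andP[a1 a2] /andP[b1 b2].
by apply/andP; split; lra.
Qed.

Lemma predict_mixing n m (F : (nat -> Y) -> R) (B : R) :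
  seq_measurable (fun _ : unit => EFin \o F) -> (forall s, (0 <= F s)%R) ->
  (forall x, predict P Q n (EFin \o F) x <= B%:E) ->
  (`|\int[Pr]_w F (cut n (next_obs m w)) - \int[Pr]_w F (cut n (next_obs m.+1 w))|
    <= 2 * K0 * delta ^+ m * B)%R.
Proof.
move=> mF F0 FB.
have F0' s : 0 <= (EFin \o F) s by rewrite lee_fin.
pose f x := fine (predict P Q n (EFin \o F) x).
have fE x : predict P Q n (EFin \o F) x = (f x)%:E.
  rewrite fineK// ge0_fin_numE ?predict_ge0//; exact: le_lt_trans (FB x) (ltry _).
have E k : (\int[Pr]_w F (cut n (next_obs k w)) = \int[Pr]_w f (X_ k w))%R.
  rewrite /Rintegral; congr fine.
  have := predict_expectation n k mF F0'; rewrite /comp => ->.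
  by apply: eq_integral => w _; rewrite -fE.
rewrite !E; apply: state_mixing.
- by apply: measurableT_comp => //; exact: measurable_predict1.
- by move=> x; rewrite -!lee_fin -fE FB andbT; exact: predict_ge0.
Qed.

(** The nonnegative functionals [F + b] and [b] are treated separately; the
    former has predictions at most [2 * B], whence the constant [6 = 4 + 2]. *)
Lemma predict_mixing_signed n m (F b : (nat -> Y) -> R) (B : R) :
  seq_measurable (fun _ : unit => EFin \o F) ->
  seq_measurable (fun _ : unit => EFin \o b) ->
  (forall s, (`|F s| <= b s)%R) ->
  (forall x, predict P Q n (EFin \o b) x <= B%:E) ->
  (`|\int[Pr]_w F (cut n (next_obs m w)) - \int[Pr]_w F (cut n (next_obs m.+1 w))|
    <= 6 * K0 * delta ^+ m * B)%R.
Proof.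
move=> mF mb Fb bB.
have b0 s : (0 <= b s)%R by exact: le_trans (Fb s).
have mG : seq_measurable (fun _ : unit => EFin \o (fun s => F s + b s)%R).
  move=> dT T c Z mc mZ; apply/measurable_EFinP; apply: measurable_funD.
  - exact/measurable_EFinP/(mF _ _ _ _ mc mZ).
  - exact/measurable_EFinP/(mb _ _ _ _ mc mZ).
have G0 s : (0 <= F s + b s)%R by have := Fb s; rewrite ler_norml => /andP[+ _]; lra.
have GB x : predict P Q n (EFin \o (fun s => F s + b s)%R) x <= (2 * B)%:E.
  have L := @predict_leZ _ _ _ _ _ P Q n (EFin \o (fun s => F s + b s)%R) (EFin \o b)
    x 2 (ler0n _ 2) mG mb.
  apply: (@le_trans _ _ (2%:E * predict P Q n (EFin \o b) x)); last first.
    by rewrite EFinM lee_wpmul2l.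
  apply: L => s; first by rewrite lee_fin.
  - by rewrite lee_fin.
  - by rewrite -EFinM lee_fin; have := Fb s; rewrite ler_norml => /andP[_ +]; lra.
have iF k := predict_integrable mb b0 bB k mF Fb.
have bb s : (`|b s| <= b s)%R by rewrite ger0_norm.
have ib k := predict_integrable mb b0 bB k mb bb.
have := predict_mixing m mG G0 GB; have := predict_mixing m mb b0 bB.
rewrite !RintegralD//.
rewrite -[(2 * K0 * _)%R]mulrA -[(6 * K0 * _)%R]mulrA.
move: (\int[Pr]_w F _)%R (\int[Pr]_w F _)%R (\int[Pr]_w b _)%R (\int[Pr]_w b _)%R (K0 * delta ^+ m)%R.
move=> I1 I2 J1 J2 e; rewrite !ler_norml => /andP[a1 a2] /andP[b1 b2].
by apply/andP; split; lra.
Qed.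

End mixing.
End hidden_markov_process.

(** * Geometrically Cauchy sequences and arrays *)

Section geometric.
Context {R : realType}.

(** The geometric rate is raised to [r = sqrt k], and [n.+1 * r ^+ n] is bounded
    because [(1 + s) ^+ n >= 1 + n * s] for [s = r^-1 - 1]. *)
Lemma linear_geometric (k : R) : 0 < k < 1 ->
  exists G r : R, [/\ 0 <= G, 0 < r < 1, k <= r & forall n, n.+1%:R * k ^+ n <= G * r ^+ n].
Proof.
move=> /andP[k0 k1].
pose r := Num.sqrt k.
have r0 : 0 < r by rewrite sqrtr_gt0.
have r1 : r < 1 by rewrite -[X in _ < X]sqrtr1 ltr_sqrt.
have rk : r * r = k by rewrite -expr2 sqr_sqrtr// ltW.
have kr : k <= r by rewrite -rk ler_piMr// ltW.
pose s := r^-1 - 1.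
have s0 : 0 < s by rewrite subr_gt0 invf_gt1.
have rE : r = (1 + s)^-1 by rewrite /s addrC subrK invrK.
have s1 : 0 < 1 + s by rewrite addr_gt0.
have H n : n.+1%:R * r ^+ n <= 1 + s^-1.
  have b : 1 + n%:R * s <= (1 + s) ^+ n.
    elim: n => [|n IH]; first by rewrite mul0r addr0 expr0.
    rewrite exprS; have s10 : 0 <= 1 + s by rewrite addr_ge0// ltW.
    apply: le_trans (ler_wpM2l s10 IH); rewrite -natr1.
    have : 0 <= s * (n%:R * s) by rewrite !mulr_ge0// ltW.
    lra.
  rewrite rE exprVn ler_pdivrMr ?exprn_gt0//.
  have i0 : 0 <= 1 + s^-1 by rewrite addr_ge0// invr_ge0 ltW.
  apply: le_trans (ler_wpM2l i0 b); rewrite -natr1.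
  have : s^-1 * (n%:R * s) = n%:R by rewrite mulrCA mulVf ?mulr1// gt_eqF.
  have : 0 <= s^-1 by rewrite invr_ge0 ltW.
  have : 0 <= n%:R * s by rewrite mulr_ge0// ltW.
  lra.
have i0 : 0 <= 1 + s^-1 by rewrite addr_ge0// invr_ge0 ltW.
exists (1 + s^-1); exists r; split; [exact: i0|by rewrite r0 r1|exact: kr|].
move=> n; rewrite -{1}rk exprMn mulrA ler_wpM2r//.
by rewrite exprn_ge0// ltW.
Qed.

Lemma geometric_sum_le (r : R) n m : 0 < r < 1 ->
  \sum_(i < n) r ^+ (m + i) <= r ^+ m / (1 - r).
Proof.
move=> /andP[r0 r1]; rewrite ler_pdivlMr ?subr_gt0//.
have E : (\sum_(i < n) r ^+ (m + i)) * (1 - r) = r ^+ m - r ^+ (m + n).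
  elim: n => [|n IH]; first by rewrite big_ord0 mul0r addn0 subrr.
  rewrite big_ord_recr/= mulrDl IH addnS exprS; ring.
by rewrite E lerBlDr lerDl exprn_ge0// ltW.
Qed.

Lemma telescope_le (v : nat -> R) (C r : R) n m : 0 < r < 1 -> 0 <= C ->
  (forall i, (m <= i)%N -> `|v i.+1 - v i| <= C * r ^+ i) ->
  `|v (m + n)%N - v m| <= C * r ^+ m / (1 - r).
Proof.
move=> r01 C0 H; rewrite -mulrA.
apply: (@le_trans _ _ (C * \sum_(i < n) r ^+ (m + i))); last first.
  by rewrite ler_wpM2l// geometric_sum_le.
elim: n => [|n IH]; first by rewrite addn0 subrr normr0 big_ord0 mulr0.
rewrite big_ord_recr/= mulrDr addnS.
have -> : v (m + n).+1 - v m = (v (m + n)%N - v m) + (v (m + n).+1 - v (m + n)%N) by ring.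
by apply: le_trans (ler_normD _ _) _; rewrite lerD// H// leq_addr.
Qed.

(** From the entry [(m, j)] one reaches the diagonal along its row if [m <= j]
    and along its column otherwise. A column is thus followed beyond its diagonal
    entry only, where the factor [j.+1] of its steps comes with at least [j]
    factors [k] and is absorbed by the passage to the rate [r]. *)
Lemma double_array (u : nat -> nat -> R) (A k G r l : R) :
  0 <= A -> 0 < k < 1 -> 0 <= G -> 0 < r < 1 -> k <= r ->
  (forall n, n.+1%:R * k ^+ n <= G * r ^+ n) ->
  (forall m j, `|u m j.+1 - u m j| <= A * (j.+1%:R * k ^+ j)) ->
  (forall m j, `|u m.+1 j - u m j| <= A * (j.+1%:R * k ^+ m)) ->
  u n n @[n --> \oo] --> l ->
  exists2 E, 0 <= E & forall m j, `|u m j - l| <= E * (r ^+ m + r ^+ j).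
Proof.
move=> A0 k01 G0 r01 kr kG H1 H2 ul.
have /andP[k0 k1] := k01; have /andP[r0 r1] := r01.
have r1' : 0 < 1 - r by rewrite subr_gt0.
have k1' : 0 < 1 - k by rewrite subr_gt0.
have AG : 0 <= A * G by rewrite mulr_ge0.
have H1' m j : `|u m j.+1 - u m j| <= A * G * r ^+ j.
  by apply: le_trans (H1 m j) _; rewrite -mulrA ler_wpM2l.
have D n : `|u n.+1 n.+1 - u n n| <= 2 * (A * G) * r ^+ n.
  have -> : u n.+1 n.+1 - u n n = (u n.+1 n.+1 - u n.+1 n) + (u n.+1 n - u n n) by ring.
  apply: le_trans (ler_normD _ _) _.
  rewrite mulr_natl mulr2n mulrDl lerD//; apply: le_trans (H2 n n) _.
  by rewrite -mulrA ler_wpM2l.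
have AG2 : 0 <= 2 * (A * G) by rewrite mulr_ge0.
have Dl n : `|u n n - l| <= 2 * (A * G) * r ^+ n / (1 - r).
  rewrite distrC; apply/ler_addgt0Pr => e e0.
  have /cvgrPdist_lt/(_ e e0)[N _ HN] := ul.
  have := HN (n + N)%N (leq_addl _ _); rewrite /= => h.
  have t := @telescope_le (fun i => u i i) (2 * (A * G)) r N n r01 AG2 (fun i _ => D i).
  have -> : l - u n n = (l - u (n + N)%N (n + N)%N) + (u (n + N)%N (n + N)%N - u n n) by ring.
  by apply: le_trans (ler_normD _ _) _; rewrite addrC lerD// ltW.
exists (2 * (A * G) / (1 - r) + A * G / (1 - r) + A * G / (1 - k)).
  by rewrite !addr_ge0// divr_ge0// ltW.
move=> m j; have Er i : 0 <= r ^+ i by rewrite exprn_ge0// ltW.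
have [mj|jm] := leqP m j.
- rewrite -(subnKC mj).
  have t := @telescope_le (u m) (A * G) r (j - m)%N m r01 AG (fun i _ => H1' m i).
  have -> : u m (m + (j - m))%N - l = (u m (m + (j - m))%N - u m m) + (u m m - l) by ring.
  apply: le_trans (ler_normD _ _) _; apply: le_trans (lerD t (Dl m)) _.
  set rm := r ^+ m; set rj := r ^+ _.
  have p1 : 0 <= (2 * (A * G) / (1 - r) + A * G / (1 - r) + A * G / (1 - k)) * rj.
    by rewrite mulr_ge0 ?Er// ?addr_ge0// divr_ge0// ltW.
  have p2 : 0 <= A * G / (1 - k) * rm by rewrite mulr_ge0 ?Er// divr_ge0// ltW.
  rewrite mulrDr -[A * G * rm / _]mulrAC -[2 * (A * G) * rm / _]mulrAC; lra.
- rewrite -(subnKC (ltnW jm)).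
  have AJ : 0 <= A * j.+1%:R by rewrite mulr_ge0.
  have t := @telescope_le (u ^~ j) (A * j.+1%:R) k (m - j)%N j k01 AJ.
  have {t} t : `|u (j + (m - j))%N j - u j j| <= A * G * r ^+ j / (1 - k).
    apply: le_trans (t _) _.
      by move=> i _; apply: le_trans (H2 i j) _; rewrite mulrA.
    rewrite ler_wpM2r ?invr_ge0 ?(ltW k1')// -!mulrA ler_wpM2l//.
  have -> : u (j + (m - j))%N j - l = (u (j + (m - j))%N j - u j j) + (u j j - l) by ring.
  apply: le_trans (ler_normD _ _) _; apply: le_trans (lerD t (Dl j)) _.
  set rj := r ^+ j; set rm := r ^+ _.
  have p1 : 0 <= (2 * (A * G) / (1 - r) + A * G / (1 - r) + A * G / (1 - k)) * rm.
    by rewrite mulr_ge0 ?Er// ?addr_ge0// divr_ge0// ltW.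
  have p2 : 0 <= A * G / (1 - r) * rj by rewrite mulr_ge0 ?Er// divr_ge0// ltW.
  rewrite mulrDr -[A * G * rj / _]mulrAC -[2 * (A * G) * rj / _]mulrAC; lra.
Qed.

(** Along the antidiagonal [m + j = n.-1] the errors are two geometric sums. *)
Lemma cesaro_bound (u : nat -> nat -> R) (E r l : R) n : 0 <= E -> 0 < r < 1 ->
  (forall m j, `|u m j - l| <= E * (r ^+ m + r ^+ j)) ->
  `|\sum_(m < n) u m (n.-1 - m)%N - n%:R * l| <= 2 * E / (1 - r).
Proof.
move=> E0 r01 H.
have -> : \sum_(m < n) u m (n.-1 - m)%N - n%:R * l = \sum_(m < n) (u m (n.-1 - m)%N - l).
  by rewrite sumrB sumr_const card_ord mulr_natl.
apply: le_trans (ler_norm_sum _ _ _) _.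
apply: (@le_trans _ _ (\sum_(m < n) E * (r ^+ m + r ^+ (n.-1 - m)))).
  by apply: ler_sum => m _; exact: H.
rewrite -mulr_sumr big_split/= (_ : 2 * E / (1 - r) = E * (2 * (1 - r)^-1)); last by ring.
rewrite ler_wpM2l//.
have S : \sum_(m < n) r ^+ m <= (1 - r)^-1.
  have := @geometric_sum_le r n 0 r01; rewrite expr0 mul1r.
  by under eq_bigr do rewrite add0n.
have S' : \sum_(m < n) r ^+ (n.-1 - m) <= (1 - r)^-1.
  rewrite (reindex_inj rev_ord_inj)/=; apply: le_trans S.
  rewrite le_eqVlt; apply/orP; left; apply/eqP; apply: eq_bigr => m _.
  congr (_ ^+ _); case: n m => [[]//|n m] /=.
  by rewrite subSS subKn// -ltnS.
lra.
Qed.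

End geometric.

Section uniform_limit.
Context {R : realType} {d : nat}.
Variable (Theta : set 'rV[R]_d).
Hypothesis Theta_open : open Theta.

Lemma counting1 i : (@counting nat R) [set i] = 1%E.
Proof.
rewrite /counting asboolT; last exact: finite_set1.
by rewrite fset_set1 finmap.cardfs1.
Qed.

(** The limit is the sum of the series of the increments, that is, an integral
    for the counting measure: termwise differentiation becomes an instance of
    differentiation under the integral. *)
Lemma jet_cauchy_limit (p : nat) (f : nat -> 'rV[R]_d -> R) (C r : R) :
  0 <= C -> 0 < r < 1 ->
  (forall n, differentiable_n p (f n) Theta) ->
  (forall n th, Theta th -> jet_norm 1 p (fun t => f n.+1 t - f n t) th <= C * r ^+ n) ->
  exists l, differentiable_n p l Theta /\
    forall th, Theta th -> f n th @[n --> \oo] --> l th.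
Proof.
move=> C0 /andP[r0 r1] df fC.
pose mu : {measure set nat -> \bar R} := @counting nat R.
pose h n t := f n.+1 t - f n t.
pose b n := C * r ^+ n.
have b0 n : 0 <= b n by rewrite mulr_ge0// exprn_ge0// ltW.
have mN (g : nat -> R) : measurable_fun setT g by move=> _ B _; exact: I.
have ib : mu.-integrable setT (EFin \o b).
  apply/integrableP; split; first exact/measurable_EFinP.
  under eq_integral do rewrite gee0_abs ?lee_fin//.
  rewrite ge0_integral_count//.
  apply: (@le_lt_trans _ _ (C / (1 - r))%:E); last exact: ltry.
  apply: lime_le; first by apply: is_cvg_nneseries => n _ _; rewrite lee_fin.
  near=> n; rewrite sumEFin lee_fin big_mkord -mulr_sumr ler_wpM2l//.
  have := @geometric_sum_le R r n 0; rewrite r0 r1 expr0 mul1r => /(_ isT).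
  by under eq_bigr do rewrite add0n.
have H : dominated_family Theta mu p h b.
  by split=> // n; exact: dnB.
exists (fun t => f 0%N t + \int[mu]_n h n t); split.
  apply: dnD => //; exact: (dn_integral Theta_open H).
move=> th Tth.
(* The partial sums, as integrals of truncations. *)
pose g n j : R := \sum_(i < n) h i th * \1_[set nat_of_ord i] j.
have gE n j : g n j = if (j < n)%N then h j th else 0.
  rewrite /g; case: ifPn => jn.
    rewrite (bigD1 (Ordinal jn))//= indicE mem_set// mulr1 big1 ?addr0// => i ij.
    rewrite indicE memNset ?mulr0// => /= ji; move/eqP: ij; apply.
    exact/val_inj.
  rewrite big1// => i _; rewrite indicE memNset ?mulr0// => /= ji.
  by move: jn; rewrite ji ltn_ord.
have hb j : `|h j th| <= b j.
  by apply: le_trans (fC j th Tth); exact: normr_jet_norm.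
have fg n : f n th = f 0%N th + \int[mu]_j g n j.
  have mu1 i : mu.-integrable setT (EFin \o \1_[set nat_of_ord (i : 'I_n)]).
    apply/integrableP; split; first exact/measurable_EFinP.
    under eq_integral do rewrite gee0_abs ?lee_fin//.
    by rewrite integral_indic// setIT /mu/= counting1 ltry.
  rewrite Rintegral_sum; last by move=> i; exact: integrableZlr.
  rewrite (eq_bigr (fun i : 'I_n => h i th)); last first.
    move=> i _; rewrite RintegralZl// /Rintegral integral_indic// setIT /mu/= counting1.
    by rewrite mulr1.
  rewrite -(big_mkord xpredT (fun i => h i th)) /h telescope_sumr//.
  by rewrite addrC subrK.
have cvg_g : (fun n => \int[mu]_j g n j) @ \oo --> \int[mu]_j h j th.
  apply: (Rintegral_dominated_cvg (b := b)) => //.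
  - move=> j; apply/cvgrPdist_lt => e e0; exists j.+1 => // n /= jn.
    by rewrite gE jn subrr normr0.
  - by move=> n j; rewrite gE; case: ifP; rewrite ?normr0.
rewrite (_ : (fun n => f n th) = fun n => f 0%N th + \int[mu]_j g n j); last exact/funext.
by apply: cvgD => //; exact: cvg_cst.
Unshelve. all: by end_near. Qed.

End uniform_limit.

(** * Means of functionals of the observations *)

Section observation_means.
Context {R : realType} {d : nat}.
Variable (Theta : set 'rV[R]_d).
Hypothesis Theta_open : open Theta.
Context {dX dY dO : measure_display}.
Context {X : measurableType dX} {Y : measurableType dY} {Omega : measurableType dO}.
Variables (Pr : probability Omega R) (P : R.-pker X ~> X) (Q : R.-pker X ~> Y).
Variables (X_ : nat -> {mfun Omega >-> X}) (Y_ : nat -> {mfun Omega >-> Y}).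
Hypothesis XY_hmm : hidden_markov Pr P Q X_ Y_.
Variables (pi : probability X R) (delta K0 : R).
Hypotheses (delta01 : 0 < delta < 1) (K0_ge1 : 1 <= K0).
Hypothesis P_ergodic : forall x B (n : nat), measurable B ->
  (`|kernel_pow P n x B - pi B| <= (K0 * delta ^+ n)%:E)%E.
Variables (e : Y -> R) (M : R).
Hypotheses (e_meas : measurable_fun setT e) (e_ge0 : forall y, 0 <= e y).
Hypothesis e_int : forall x, (\int[Q x]_y (e y)%:E <= M%:E)%E.

Local Notation dn := (fun k f => differentiable_n k f Theta).
Local Notation seqmeas F := (seq_measurable (fun _ : unit => EFin \o F)).
Local Notation obs n m w := (cut n (next_obs Y_ m w)).

(** All functionals of the observations below are bounded by such sums, whose
    prediction is linear in [n] whatever the hidden state. *)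
Definition weight_sum n (s : nat -> Y) : R := \sum_(k < n) e (s k).

Lemma weight_sum_meas (a : R) n : seqmeas (fun s => a * weight_sum n s).
Proof.
move=> dT T b Z _ mZ; apply/measurable_EFinP; apply: measurable_funM => //.
by apply: measurable_sum => k; exact: measurableT_comp.
Qed.

Lemma weight_sum_ge0 n s : 0 <= weight_sum n s.
Proof. by apply: sumr_ge0 => k _. Qed.

Lemma e_moment_ge0 : 0 <= M.
Proof.
rewrite -lee_fin; apply: le_trans (e_int point); apply: integral_ge0 => y _.
by rewrite lee_fin.
Qed.

Lemma weight_sum_predict (a : R) n x : 0 <= a ->
  (predict P Q n (EFin \o (fun s => a * weight_sum n s)%R) x <= (a * (n%:R * M))%:E)%E.
Proof.
move=> a0.
have H := @predict_sum_le _ _ _ _ _ P Q n (fun _ y => a * e y) (fun=> a * M) 0 x (lexx 0).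
rewrite add0r sumr_const card_ord -mulr_natl mulrCA in H.
rewrite (_ : EFin \o _ = fun s : nat -> Y => (0 + \sum_(k < n) a * e (s k))%:E); last first.
  by apply/funext => s /=; rewrite add0r /weight_sum mulr_sumr.
apply: H => [_|_ y|_ z]; first exact: measurable_funM.
  by rewrite mulr_ge0.
under eq_integral do rewrite EFinM.
rewrite ge0_integralZl//; last 2 first.
  exact/measurable_EFinP.
  by move=> y _; rewrite lee_fin.
by rewrite EFinM lee_wpmul2l// lee_fin.
Qed.

Section family.
Variables (n : nat) (a : R).
Hypothesis a0 : 0 <= a.

(** The hypotheses under which the mean of [F] over [n] observations can be
    differentiated [k] times. *)
Definition controlled k (F : (nat -> Y) -> 'rV[R]_d -> R) :=
  [/\ forall s, dn k (F s),
      forall th, Theta th -> seqmeas (F ^~ th)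
    & forall s th, Theta th -> jet_norm 1 k (F s) th <= a * weight_sum n s].

Definition obs_mean m (F : (nat -> Y) -> 'rV[R]_d -> R) th :=
  \int[Pr]_w F (obs n m w) th.

Lemma controlled_dominated k m F : controlled k F ->
  dominated_family Theta Pr k (fun w => F (obs n m w)) (fun w => a * weight_sum n (obs n m w)).
Proof.
move=> [dF mF bF]; split => [w|th Tth|w th Tth|].
- exact: dF.
- exact: (seq_cut_measurable Y_ n m (mF th Tth)).
- exact: bF.
- apply: (predict_integrable XY_hmm (weight_sum_meas a n) _ (fun x => weight_sum_predict n x a0)
    m (weight_sum_meas a n)).
    by move=> s; rewrite mulr_ge0// weight_sum_ge0.
  by move=> s; rewrite ger0_norm// mulr_ge0// weight_sum_ge0.
Qed.

Lemma obs_mean_dn k m F : controlled k F -> dn k (obs_mean m F).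
Proof. by move=> /(controlled_dominated m) H; exact: (dn_integral Theta_open H). Qed.

Lemma obs_mean_jet_le k m F th : controlled k F -> Theta th ->
  jet_norm 1 k (obs_mean m F) th <= a * (n%:R * M).
Proof.
move=> cF Tth; have H := controlled_dominated m cF.
have t01 : (0 : R) <= (1 : R) <= (1 : R) by rewrite ler01 lexx.
apply: le_trans (jet_norm_integral Theta_open t01 H Tth) _.
apply: (@le_trans _ _ (\int[Pr]_w (a * weight_sum n (obs n m w)))).
  have [_ _ Hb ib] := H.
  apply: le_Rintegral => //; first exact: (integrable_jet_norm Theta_open t01 H Tth).
  by move=> w _; exact: Hb.
apply: (predict_Rintegral_le XY_hmm (weight_sum_meas a n)).
  by move=> s; rewrite mulr_ge0// weight_sum_ge0.
by move=> x; exact: weight_sum_predict.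
Qed.

Lemma controlled_partial k i F : controlled k.+1 F -> controlled k (fun s => partial i (F s)).
Proof.
move=> [dF mF bF]; split => [s|th Tth|s th Tth].
- exact: dn_partial.
- move=> dT T b Z mb mZ; apply/measurable_EFinP.
  apply: (measurable_partial Theta_open i (h := fun z => F (fun i => Z i z)) Tth) => [z|t Tt].
    by have [] := dF (fun i => Z i z) => + _; exact.
  by apply/measurable_EFinP; exact: (mF t Tt _ _ _ _ mb mZ).
- apply: le_trans (bF s th Tth); apply: le_trans (jet_norm_partial k (F s) th ler01).
  rewrite mul1r (bigD1 i)//= lerDl sumr_ge0// => j _; exact: jet_norm_ge0.
Qed.

(** The derivatives of a mean are the means of the derivatives, which satisfy
    the same bound as the functional itself; the mixing estimate thus applies to
    each of them, and they number [(1 + d) ^+ k] with multiplicity. *)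
Lemma obs_mean_jet_mixing k m F th : controlled k F -> Theta th ->
  jet_norm 1 k (fun t => obs_mean m F t - obs_mean m.+1 F t) th <=
    (1 + d%:R) ^+ k * (6 * K0 * delta ^+ m * (a * (n%:R * M))).
Proof.
move=> + Tth; elim: k F => [|k IH] F cF.
  rewrite expr0 mul1r; have [_ mF bF] := cF.
  apply: (predict_mixing_signed XY_hmm delta01 K0_ge1 P_ergodic m (mF th Tth)
    (weight_sum_meas a n)).
    by move=> s; exact: bF.
  by move=> x; exact: weight_sum_predict.
have cFk : controlled k F.
  have [dF mF bF] := cF; split => // [s|s t Tt]; first exact: dnW (dF s).
  by apply: le_trans (bF s t Tt); exact: jet_norm_leS.
have B0 := IH F cFk; rewrite [jet_norm _ _ _ _]/= mul1r exprS.
set B := _ * (_ * (a * _)) in B0 *.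
rewrite -mulrA mulrDl mul1r lerD//.
apply: (@le_trans _ _ (\sum_(i < d) B)); last by rewrite sumr_const card_ord mulr_natl.
apply: ler_sum => i _; have cP := controlled_partial i cF.
rewrite (jet_norm_ext Theta_open _ _ Tth (g := fun t =>
  obs_mean m (fun s => partial i (F s)) t - obs_mean m.+1 (fun s => partial i (F s)) t)).
  exact: IH.
move=> t Tt.
have H1 := controlled_dominated m cF; have H2 := controlled_dominated m.+1 cF.
rewrite partialB; last 2 first.
  by have [+ _] := dn_integral Theta_open H1; exact.
  by have [+ _] := dn_integral Theta_open H2; exact.
by rewrite (partial_integral Theta_open i H1 Tt) (partial_integral Theta_open i H2 Tt).
Qed.

End family.

Section increments.
Variables (p : nat) (u : nat -> (nat -> Y) -> 'rV[R]_d -> R) (rho : R).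
Hypothesis rho01 : 0 < rho < 1.
Hypothesis u_ctrl : forall n, controlled n.+1 1 p (u n).
Hypothesis du_ctrl : forall n,
  controlled n.+2 (rho ^+ n) p (fun s t => u n.+1 s t - u n s t).
Hypothesis u_local : forall n s, u n (cut n.+1 s) = u n s.

Let rate_max := Num.max rho delta.
Let mean m j := obs_mean j.+1 m (u j).

Let rate_max01 : 0 < rate_max < 1.
Proof.
have /andP[r0 r1] := rho01; have /andP[d0 d1] := delta01.
by rewrite /rate_max lt_max r0 gt_max r1 d1.
Qed.

Let mean_const := 2 * M + (1 + d%:R) ^+ p * (6 * K0 * M).

Let KM0 : 0 <= (1 + d%:R) ^+ p * (6 * K0 * M).
Proof.
have M0 := e_moment_ge0; have K0' : 0 <= K0 by rewrite (le_trans _ K0_ge1).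
by rewrite mulr_ge0 ?exprn_ge0 ?addr_ge0// !mulr_ge0.
Qed.

Let mean_const_ge0 : 0 <= mean_const.
Proof. by rewrite addr_ge0// mulr_ge0// e_moment_ge0. Qed.

Let mean_dn m j : dn p (mean m j).
Proof. exact: (obs_mean_dn ler01 m (u_ctrl j)). Qed.

Let rho_le n : rho ^+ n <= rate_max ^+ n.
Proof.
have /andP[r0 _] := rho01; rewrite lerXn2r ?nnegrE ?(ltW r0)//; last first.
  by rewrite /rate_max le_max lexx.
by rewrite /rate_max le_max (ltW r0).
Qed.

Let delta_le n : delta ^+ n <= rate_max ^+ n.
Proof.
have /andP[r0 _] := delta01; rewrite lerXn2r ?nnegrE ?(ltW r0)//; last first.
  by rewrite /rate_max le_max lexx orbT.
by rewrite /rate_max le_max (ltW r0) orbT.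
Qed.

Let rate_max_ge0 n : 0 <= rate_max ^+ n.
Proof. by have /andP[r0 _] := rate_max01; rewrite exprn_ge0// ltW. Qed.

(** [u j] and [u j.+1] are compared on the same observations thanks to their
    locality. *)
Let mean_step m j th : Theta th ->
  jet_norm 1 p (fun t => mean m j.+1 t - mean m j t) th <=
    2 * M * (j.+1%:R * rate_max ^+ j).
Proof.
move=> Tth; have r0 : 0 <= rho ^+ j by have /andP[r0 _] := rho01; rewrite exprn_ge0// ltW.
rewrite (jet_norm_ext Theta_open _ _ Tth
  (g := obs_mean j.+2 m (fun s t => u j.+1 s t - u j s t))); last first.
  move=> t Tt; rewrite /mean /obs_mean RintegralB//.
  - congr (_ - _); apply: eq_Rintegral => w _.
    by rewrite -(u_local j (cut j.+2 _)) cut_cut.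
  - exact: dominated_family_integrable (controlled_dominated ler01 m (u_ctrl j.+1)) Tt.
  - rewrite (_ : _ \o _ = EFin \o (fun w => u j (obs j.+1 m w) t)).
      exact: dominated_family_integrable (controlled_dominated ler01 m (u_ctrl j)) Tt.
    by apply/funext => w /=; rewrite -(u_local j (cut j.+2 _)) cut_cut.
apply: le_trans (obs_mean_jet_le r0 m (du_ctrl j) Tth) _.
rewrite mulrC [leRHS](_ : _ = (2 * j.+1%:R * M) * rate_max ^+ j); last by ring.
rewrite ler_pM ?mulr_ge0 ?e_moment_ge0 ?rho_le//.
by rewrite ler_wpM2r ?e_moment_ge0// -natrM ler_nat mul2n -addnn addnS ltnS leq_addr.
Qed.

Let mean_shift m j th : Theta th ->
  jet_norm 1 p (fun t => mean m j t - mean m.+1 j t) th <=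
    (1 + d%:R) ^+ p * (6 * K0 * M) * (j.+1%:R * rate_max ^+ m).
Proof.
move=> Tth; apply: le_trans (obs_mean_jet_mixing ler01 m (u_ctrl j) Tth) _.
rewrite mul1r [leLHS](_ : _ = (1 + d%:R) ^+ p * (6 * K0 * M) * (j.+1%:R * delta ^+ m)); last by ring.
by rewrite ler_wpM2l// ler_wpM2l.
Qed.

(** The array [mean m j] and its derivatives are geometrically Cauchy in [j] by
    the contraction of [u] and in [m] by mixing. The diagonal is Cauchy for the
    jets, hence its limit is smooth; the value of every entry is then compared
    with this limit. *)
Lemma mean_limit : exists l, dn p l /\ forall th, Theta th ->
  exists E, forall n,
    `|\sum_(m < n) mean m (n.-1 - m)%N th - n%:R * l th| <= E.
Proof.
have [G [r [G0 r01 kr kG]]] := linear_geometric rate_max01.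
have Hd j th : Theta th -> jet_norm 1 p (fun t => mean j.+1 j.+1 t - mean j j t) th <=
    (mean_const * G) * r ^+ j.
  move=> Tth.
  apply: le_trans (jet_norm_triangle Theta_open (g := mean j.+1 j) ler01 Tth _ _ _) _ => //.
  rewrite [X in _ + X](jet_norm_distC Theta_open)//.
  apply: le_trans (lerD (mean_step j.+1 j Tth) (mean_shift j j Tth)) _.
  by rewrite -mulrDl -[leRHS]mulrA ler_wpM2l.
have C0 : 0 <= mean_const * G by rewrite mulr_ge0.
have [l [dl Hl]] := jet_cauchy_limit Theta_open C0 r01 (fun j => mean_dn j j) Hd.
exists l; split => // th Tth.
have jn (f : 'rV[R]_d -> R) : `|f th| <= jet_norm 1 p f th by exact: normr_jet_norm.
have M0 := e_moment_ge0.
have H1 m j : `|mean m j.+1 th - mean m j th| <= mean_const * (j.+1%:R * rate_max ^+ j).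
  apply: le_trans (jn (fun t => mean m j.+1 t - mean m j t)) _.
  apply: le_trans (mean_step m j Tth) _.
  by rewrite ler_wpM2r ?mulr_ge0// lerDl.
have H2 m j : `|mean m.+1 j th - mean m j th| <= mean_const * (j.+1%:R * rate_max ^+ m).
  rewrite distrC; apply: le_trans (jn (fun t => mean m j t - mean m.+1 j t)) _.
  apply: le_trans (mean_shift m j Tth) _.
  by rewrite ler_wpM2r ?mulr_ge0// lerDr mulr_ge0.
have [E E0 HE] := double_array (u := fun m j => mean m j th) mean_const_ge0 rate_max01 G0
  r01 kr kG H1 H2 (Hl th Tth).
exists (2 * E / (1 - r)) => n.
exact: (cesaro_bound (u := fun m j => mean m j th) n E0 r01 HE).
Qed.

End increments.
End observation_means.

(** * Forgetting of the initial state by the likelihoods *)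

(** The constants [s], [e] and [k] are, for a contraction factor [1 - m], the
    admissible oscillation, the admissible size of a perturbation, and the
    distance between two successive normalized likelihoods. The last inequality
    says that contraction, perturbation and renormalization together keep the
    oscillation below [s]. *)
Lemma cone_numerics (R : realType) (m s e k : R) : 0 < m < 1 ->
  s = m / 16 -> e = m * s / 8 -> k = s + e * (1 + s) ->
  [/\ 0 < s, 0 < e, 0 < k < m / 8, k < 1 / 8 &
    ((1 - m) * s + 2 * (e * (1 + s))) * (1 - k)^-1 <= s].
Proof.
move=> /andP[m0 m1] sE eE kE.
have s0 : 0 < s by lra.
have s1 : s < 1 / 16 by lra.
have ms0 : 0 < m * s by rewrite mulr_gt0.
have e0 : 0 < e by lra.
have ms : m * s <= m / 16 by rewrite ler_wpM2l ?(ltW m0)//; lra.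
have e1 : e * (1 + s) <= m * s * (17 / 128).
  apply: (@le_trans _ _ (e * (17 / 16))); last lra.
  by rewrite ler_wpM2l ?(ltW e0)//; lra.
have k0 : 0 < k by rewrite kE addr_gt0// mulr_gt0// addr_gt0.
have km : k < m / 8 by lra.
have k8 : k < 1 / 8 by lra.
split=> //; first by rewrite k0.
rewrite ler_pdivrMr; last lra.
have : s * k <= s * (m / 8) by rewrite ler_wpM2l// ltW.
have -> : s * (m / 8) = m * s / 8 by ring.
lra.
Qed.

(** The densities [r y x' x th] stand for the product of the observation density
    and the transition density. The comparison of the densities with a measure
    that does not depend on the state appears through its consequences [r_mix],
    with [q = eps ^+ 2], and [r_mass]; the bounds on the derivatives are condensed
    in [r_jet]. *)
Section likelihood_recursion.
Context {R : realType} {d : nat}.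
Variable (Theta : set 'rV[R]_d).
Hypothesis Theta_open : open Theta.
Context {dX dY : measure_display} {X : measurableType dX} {Y : measurableType dY}.
Variable mu : {finite_measure set X -> \bar R}.
Variables (p : nat) (r : Y -> X -> X -> 'rV[R]_d -> R).
Variables (psi L : Y -> R) (phi : Y -> X -> R) (q : R) (xs : X).

Local Notation dn := (fun k f => differentiable_n k f Theta).
Local Notation sh y := (fun i : nat => y i.+1).
Local Notation bfam := (bounded_family Theta p).

Hypothesis r_ge0 : forall y x' x th, Theta th -> 0 <= r y x' x th.
Hypothesis r_meas : forall th, Theta th ->
  measurable_fun setT (fun z : (Y * X) * X => r z.1.1 z.1.2 z.2 th).
Hypothesis r_dn : forall y x' x, dn p (r y x' x).
Hypothesis psi_ge1 : forall y, 1 <= psi y.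
Hypothesis r_jet : forall y x' x tau th, Theta th -> 0 <= tau ->
  jet_norm tau p (r y x' x) th <= r y x' x th * (1 + d%:R * tau * psi y) ^+ p.
Hypothesis r_phi : forall y x' x th, Theta th -> r y x' x th <= phi y x'.
Hypothesis phi_int : forall y, mu.-integrable setT (EFin \o phi y).
Hypothesis q01 : 0 < q < 1.
Hypothesis r_mix : forall y x z th, Theta th ->
  {ae mu, forall x', q * r y x' z th <= r y x' x th}.
Hypothesis r_pos : forall y x th, Theta th -> 0 < \int[mu]_x' r y x' x th.
Hypothesis r_mass : forall y x th, Theta th -> `|ln (\int[mu]_x' r y x' x th)| <= L y.

Fixpoint lik n (y : nat -> Y) (x : X) (th : 'rV[R]_d) : R :=
  if n is k.+1 then \int[mu]_x' (r (y 0%N) x' x th * lik k (sh y) x' th) else 1.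

Lemma likS n y x th :
  lik n.+1 y x th = \int[mu]_x' (r (y 0%N) x' x th * lik n (sh y) x' th).
Proof. by []. Qed.

Lemma lik_ge0 n y x th : Theta th -> 0 <= lik n y x th.
Proof.
move=> Tth; elim: n y x => [//|n IH] y x.
by apply: Rintegral_ge0 => x' _; rewrite mulr_ge0 ?r_ge0.
Qed.

Lemma r_comp_meas dT (T : measurableType dT) (f : T -> Y) (g h : T -> X) th :
  Theta th -> measurable_fun setT f -> measurable_fun setT g ->
  measurable_fun setT h -> measurable_fun setT (fun t => r (f t) (g t) (h t) th).
Proof.
move=> Tth mf mg mh.
apply: (@measurableT_comp _ _ _ _ _ _ (fun z : (Y * X) * X => r z.1.1 z.1.2 z.2 th)
  _ (fun t => ((f t, g t), h t))); first exact: r_meas.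
by do 2 apply: measurable_fun_pair => //.
Qed.

(** Joint measurability in the observations and the initial state, tested on
    arbitrary parametrizations: the induction needs the integration variable as
    a further parameter, but no measurable structure on sequences. *)
Lemma lik_meas n dT (T : measurableType dT) (Z : nat -> T -> Y) (x : T -> X) th :
  Theta th -> (forall i, measurable_fun setT (Z i)) -> measurable_fun setT x ->
  measurable_fun setT (fun t => lik n (fun i => Z i t) (x t) th).
Proof.
move=> Tth; elim: n dT T Z x => [|n IH] dT T Z x mZ mx; first exact: measurable_cst.
pose F (z : T * X) := r (Z 0%N z.1) z.2 (x z.1) th * lik n (fun i => Z i.+1 z.1) z.2 th.
have mF : measurable_fun setT F.
  apply: measurable_funM.
    apply: r_comp_meas => //; first exact: measurableT_comp.
    exact: measurableT_comp.
  by apply: IH => // i; exact: measurableT_comp.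
apply: (@measurableT_comp _ _ _ _ _ _ fine _
  (fun t => \int[mu]_x' (EFin \o F) (t, x'))%E) => //.
apply: measurable_fun_fubini_tonelli_F; first exact/measurable_EFinP.
by move=> z; rewrite lee_fin mulr_ge0 ?r_ge0 ?lik_ge0.
Qed.

Lemma lik_meas_state n y th : Theta th ->
  measurable_fun setT (fun x => lik n y x th).
Proof.
move=> Tth; by apply: (@lik_meas n _ X (fun i _ => y i) id) => // i.
Qed.

Definition jet_const y := (1 + d%:R * psi y) ^+ p.

Lemma psi_ge0 y : 0 <= psi y. Proof. exact: le_trans (psi_ge1 y). Qed.

Lemma jet_const_ge0 y : 0 <= jet_const y.
Proof. by rewrite exprn_ge0// addr_ge0// mulr_ge0// psi_ge0. Qed.

Lemma r_dom y x : dominated_family Theta mu p (fun x' => r y x' x)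
  (fun x' => jet_const y * phi y x').
Proof.
split=> [x'|th Tth|x' th Tth|]; first exact: r_dn.
- by apply: r_comp_meas.
- apply: le_trans (r_jet _ _ _ Tth ler01) _.
  rewrite mulr1 mulrC; apply: ler_wpM2l (jet_const_ge0 y) _ _ _; exact: r_phi.
- exact: integrableZlr.
Qed.

(** Differentiation under the integral, once per observation. *)
Lemma lik_bfam n y : bfam (lik n y).
Proof.
elim: n y => [|n IH] y; first exact: (bounded_family_cst Theta_open).
have H x := dominated_familyM Theta_open (r_dom (y 0%N) x) (IH (sh y)).
split=> [x|th Tth|].
- by have [b Hb] := H x; exact: (dn_integral Theta_open Hb).
- exact: lik_meas_state.
have [dl ml [C hC]] := IH (sh y).
exists (\int[mu]_x' (`|C| * (jet_const (y 0%N) * phi (y 0%N) x'))) => x th Tth.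
have [b Hb] := H x.
have t01 : (0 : R) <= (1 : R) <= (1 : R) by rewrite ler01 lexx.
apply: le_trans (jet_norm_integral Theta_open t01 Hb Tth) _.
apply: le_Rintegral => //.
- exact: (integrable_jet_norm Theta_open t01 Hb Tth).
- by do 2 apply: integrableZlr.
move=> x' _; apply: le_trans (jet_normM Theta_open ler01 Tth (r_dn _ _ _) (dl x')) _.
rewrite mulrC; apply: ler_pM; rewrite ?jet_norm_ge0//.
- by rewrite (le_trans (hC x' th Tth))// ler_norm.
- by have [_ _ hb _] := r_dom (y 0%N) x; exact: hb.
Qed.

Lemma r_int y x th : Theta th -> mu.-integrable setT (EFin \o (fun x' => r y x' x th)).
Proof. by move=> Tth; exact: dominated_family_integrable (r_dom y x) Tth. Qed.

Lemma r_mul_int y x h th : bfam h -> Theta th ->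
  mu.-integrable setT (EFin \o (fun x' => r y x' x th * h x' th)).
Proof.
move=> bh Tth; have [b Hb] := dominated_familyM Theta_open (r_dom y x) bh.
exact: dominated_family_integrable Hb Tth.
Qed.

Lemma r_mass_low y x th : Theta th -> expR (- L y) <= \int[mu]_x' r y x' x th.
Proof.
move=> Tth; rewrite -[leRHS]lnK ?posrE ?r_pos// ler_expR lerNl.
by apply: le_trans (r_mass y x Tth); rewrite -normrN ler_norm.
Qed.

Lemma lik_low n y : exists2 low, 0 < low &
  forall x th, Theta th -> low <= lik n y x th.
Proof.
elim: n y => [|n IH] y; first by exists 1.
have [l l0 hl] := IH (sh y); exists (expR (- L (y 0%N)) * l).
  by rewrite mulr_gt0// expR_gt0.
move=> x th Tth; apply: (@le_trans _ _ (\int[mu]_x' (r (y 0%N) x' x th * l))).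
  by rewrite RintegralZr ?r_int// ler_wpM2r ?(ltW l0)// r_mass_low.
apply: le_Rintegral => //.
- rewrite (_ : _ \o _ = EFin \o (fun x' => l * r (y 0%N) x' x th)).
    by apply: integrableZlr; exact: r_int.
  by apply/funext => x' /=; rewrite mulrC.
- exact: r_mul_int (lik_bfam n _) Tth.
- by move=> x' _; rewrite ler_wpM2l ?r_ge0 ?hl.
Qed.

Lemma lik_gt0 n y x th : Theta th -> 0 < lik n y x th.
Proof. by move=> Tth; have [l l0 /(_ x th Tth)] := lik_low n y; exact: lt_le_trans. Qed.

Lemma q_gt0 : 0 < q. Proof. by case/andP : q01. Qed.
Lemma q_lt1 : q < 1. Proof. by case/andP : q01. Qed.

(** Only the first transition sees the initial state. *)
Lemma lik_mix n y x z th : Theta th -> q * lik n y z th <= lik n y x th.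
Proof.
move=> Tth; case: n => [|n] /=; first by rewrite mulr1 ltW// q_lt1.
have iz := r_mul_int (y 0%N) z (lik_bfam n (sh y)) Tth.
have ix := r_mul_int (y 0%N) x (lik_bfam n (sh y)) Tth.
rewrite -RintegralZl// /Rintegral; apply: fine_le.
- by apply: (integrable_fin_num measurableT); exact: integrableZlr.
- exact: (integrable_fin_num measurableT).
apply: ae_ge0_le_integral => //.
- by move=> x' _; rewrite lee_fin !mulr_ge0 ?lik_ge0 ?r_ge0// ltW// q_gt0.
- by have /integrableP[] := integrableZlr q iz.
- by move=> x' _; rewrite lee_fin mulr_ge0 ?lik_ge0 ?r_ge0.
- by have /integrableP[] := ix.
- have := r_mix (y 0%N) x z Tth; apply: filterS => x' H _.
  by rewrite lee_fin mulrA ler_wpM2r ?lik_ge0.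
Qed.

(** All estimates are at the parameter [th] and with a weight [tau] for which
    every observation makes a [small_step]. *)
Section cone.
Variables (tau : R) (th : 'rV[R]_d).
Hypotheses (t01 : 0 <= tau <= 1) (Tth : Theta th).

Let t0 : 0 <= tau. Proof. by case/andP : t01. Qed.
Let N f := jet_norm tau p f th.

Definition mix := q * q.
Definition spread := mix / 16.
Definition pert := mix * spread / 8.
Definition slack := spread + pert * (1 + spread).
(** The jets of the density for the observation [yk] deviate from its value by a
    relative error of at most [pert]; this holds for [tau * psi yk] small. *)
Definition small_step yk := (1 + d%:R * tau * psi yk) ^+ p - 1 <= pert.

Lemma mix01 : 0 < mix < 1.
Proof. by rewrite mulr_gt0 ?q_gt0//= mulr_ilt1 ?q_lt1 ?ltW ?q_gt0. Qed.

Lemma cone_constants : [/\ 0 < spread, 0 < pert, 0 < slack < mix / 8, slack < 1 / 8 &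
  ((1 - mix) * spread + 2 * (pert * (1 + spread))) * (1 - slack)^-1 <= spread].
Proof. exact: (cone_numerics mix01 erefl erefl erefl). Qed.

Lemma r_pert y x' x : small_step y ->
  N (fun t => r y x' x t - r y x' x th) <= pert * r y x' x th.
Proof.
move=> sm; rewrite /N (jet_norm_subcst Theta_open _ _ Tth (r_dn y x' x)).
rewrite subrr normr0 add0r ger0_norm ?r_ge0//.
apply: (@le_trans _ _ (r y x' x th * ((1 + d%:R * tau * psi y) ^+ p - 1))).
  by rewrite mulrBr mulr1 lerB// r_jet.
by rewrite mulrC ler_wpM2r// r_ge0.
Qed.

(** With the parameter frozen at [th], the density [kern0 n y x] is that of the
    next state given the current state [x] and [n.+1] further observations: a
    Markov density, which [weight] deduces from [r] by Bayes' formula. *)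
Definition weight n y x' x := lik n (sh y) x' th / lik n.+1 y x th.
Definition kern0 n y x x' := r (y 0%N) x' x th * weight n y x' x.
(** The dependence of a likelihood on the initial state, normalized to be 1 at
    the state [xs] for all parameters and at the parameter [th] for all
    states. *)
Definition ratio n y x t :=
  (lik n y x t / lik n y xs t) * (lik n y xs th / lik n y x th).
(** The image of [ratio n (sh y)] under the density of the current parameter
    ([step_integral]); it differs from [ratio n.+1 y] by the normalization at
    [xs] ([ratio_step]). *)
Definition step n y x t :=
  (lik n.+1 y x t / lik n (sh y) xs t) * (lik n (sh y) xs th / lik n.+1 y x th).

Lemma lik_neq0 n y x t : Theta t -> lik n y x t != 0.
Proof. by move=> Tt; rewrite gt_eqF ?lik_gt0. Qed.

Lemma weight_ge0 n y x' x : 0 <= weight n y x' x.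
Proof. by rewrite divr_ge0 ?lik_ge0. Qed.

Lemma lik_inv_bfam n y : bfam (fun x t => (lik n y x t)^-1%R).
Proof.
have [l l0 hl] := lik_low n y.
exact: (bounded_familyV Theta_open l0 hl (lik_bfam n y)).
Qed.

Lemma ratio_bfam n y : bfam (ratio n y).
Proof.
have b1 := lik_bfam n y; have b2 := lik_inv_bfam n y.
apply: (bounded_familyM Theta_open).
  by apply: (bounded_familyM Theta_open) => //; exact: bounded_family_at b2.
apply: (bounded_familyM Theta_open).
  exact: (bounded_family_cst Theta_open).
exact: (bounded_family_freeze Theta_open Tth b2).
Qed.

Lemma weight_bfam n y x : bfam (fun x' _ => weight n y x' x).
Proof.
apply: (bounded_familyM Theta_open); last exact: (bounded_family_cst Theta_open).
exact: (bounded_family_freeze Theta_open Tth (lik_bfam n (sh y))).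
Qed.

Lemma kern0_ge0 n y x x' : 0 <= kern0 n y x x'.
Proof. by rewrite mulr_ge0 ?r_ge0 ?weight_ge0. Qed.

Lemma kern0_int n y x : mu.-integrable setT (EFin \o kern0 n y x).
Proof. exact: r_mul_int (weight_bfam n y x) Tth. Qed.

Lemma kern0_1 n y x : \int[mu]_x' kern0 n y x x' = 1.
Proof.
rewrite /kern0 /weight.
under eq_Rintegral do rewrite mulrA.
rewrite RintegralZr//; first by rewrite -likS mulfV ?lik_neq0.
exact: r_mul_int (lik_bfam n (sh y)) Tth.
Qed.

(** One factor [q] comes from the transition density and the other from the
    likelihood in the denominator of the weight. *)
Lemma kern0_min n y x : {ae mu, forall x', mix * kern0 n y xs x' <= kern0 n y x x'}.
Proof.
have := r_mix (y 0%N) x xs Tth; apply: filterS => x' H.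
rewrite /mix -mulrA mulrA mulrACA; apply: ler_pM => //.
- by rewrite mulr_ge0 ?r_ge0// ltW// q_gt0.
- by rewrite mulr_ge0 ?weight_ge0// ltW// q_gt0.
rewrite /weight mulrCA ler_wpM2l ?lik_ge0//.
rewrite ler_pdivrMr ?lik_gt0// [leRHS]mulrC.
rewrite ler_pdivlMr ?lik_gt0//; exact: lik_mix.
Qed.

Lemma kern0_M_dom n y x h : bfam h ->
  exists b, dominated_family Theta mu p (fun x' t => kern0 n y x x' * h x' t) b.
Proof.
exact: (dominated_familyM Theta_open (dominated_family_weight Theta_open _ (kern0_int n y x))).
Qed.

(** What the dependence of the density on the parameter adds to [kern0]; it is
    measured relatively to [kern0] ([pert_kern_small]). *)
Definition pert_kern n y x x' t :=
  (r (y 0%N) x' x t - r (y 0%N) x' x th) * weight n y x' x.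

Lemma pert_kern_dn n y x x' : dn p (pert_kern n y x x').
Proof.
apply: (dnM Theta_open); last exact: (dn_cst Theta_open).
exact: (dnB Theta_open (r_dn _ _ _) (dn_cst Theta_open _ _)).
Qed.

Lemma pert_kern_dom n y x h : bfam h ->
  exists b, dominated_family Theta mu p (fun x' t => pert_kern n y x x' t * h x' t) b.
Proof.
move=> bh; have bwh := bounded_familyM Theta_open (weight_bfam n y x) bh.
have D := dominated_familyB Theta_open (r_dom (y 0%N) x)
  (dominated_family_weight Theta_open _ (r_int (y 0%N) x Tth)).
have [b [H1 H2 H3 H4]] := dominated_familyM Theta_open D bwh.
exists b; split=> // [x'|t Tt|x' t Tt].
- by apply: (dn_ext Theta_open _ (H1 x')) => t _; rewrite mulrA.
- by apply: eq_measurable_fun (H2 t Tt) => x' _; rewrite mulrA.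
- rewrite (jet_norm_ext Theta_open _ _ Tt (g := fun t =>
    (r (y 0%N) x' x t - r (y 0%N) x' x th) * (weight n y x' x * h x' t))).
    exact: H3.
  by move=> u _; rewrite mulrA.
Qed.

Lemma pert_kern_small n y x x' : small_step (y 0%N) ->
  N (pert_kern n y x x') <= pert * kern0 n y x x'.
Proof.
move=> sm; apply: le_trans (jet_normM Theta_open t0 Tth _ _) _.
- exact: (dnB Theta_open (r_dn _ _ _) (dn_cst Theta_open _ _)).
- exact: (dn_cst Theta_open).
rewrite (jet_norm_cst Theta_open)// ger0_norm ?weight_ge0// /kern0 mulrA.
by rewrite ler_wpM2r ?weight_ge0// r_pert.
Qed.

Lemma kern_sum n y x h t : bfam h -> Theta t ->
  \int[mu]_x' (kern0 n y x x' * h x' t) + \int[mu]_x' (pert_kern n y x x' t * h x' t) =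
  \int[mu]_x' (r (y 0%N) x' x t * (weight n y x' x * h x' t)).
Proof.
move=> bh Tt; rewrite -RintegralD//.
- by apply: eq_Rintegral => x' _; rewrite /kern0 /pert_kern; ring.
- by have [b Hb] := kern0_M_dom n y x bh; exact: dominated_family_integrable Hb Tt.
- by have [b Hb] := pert_kern_dom n y x bh; exact: dominated_family_integrable Hb Tt.
Qed.

Lemma step_integral n y x t : Theta t ->
  \int[mu]_x' (r (y 0%N) x' x t * (weight n y x' x * ratio n (sh y) x' t)) =
  step n y x t.
Proof.
move=> Tt; rewrite /step [lik n.+1 y x t]likS mulrAC -mulrA -RintegralZr//; last first.
  exact: r_mul_int (lik_bfam n (sh y)) Tt.
apply: eq_Rintegral => x' _; rewrite /weight /ratio.
have h1 := lik_neq0 n (sh y) x' Tth; have h2 := lik_neq0 n.+1 y x Tth.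
have h3 := lik_neq0 n (sh y) xs Tt.
move: h1 h2 h3; set a := lik n (sh y) x' th; set b := lik n.+1 y x th.
set c := lik n (sh y) xs t => a0 b0 c0; field.
by rewrite a0 b0 c0.
Qed.

Lemma ratio_xs n y t : Theta t -> ratio n y xs t = 1.
Proof. by move=> Tt; rewrite /ratio !mulfV ?mul1r ?lik_neq0. Qed.

Lemma ratio_dn n y x : dn p (ratio n y x).
Proof. by have [] := ratio_bfam n y. Qed.

Lemma ratio_le n y x : (forall x z, N (fun t => ratio n y x t - ratio n y z t) <= spread) ->
  N (ratio n y x) <= 1 + spread.
Proof.
move=> H; rewrite /N (jet_norm_ext Theta_open _ _ Tth
  (g := fun t => 1 + (ratio n y x t - ratio n y xs t))); last first.
  by move=> t Tt; rewrite ratio_xs//; ring.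
have d1 := dnB Theta_open (ratio_dn n y x) (ratio_dn n y xs).
apply: le_trans (jet_normD Theta_open t0 Tth (dn_cst Theta_open p 1) d1) _.
by rewrite (jet_norm_cst Theta_open)// normr1 lerD2l; exact: H.
Qed.

Lemma step_dn n y x : dn p (step n y x).
Proof.
apply: (dnM Theta_open); last exact: (dn_cst Theta_open).
apply: (dnM Theta_open); first by have [] := lik_bfam n.+1 y.
by have [+ _ _] := lik_inv_bfam n (sh y); exact.
Qed.

(** Doeblin contraction, applied to [ratio] at the next time. *)
Lemma step_cone n y : small_step (y 0%N) ->
  (forall x z, N (fun t => ratio n (sh y) x t - ratio n (sh y) z t) <= spread) ->
  (forall x z, N (fun t => step n y x t - step n y z t) <=
     (1 - mix) * spread + 2 * (pert * (1 + spread))) /\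
  (forall x z, N (fun t => step n y x t - ratio n (sh y) z t) <= slack).
Proof.
move=> sm osc.
have [s0 e0 _ _ _] := cone_constants.
have bR := ratio_bfam n (sh y).
have HE x t : Theta t -> step n y x t =
    \int[mu]_x' (kern0 n y x x' * ratio n (sh y) x' t) +
    \int[mu]_x' (pert_kern n y x x' t * ratio n (sh y) x' t).
  by move=> Tt; rewrite kern_sum// step_integral.
have C1 := doeblin_osc Theta_open t01 Tth mix01
  (kern0_int n y) (kern0_1 n y) (kern0_min n y) bR (pert_kern_dn n y)
  (fun x => pert_kern_dom n y x bR) (fun x x' => pert_kern_small n x x' sm)
  osc (fun x => ratio_le x osc).
have C2 := doeblin_dist Theta_open t01 Tth xs (kern0_ge0 n y)
  (kern0_int n y) (kern0_1 n y) bR (pert_kern_dn n y)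
  (fun x => pert_kern_dom n y x bR) (fun x x' => pert_kern_small n x x' sm)
  osc (fun x => ratio_le x osc).
split=> x z.
- rewrite /N (jet_norm_ext Theta_open _ _ Tth (fun t Tt => congr2 (fun a b => a - b) (HE x t Tt) (HE z t Tt))).
  exact: C1.
- rewrite /N (jet_norm_ext Theta_open _ _ Tth (fun t Tt => congr2 (fun a b => a - b) (HE x t Tt) (erefl (ratio n (sh y) z t)))).
  exact: C2.
Qed.

Lemma step_gt0 n y x t : Theta t -> 0 < step n y x t.
Proof. by move=> Tt; rewrite mulr_gt0// divr_gt0 ?lik_gt0. Qed.

Lemma ratio_step n y x t : Theta t ->
  ratio n.+1 y x t = step n y x t * (step n y xs t)^-1.
Proof.
move=> Tt; rewrite /ratio /step.
have h1 := lik_neq0 n (sh y) xs Tt; have h2 := lik_neq0 n (sh y) xs Tth.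
have h3 := lik_neq0 n.+1 y x Tth; have h4 := lik_neq0 n.+1 y xs Tt.
have h5 := lik_neq0 n.+1 y xs Tth.
move: h1 h2 h3 h4 h5; move: (lik n (sh y) xs t) (lik n (sh y) xs th)
  (lik n.+1 y x th) (lik n.+1 y xs t) (lik n.+1 y xs th) (lik n.+1 y x t).
by move=> a b c e f g a0 b0 c0 e0 f0; field; rewrite a0 b0 c0 e0 f0.
Qed.

Lemma step_near1_aux n y x : (forall z, N (fun t => step n y z t - ratio n (sh y) xs t) <= slack) ->
  N (fun t => step n y x t - 1) <= slack.
Proof.
move=> H; rewrite /N (jet_norm_ext Theta_open _ _ Tth
  (g := fun t => step n y x t - ratio n (sh y) xs t)); first exact: H.
by move=> t Tt; rewrite ratio_xs.
Qed.

Lemma step_inv_le n y x : N (fun t => step n y x t - 1) <= slack ->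
  N (fun t => (step n y x t)^-1%R) <= (1 - slack)^-1.
Proof.
have [_ _ _ k1 _] := cone_constants.
move=> H; apply: (jet_norm_inv_near1 Theta_open t0 Tth (step_dn n y x)) => //.
- by move=> t Tt; rewrite gt_eqF ?step_gt0.
- lra.
Qed.

Lemma step_inv_dn n y x : dn p (fun t => (step n y x t)^-1%R).
Proof.
apply: (dnV Theta_open) (step_dn n y x) => t Tt.
by rewrite gt_eqF ?step_gt0.
Qed.

(** The ratios start constant in the state. At each step the frozen density
    contracts their oscillation, which leaves enough room for the perturbation
    and for the renormalization at [xs]. *)
Lemma ratio_cone n y : (forall k, (k < n)%N -> small_step (y k)) ->
  forall x z, N (fun t => ratio n y x t - ratio n y z t) <= spread.
Proof.
have [s0 _ _ _ k1] := cone_constants.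
elim: n y => [|n IH] y sm x z.
  rewrite /N (jet_norm_ext Theta_open _ _ Tth (g := fun=> 0)).
    by rewrite (jet_norm_cst Theta_open)// normr0 ltW.
  by move=> t _; rewrite /ratio /=; ring.
have [C1 C2] := step_cone (sm 0%N isT) (IH (sh y) (fun k kn => sm k.+1 kn)).
have ds := step_dn n y.
rewrite /N (jet_norm_ext Theta_open _ _ Tth (g := fun t =>
  (step n y x t - step n y z t) * (step n y xs t)^-1)); last first.
  by move=> t Tt; rewrite !ratio_step// mulrBl.
have di := step_inv_dn n y xs.
apply: le_trans (jet_normM Theta_open t0 Tth (dnB Theta_open (ds x) (ds z)) di) _.
apply: le_trans k1; apply: ler_pM; rewrite ?jet_norm_ge0 ?C1//.
by apply: step_inv_le; apply: step_near1_aux.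
Qed.

Lemma step_ratio_dist n y : (forall k, (k < n.+1)%N -> small_step (y k)) ->
  forall x z, N (fun t => step n y x t - ratio n (sh y) z t) <= slack.
Proof.
move=> sm; have [] := step_cone (sm 0%N isT) (ratio_cone (fun k kn => sm k.+1 kn)) => //.
Qed.

Lemma step_near1 n y x : (forall k, (k < n.+1)%N -> small_step (y k)) ->
  N (fun t => step n y x t - 1) <= slack.
Proof. by move=> sm; apply: step_near1_aux => z; exact: step_ratio_dist. Qed.

Definition mass yk t := lik 1 (fun=> yk) xs t.

(** The factor by which the last observation [y n] multiplies the likelihood,
    relatively to the likelihood of [y n] alone. Read from the initial state, it is
    an average of [growth] from the next state ([growth_step]), so it forgets that
    state exponentially; the division by [mass] keeps it bounded. *)
Definition growth n y x t := lik n.+1 y x t * ((lik n y x t)^-1 * (mass (y n) t)^-1).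

Lemma growth_bfam n y : bfam (growth n y).
Proof.
apply: (bounded_familyM Theta_open); first exact: lik_bfam.
apply: (bounded_familyM Theta_open); first exact: lik_inv_bfam.
exact: bounded_family_at (lik_inv_bfam 1 (fun=> y n)).
Qed.

Lemma growth_dn n y x : dn p (growth n y x).
Proof. by have [] := growth_bfam n y. Qed.

Lemma mass_gt0 yk t : Theta t -> 0 < mass yk t. Proof. exact: lik_gt0. Qed.

(** The last observation contributes a mass at least [q] times [mass], from any
    state. *)
Lemma growth_low n y x t : Theta t -> q <= growth n y x t.
Proof.
move=> Tt; rewrite /growth -invfM ler_pdivlMr ?mulr_gt0 ?lik_gt0 ?mass_gt0//.
rewrite [_ * mass _ _]mulrC mulrA; elim: n y x => [|n IH] y x.
  rewrite mulr1; exact: (lik_mix 1 (fun=> y 0%N)).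
rewrite likS [lik n.+2 y x t]likS -RintegralZl//; last exact: r_mul_int (lik_bfam n (sh y)) Tt.
apply: le_Rintegral => //.
- by apply: integrableZlr; exact: r_mul_int (lik_bfam n (sh y)) Tt.
- exact: r_mul_int (lik_bfam n.+1 (sh y)) Tt.
- by move=> x' _; rewrite mulrCA ler_wpM2l ?r_ge0//; exact: IH.
Qed.

(** The perturbed contraction factor: the relative size of the perturbation of
    the filter, [mix * (3 / 8)], enters twice, and
    [1 - mix + 2 * (mix * (3 / 8)) = 1 - mix / 4]. *)
Definition rate := 1 - mix / 4.
Definition osc0 := 4 / q.
(** The sum of all the increments of [growth] in [growth_forget]: a geometric
    series of first term [2 * osc0]. *)
Definition drift := 2 * osc0 / (1 - rate).

Lemma rate01 : 0 < rate < 1.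
Proof. by have /andP[m0 m1] := mix01; rewrite /rate; apply/andP; split; lra. Qed.

Lemma osc0_gt0 : 0 < osc0. Proof. by rewrite divr_gt0 ?q_gt0. Qed.

Lemma drift_gt0 : 0 < drift.
Proof.
have /andP[_ r1] := rate01.
by rewrite divr_gt0 ?subr_gt0// mulr_gt0 ?osc0_gt0.
Qed.

Lemma growth0_le y x : small_step (y 0%N) -> N (growth 0 y x) <= 2 / q.
Proof.
move=> sm; have [_ _ /andP[_ k1] _ _] := cone_constants.
have [s0 _ _ k8 _] := cone_constants; have /andP[m0 m1] := mix01.
have smk k : (k < 1)%N -> small_step (y k) by case: k.
(* A single observation gives a growth proportional to a ratio, which the cone
   bounds by [1 + spread <= 2]. *)
rewrite /N (jet_norm_ext Theta_open _ _ Tth (g := fun t =>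
  (lik 1 y x th / lik 1 y xs th) * ratio 1 y x t)); last first.
  move=> t Tt; rewrite /growth /ratio invr1 mul1r -[mass _ _]/(lik 1 y xs t).
  have h1 := lik_neq0 1 y x Tth; have h2 := lik_neq0 1 y xs Tth.
  have h3 := lik_neq0 1 y xs Tt; move: h1 h2 h3.
  move: (lik 1 y x th) (lik 1 y xs th) (lik 1 y xs t) (lik 1 y x t).
  by move=> a b c e a0 b0 c0; field; rewrite a0 b0 c0.
apply: le_trans (jet_normZ Theta_open _ t0 Tth (ratio_dn 1 y x)) _.
rewrite ger0_norm ?divr_ge0 ?lik_ge0// mulrC; apply: ler_pM.
- exact: jet_norm_ge0.
- by rewrite divr_ge0 ?lik_ge0.
- apply: le_trans (ratio_le _ (ratio_cone smk)) _; rewrite /spread; lra.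
- rewrite ler_pdivrMr ?lik_gt0// ler_pdivlMl ?q_gt0//; exact: lik_mix.
Qed.

(** The difference between the density of the next state given the observations
    at the current parameter and the same at [th]. Both have total mass 1, so the
    oscillation of [growth] is all that matters in [growth_step]. *)
Definition pert_filter n y x x' t :=
  r (y 0%N) x' x t * (lik n (sh y) x' t * (lik n.+1 y x t)^-1) - kern0 n y x x'.

Lemma filter_dom n y x h : bfam h -> exists b, dominated_family Theta mu p
  (fun x' t => r (y 0%N) x' x t * (lik n (sh y) x' t * (lik n.+1 y x t)^-1) * h x' t) b.
Proof.
move=> bh; have b1 := bounded_familyM Theta_open (lik_bfam n (sh y))
  (bounded_family_at x (lik_inv_bfam n.+1 y)).
have [b Hb] := dominated_familyM Theta_open (r_dom (y 0%N) x) b1.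
exact: (dominated_familyM Theta_open Hb bh).
Qed.

Lemma pert_filter_dom n y x h : bfam h -> exists b, dominated_family Theta mu p
  (fun x' t => pert_filter n y x x' t * h x' t) b.
Proof.
move=> bh; have [b Hb] := filter_dom n y x bh.
have [b' Hb'] := kern0_M_dom n y x bh.
have [H1 H2 H3 H4] := dominated_familyB Theta_open Hb Hb'.
exists (fun x' => b x' + b' x'); split=> // [x'|t Tt|x' t Tt].
- by apply: (dn_ext Theta_open _ (H1 x')) => t _; rewrite -mulrBl.
- by apply: eq_measurable_fun (H2 t Tt) => x' _; rewrite -mulrBl.
- apply: le_trans (H3 x' t Tt); rewrite le_eqVlt; apply/orP; left; apply/eqP.
  by apply: (jet_norm_ext Theta_open _ _ Tt) => u _; rewrite -mulrBl.
Qed.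

Lemma pert_filter_dn n y x x' : dn p (pert_filter n y x x').
Proof.
apply: (dnB Theta_open); last exact: (dn_cst Theta_open).
apply: (dnM Theta_open) => //; apply: (dnM Theta_open).
  by have [] := lik_bfam n (sh y).
by have [+ _ _] := lik_inv_bfam n.+1 y; exact.
Qed.

(** A product of a density and a ratio of likelihoods is compared with its value
    at [th] in two steps, which bounds it by quantities known to be small in the
    cone. *)
Lemma pert_filterE n y x x' t : Theta t -> pert_filter n y x x' t =
  weight n y x' x *
  ((r (y 0%N) x' x t - r (y 0%N) x' x th) * (ratio n (sh y) x' t * (step n y x t)^-1)
   + r (y 0%N) x' x th * ((ratio n (sh y) x' t - step n y x t) * (step n y x t)^-1)).
Proof.
move=> Tt; rewrite /pert_filter /kern0 /weight /ratio /step.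
have h1 := lik_neq0 n (sh y) xs Tt; have h2 := lik_neq0 n (sh y) xs Tth.
have h3 := lik_neq0 n.+1 y x Tth; have h4 := lik_neq0 n.+1 y x Tt.
have h5 := lik_neq0 n (sh y) x' Tth.
move: h1 h2 h3 h4 h5; move: (lik n (sh y) xs t) (lik n (sh y) xs th)
  (lik n.+1 y x th) (lik n.+1 y x t) (lik n (sh y) x' th) (lik n (sh y) x' t).
by move=> a b c e f g a0 b0 c0 e0 f0; field; rewrite a0 b0 c0 e0 f0.
Qed.

Lemma pert_filter_small n y x x' : (forall k, (k < n.+1)%N -> small_step (y k)) ->
  N (pert_filter n y x x') <= mix * (3 / 8) * kern0 n y x x'.
Proof.
move=> sm; have [s0 e0 /andP[k0 km] k8 _] := cone_constants.
rewrite /N (jet_norm_ext Theta_open _ _ Tth (pert_filterE n y x x')).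
have d0 := dnB Theta_open (r_dn (y 0%N) x' x) (dn_cst Theta_open p (r (y 0%N) x' x th)).
have d1 := ratio_dn n (sh y) x'; have d2 := step_dn n y x; have d3 := step_inv_dn n y x.
have d4 := dnM Theta_open d1 d3; have d5 := dnM Theta_open (dnB Theta_open d1 d2) d3.
have d6 := dnM Theta_open d0 d4; have d7 := dnZ Theta_open (r (y 0%N) x' x th) d5.
apply: le_trans (jet_normZ Theta_open _ t0 Tth (dnD Theta_open d6 d7)) _.
rewrite ger0_norm ?weight_ge0// /kern0 [leRHS]mulrA [leRHS]mulrC.
rewrite ler_wpM2l ?weight_ge0//.
apply: le_trans (jet_normD Theta_open t0 Tth d6 d7) _.
have inv_le : N (fun t => (step n y x t)^-1) <= 8 / 7.
  apply: le_trans (step_inv_le (step_near1 x sm)) _.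
  rewrite -[leRHS]invf_div lef_pV2 ?posrE; lra.
set rr := r _ _ _ th; have rr0 : 0 <= rr by exact: r_ge0.
have H1 : N (fun t => (r (y 0%N) x' x t - r (y 0%N) x' x th) *
    (ratio n (sh y) x' t * (step n y x t)^-1)) <=
    (pert * rr) * ((1 + spread) * (8 / 7)).
  apply: le_trans (jet_normM Theta_open t0 Tth d0 d4) _.
  apply: ler_pM; rewrite ?jet_norm_ge0//; first exact: (r_pert x' x (sm 0%N isT)).
  apply: le_trans (jet_normM Theta_open t0 Tth d1 d3) _.
  apply: ler_pM; rewrite ?jet_norm_ge0//; apply: ratio_le; apply: ratio_cone => k kn.
  exact: sm.
have H2 : N (fun t => rr * ((ratio n (sh y) x' t - step n y x t) * (step n y x t)^-1))
    <= rr * (slack * (8 / 7)).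
  apply: le_trans (jet_normZ Theta_open _ t0 Tth d5) _.
  rewrite ger0_norm// ler_wpM2l//.
  apply: le_trans (jet_normM Theta_open t0 Tth (dnB Theta_open d1 d2) d3) _.
  apply: ler_pM; rewrite ?jet_norm_ge0//.
  by rewrite (jet_norm_distC Theta_open t0 Tth d1 d2); exact: step_ratio_dist.
apply: le_trans (lerD H1 H2) _.
have -> : pert * rr * ((1 + spread) * (8 / 7)) + rr * (slack * (8 / 7)) =
  rr * ((pert * (1 + spread) + slack) * (8 / 7)) by ring.
rewrite [leRHS]mulrC ler_wpM2l//.
have : pert * (1 + spread) <= slack by rewrite lerDr ltW.
move: (pert * (1 + spread)) (mix) km => a b kb; lra.
Qed.

Lemma filter_int1 n y x t : Theta t ->
  \int[mu]_x' (r (y 0%N) x' x t * (lik n (sh y) x' t * (lik n.+1 y x t)^-1)) = 1.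
Proof.
move=> Tt; under eq_Rintegral do rewrite mulrA.
rewrite RintegralZr//; first by rewrite -likS mulfV ?lik_neq0.
exact: r_mul_int (lik_bfam n (sh y)) Tt.
Qed.

Lemma growth_step n y x z t : Theta t ->
  growth n.+1 y x t - growth n (sh y) z t =
  \int[mu]_x' (kern0 n y x x' * (growth n (sh y) x' t - growth n (sh y) z t)) +
  \int[mu]_x' (pert_filter n y x x' t * (growth n (sh y) x' t - growth n (sh y) z t)).
Proof.
move=> Tt.
have bg := growth_bfam n (sh y).
have bh := bounded_familyB Theta_open bg (bounded_family_at z bg).
rewrite -RintegralD//; first last.
- by have [b Hb] := pert_filter_dom n y x bh; exact: dominated_family_integrable Hb Tt.
- by have [b Hb] := kern0_M_dom n y x bh; exact: dominated_family_integrable Hb Tt.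
pose K x' := r (y 0%N) x' x t * (lik n (sh y) x' t * (lik n.+1 y x t)^-1).
transitivity (\int[mu]_x' (K x' * growth n (sh y) x' t - growth n (sh y) z t * K x')); last first.
  by apply: eq_Rintegral => x' _; rewrite /pert_filter -/(K x'); ring.
have iK : mu.-integrable setT (EFin \o K).
  have [b Hb] := dominated_familyM Theta_open (r_dom (y 0%N) x)
    (bounded_familyM Theta_open (lik_bfam n (sh y)) (bounded_family_at x (lik_inv_bfam n.+1 y))).
  exact: dominated_family_integrable Hb Tt.
have iKg : mu.-integrable setT (EFin \o (fun x' => K x' * growth n (sh y) x' t)).
  by have [b Hb] := filter_dom n y x bg; exact: dominated_family_integrable Hb Tt.
rewrite RintegralB//; last exact: integrableZlr.
rewrite RintegralZl// filter_int1// mulr1; congr (_ - _).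
rewrite {1}/growth -[lik n.+2 y x t]/(\int[mu]_x' (r (y 0%N) x' x t * lik n.+1 (sh y) x' t)).
rewrite -RintegralZr//; last exact: r_mul_int (lik_bfam n.+1 (sh y)) Tt.
apply: eq_Rintegral => x' _; rewrite /K /growth.
have h1 := lik_neq0 n (sh y) x' Tt; have h2 := lik_neq0 n.+1 y x Tt.
have h3 : mass (y n.+1) t != 0 by rewrite gt_eqF ?mass_gt0.
move: h1 h2 h3; move: (lik n (sh y) x' t) (lik n.+1 y x t) (mass (y n.+1) t).
by move=> a b c a0 b0 c0; field; rewrite a0 b0 c0.
Qed.

(** One more observation contracts the oscillation of [growth], whatever its
    present size [om]. Unlike for [ratio], the perturbation is controlled
    beforehand by the cone, so the contraction is linear. *)
Lemma growth_contract n y om : (forall k, (k < n.+1)%N -> small_step (y k)) ->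
  (forall x z, N (fun t => growth n (sh y) x t - growth n (sh y) z t) <= om) ->
  (forall x z, N (fun t => growth n.+1 y x t - growth n.+1 y z t) <= rate * om) /\
  (forall x, N (fun t => growth n.+1 y x t - growth n (sh y) xs t) <= 2 * om).
Proof.
move=> smn IH1; have /andP[m0 m1] := mix01.
have om0 : 0 <= om by apply: le_trans (IH1 xs xs); exact: jet_norm_ge0.
have bg := growth_bfam n (sh y).
have bh := bounded_familyB Theta_open bg (bounded_family_at xs bg).
have osc x z : N (fun t => (growth n (sh y) x t - growth n (sh y) xs t) -
    (growth n (sh y) z t - growth n (sh y) xs t)) <= om.
  rewrite /N (jet_norm_ext Theta_open _ _ Tth (g := fun t => growth n (sh y) x t - growth n (sh y) z t)).
    exact: IH1.
  by move=> t Tt; ring.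
have C1 := doeblin_osc Theta_open t01 Tth mix01
  (kern0_int n y) (kern0_1 n y) (kern0_min n y) bh (pert_filter_dn n y)
  (fun x => pert_filter_dom n y x bh) (fun x x' => pert_filter_small x x' smn)
  osc (fun x => IH1 x xs).
have C2 := doeblin_dist Theta_open t01 Tth xs (kern0_ge0 n y)
  (kern0_int n y) (kern0_1 n y) bh (pert_filter_dn n y)
  (fun x => pert_filter_dom n y x bh) (fun x x' => pert_filter_small x x' smn)
  osc (fun x => IH1 x xs).
split=> [x z|x].
  have E t : Theta t -> growth n.+1 y x t - growth n.+1 y z t =
    (growth n.+1 y x t - growth n (sh y) xs t) - (growth n.+1 y z t - growth n (sh y) xs t).
    by move=> Tt; ring.
  rewrite /N (jet_norm_ext Theta_open _ _ Tth E).
  rewrite (jet_norm_ext Theta_open _ _ Tth (fun t Tt => congr2 (fun a b => a - b)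
    (growth_step n y x xs Tt) (growth_step n y z xs Tt))).
  apply: le_trans (C1 x z) _; rewrite /rate.
  by rewrite le_eqVlt; apply/orP; left; apply/eqP; field.
have E t : Theta t -> growth n.+1 y x t - growth n (sh y) xs t =
  (growth n.+1 y x t - growth n (sh y) xs t) - (growth n (sh y) xs t - growth n (sh y) xs t).
  by move=> Tt; ring.
rewrite /N (jet_norm_ext Theta_open _ _ Tth E).
rewrite (jet_norm_ext Theta_open _ _ Tth (fun t Tt => congr2 (fun a b => a - b)
  (growth_step n y x xs Tt) (erefl (growth n (sh y) xs t - growth n (sh y) xs t)))).
apply: le_trans (C2 x xs) _.
have : mix * (3 / 8) * om <= om by rewrite ler_piMl//; lra.
lra.
Qed.

(** Exponential forgetting of the initial state, for the growth and all its
    derivatives up to the order [p]. The second part, an induction hypothesis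
    with a decreasing surplus, sums up the increments to a uniform bound. *)
Lemma growth_forget n y : (forall k, (k < n.+1)%N -> small_step (y k)) ->
  (forall x z, N (fun t => growth n y x t - growth n y z t) <= osc0 * rate ^+ n) /\
  (forall x, N (growth n y x) + drift * rate ^+ n <= osc0 + drift).
Proof.
have /andP[r0 r1] := rate01.
elim: n y => [|n IH] y sm.
  have g0 := growth0_le _ (sm 0%N isT).
  have o2 : osc0 = 2 / q + 2 / q by rewrite /osc0; field; rewrite gt_eqF ?q_gt0.
  split=> [x z|x].
    apply: le_trans (jet_normB Theta_open t0 Tth (growth_dn _ _ _) (growth_dn _ _ _)) _.
    by rewrite expr0 mulr1 o2; apply: lerD; exact: g0.
  rewrite expr0 mulr1 lerD2r (le_trans (g0 x))// o2 lerDl.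
  by apply: divr_ge0 => //; exact: ltW q_gt0.
have [IH1 IH2] := IH (sh y) (fun k kn => sm k.+1 kn).
have smn k : (k < n.+1)%N -> small_step (y k) by move=> kn; apply: sm; rewrite leqW.
have [H1 H2] := growth_contract smn IH1.
split=> [x z|x]; first by rewrite exprS mulrCA; exact: H1.
rewrite /N (jet_norm_ext Theta_open _ _ Tth (g := fun t =>
   growth n (sh y) xs t + (growth n.+1 y x t - growth n (sh y) xs t))); last first.
  by move=> t Tt; ring.
have D := jet_normD Theta_open t0 Tth (growth_dn n (sh y) xs)
  (dnB Theta_open (growth_dn n.+1 y x) (growth_dn n (sh y) xs)).
apply: le_trans (lerD D (lexx _)) _.
apply: le_trans (lerD (lerD (lexx _) (H2 x)) (lexx _)) _.
apply: le_trans (IH2 xs); rewrite -addrA lerD2l exprS.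
have De : drift * (1 - rate) = 2 * osc0.
  by rewrite /drift divfK// subr_eq0 gt_eqF.
have := congr1 (fun a => a * rate ^+ n) De.
by move: drift rate osc0 (rate ^+ n) => a b c e; lra.
Qed.

Definition growth_bound := osc0 + drift.

Lemma growth_le n y x : (forall k, (k < n.+1)%N -> small_step (y k)) ->
  N (growth n y x) <= growth_bound.
Proof.
move=> sm; apply: le_trans ((growth_forget sm).2 x); rewrite lerDl mulr_ge0//.
  exact: ltW drift_gt0.
by rewrite exprn_ge0// ltW//; case/andP: rate01.
Qed.

Definition growth_inv_bound := inv_bound p q^-1 growth_bound.

Lemma growth_gt0 n y x t : Theta t -> 0 < growth n y x t.
Proof. by move=> Tt; apply: lt_le_trans (growth_low n y x Tt); exact: q_gt0. Qed.

Lemma growth_inv_le n y x : (forall k, (k < n.+1)%N -> small_step (y k)) ->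
  N (fun t => (growth n y x t)^-1%R) <= growth_inv_bound.
Proof.
move=> sm; apply: (jet_norm_inv Theta_open t0 Tth (growth_dn n y x)).
- by move=> t Tt; rewrite gt_eqF ?growth_gt0.
- rewrite ger0_norm ?invr_ge0 ?(ltW (growth_gt0 _ _ _ Tth))//.
  by rewrite lef_pV2 ?posrE ?q_gt0 ?growth_gt0//; exact: growth_low.
- exact: growth_le.
Qed.

Lemma growth_inv_dn n y x : dn p (fun t => (growth n y x t)^-1%R).
Proof.
apply: (dnV Theta_open) (growth_dn n y x) => t Tt.
by rewrite gt_eqF ?growth_gt0.
Qed.

(** The log-likelihood brought by the oldest observation [y 0], given the [n]
    later ones. *)
Definition incr n y t := ln (lik n.+1 y xs t) - ln (lik n (sh y) xs t).

Lemma lik_dn n y x : dn p (lik n y x). Proof. by have [] := lik_bfam n y. Qed.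

Lemma incr_dn n y : dn p (incr n y).
Proof.
by apply: (dnB Theta_open); apply: (dn_ln Theta_open _ (lik_dn _ _ _)) => t; exact: lik_gt0.
Qed.

Definition growth_cond := growth_bound * growth_inv_bound.
Definition incr_const :=
  2 * osc0 * growth_inv_bound * (1 + growth_cond + p%:R * growth_cond).

(** The difference of the increments is the logarithm of
    [growth n.+1 y xs / growth n (sh y) xs], a quotient close to 1 by the
    forgetting property. *)
Lemma incr_contract n y : (forall k, (k < n.+2)%N -> small_step (y k)) ->
  N (fun t => incr n.+1 y t - incr n y t) <= incr_const * rate ^+ n.
Proof.
move=> sm.
have smn k : (k < n.+1)%N -> small_step (y k) by move=> kn; apply: sm; rewrite leqW.
have sms k : (k < n.+1)%N -> small_step (sh y k) by move=> kn; exact: sm.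
pose F t := growth n.+1 y xs t * (growth n (sh y) xs t)^-1.
have F0 t : Theta t -> 0 < F t by move=> Tt; rewrite divr_gt0 ?growth_gt0.
have dF : dn p F.
  by apply: (dnM Theta_open); [exact: growth_dn|exact: growth_inv_dn].
have FE t : Theta t -> incr n.+1 y t - incr n y t = ln (F t).
  move=> Tt; rewrite /F /growth /incr.
  have h1 : 0 < lik n.+2 y xs t := lik_gt0 _ _ _ Tt.
  have h2 : 0 < lik n.+1 (sh y) xs t := lik_gt0 _ _ _ Tt.
  have h3 : 0 < lik n.+1 y xs t := lik_gt0 _ _ _ Tt.
  have h4 : 0 < lik n (sh y) xs t := lik_gt0 _ _ _ Tt.
  have h5 : 0 < mass (y n.+1) t := mass_gt0 _ Tt.
  move: h1 h2 h3 h4 h5; set a := lik n.+2 _ _ _; set b := lik n.+1 (sh y) _ _.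
  set c := lik n.+1 y _ _; set e := lik n _ _ _; set f := mass _ _.
  move=> a0 b0 c0 e0 f0.
  rewrite (_ : _ * _ * _^-1 = (a * e) / (b * c)); last first.
    by field; rewrite !gt_eqF.
  rewrite ln_div ?posrE ?mulr_gt0// !lnM ?posrE//; ring.
have G0 : 0 <= growth_inv_bound by apply: le_trans (growth_inv_le xs smn); exact: jet_norm_ge0.
have G1 : 0 <= growth_bound by apply: le_trans (growth_le xs smn); exact: jet_norm_ge0.
have NF1 : N (fun t => F t - 1) <= 2 * osc0 * growth_inv_bound * rate ^+ n.
  rewrite /N (jet_norm_ext Theta_open _ _ Tth (g := fun t =>
    (growth n.+1 y xs t - growth n (sh y) xs t) * (growth n (sh y) xs t)^-1)); last first.
    by move=> t Tt; rewrite mulrBl mulfV// gt_eqF ?growth_gt0.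
  have d1 := dnB Theta_open (growth_dn n.+1 y xs) (growth_dn n (sh y) xs).
  apply: le_trans (jet_normM Theta_open t0 Tth d1 (growth_inv_dn _ _ _)) _.
  rewrite mulrAC; apply: ler_pM; rewrite ?jet_norm_ge0//.
    rewrite -mulrA; have [_] := growth_contract smn (growth_forget sms).1; exact.
  exact: growth_inv_le.
have NF2 : N (fun t => (F t)^-1%R) <= growth_cond.
  rewrite /N (jet_norm_ext Theta_open _ _ Tth (g := fun t =>
    growth n (sh y) xs t * (growth n.+1 y xs t)^-1)); last first.
    by move=> t Tt; rewrite /F invfM invrK mulrC.
  apply: le_trans (jet_normM Theta_open t0 Tth (growth_dn _ _ _) (growth_inv_dn _ _ _)) _.
  apply: ler_pM; rewrite ?jet_norm_ge0 ?growth_le//.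
  exact: growth_inv_le.
rewrite /N (jet_norm_ext Theta_open _ _ Tth FE).
apply: le_trans (jet_norm_ln Theta_open t0 Tth dF F0) _.
have n1 : 0 <= N (fun t => F t - 1) by exact: jet_norm_ge0.
have n2 : 0 <= N (fun t => (F t)^-1) by exact: jet_norm_ge0.
(* Both signs use [ln u <= u - 1], at [F th] and at its inverse. *)
have lnF : `|ln (F th)| <= N (fun t => F t - 1) * (1 + growth_cond).
  have Fth := F0 th Tth.
  have f1 : `|F th - 1| <= N (fun t => F t - 1) := normr_jet_norm p (fun t => F t - 1) th t0.
  have f2 : `|(F th)^-1| <= growth_cond.
    by apply: le_trans NF2; exact: (normr_jet_norm p (fun t => (F t)^-1) th t0).
  have gc0 : 0 <= growth_cond by apply: le_trans f2.
  have u1 : ln (F th) <= `|F th - 1|.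
    apply: le_trans (ler_norm _); rewrite -{1}[F th](subrK 1) addrC.
    by apply: le_ln1Dx; lra.
  have u2 : - ln (F th) <= `|F th - 1| * `|(F th)^-1|.
    rewrite -lnV ?posrE// -normrM; apply: (@le_trans _ _ ((F th)^-1 - 1)).
      rewrite -{1}[(F th)^-1](subrK 1) addrC; apply: le_ln1Dx.
      by rewrite ltrBrDr addNr invr_gt0.
    rewrite mulrBl mulfV ?gt_eqF// mul1r distrC; exact: ler_norm.
  have u3 : `|F th - 1| * `|(F th)^-1| <= N (fun t => F t - 1) * growth_cond.
    by apply: ler_pM.
  rewrite ler_norml lerNl mulrDr mulr1; apply/andP; split.
    by apply: (le_trans u2); apply: (le_trans u3); rewrite lerDr.
  by apply: (le_trans u1); apply: (le_trans f1); rewrite lerDl mulr_ge0.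
apply: le_trans (lerD lnF (lexx _)) _.
have gc0 : 0 <= growth_cond by rewrite mulr_ge0.
apply: (@le_trans _ _ (N (fun t => F t - 1) * (1 + growth_cond + p%:R * growth_cond))).
  rewrite [leRHS]mulrDr lerD2l mulrCA ler_wpM2l//.
  by rewrite ler_wpM2l.
rewrite /incr_const mulrAC ler_wpM2r// !addr_ge0// mulr_ge0//.
Qed.

(** An increment is, up to a constant, the logarithm of [step], which stays
    close to 1. *)
Lemma incr_jet n y : (forall k, (k < n.+1)%N -> small_step (y k)) ->
  N (fun t => incr n y t - incr n y th) <= p%:R.
Proof.
move=> sm; have [_ _ /andP[k0 _] k8 _] := cone_constants.
have sp t : Theta t -> 0 < step n y xs t by exact: step_gt0.
rewrite /N (jet_norm_ext Theta_open _ _ Tth (g := fun t => ln (step n y xs t))); last first.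
  move=> t Tt; rewrite /incr /step lnM ?posrE ?divr_gt0 ?lik_gt0//.
  by rewrite !ln_div ?posrE ?lik_gt0//; ring.
apply: le_trans (jet_norm_ln Theta_open t0 Tth (step_dn n y xs) sp) _.
have -> : step n y xs th = 1.
  rewrite /step; have h1 := lik_neq0 n (sh y) xs Tth; have h2 := lik_neq0 n.+1 y xs Tth.
  move: h1 h2; move: (lik n _ _ _) (lik n.+1 _ _ _) => a b a0 b0.
  by field; rewrite a0 b0.
rewrite ln1 normr0 add0r -[leRHS]mulr1 ler_wpM2l//.
have n1 := step_near1 xs sm.
apply: (@le_trans _ _ (slack * (1 - slack)^-1)).
  by apply: ler_pM; rewrite ?jet_norm_ge0//; exact: step_inv_le.
by rewrite ler_pdivrMr; lra.
Qed.

(** Once the oldest observation is integrated out, the remaining likelihood is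
    that from [xs] up to a factor [q]. *)
Lemma incr_le n y : `|incr n y th| <= L (y 0%N) - ln q.
Proof.
have B := lik_bfam n (sh y); have c0 := lik_gt0 n (sh y) xs Tth.
have ri := r_int (y 0%N) xs Tth.
have rl := r_mul_int (y 0%N) xs B Tth.
have rp := r_pos (y 0%N) xs Tth; have rm := r_mass (y 0%N) xs Tth.
set I := \int[mu]_x' r (y 0%N) x' xs th in rp rm.
have cri c : mu.-integrable setT (EFin \o (fun x' => r (y 0%N) x' xs th * c)).
  rewrite (_ : _ \o _ = EFin \o (fun x' => c * r (y 0%N) x' xs th)); first exact: integrableZlr.
  by apply/funext => x' /=; rewrite mulrC.
have lo : I * (q * lik n (sh y) xs th) <= lik n.+1 y xs th.
  rewrite likS -RintegralZr//; apply: le_Rintegral => // x' _.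
  by rewrite ler_wpM2l ?r_ge0//; exact: lik_mix.
have up : lik n.+1 y xs th <= I * (q^-1 * lik n (sh y) xs th).
  rewrite likS -RintegralZr//; apply: le_Rintegral => // x' _.
  by rewrite ler_wpM2l ?r_ge0// ler_pdivlMl ?q_gt0//; exact: lik_mix.
have q0 := q_gt0; have h := lik_gt0 n.+1 y xs Tth.
rewrite /incr ler_norml; apply/andP; split.
  have : ln (I * (q * lik n (sh y) xs th)) <= ln (lik n.+1 y xs th).
    by rewrite ler_ln ?posrE// !mulr_gt0.
  rewrite !lnM ?posrE ?mulr_gt0//; move: rm; rewrite ler_norml => /andP[rm1 rm2].
  move: rm1; move: (ln I) (ln q) (ln (lik n (sh y) xs th)) (ln (lik n.+1 y xs th)) (L _).
  move=> *; lra.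
have : ln (lik n.+1 y xs th) <= ln (I * (q^-1 * lik n (sh y) xs th)).
  by rewrite ler_ln ?posrE// !mulr_gt0// invr_gt0.
rewrite !lnM ?posrE ?mulr_gt0 ?invr_gt0// lnV ?posrE//; move: rm; rewrite ler_norml => /andP[rm1 rm2].
move: rm2; move: (ln I) (ln q) (ln (lik n (sh y) xs th)) (ln (lik n.+1 y xs th)) (L _).
by move=> *; lra.
Qed.

End cone.
(** Below the threshold [x = d * tau * psi yk] is at most 1, and then
    [(1 + x) ^+ p - 1 <= x * 2 ^+ p]. *)
Lemma small_step_threshold : exists c : R, [/\ 0 < c, c <= 1 &
  forall tau yk, 0 <= tau -> tau * psi yk <= c -> small_step tau yk].
Proof.
have [_ e0 _ _ _] := cone_constants; have /andP[m0 m1] := mix01.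
have s1 : pert <= 1.
  rewrite /pert /spread; move: mix m0 m1 => m m0 m1.
  have : m * m <= 1 by rewrite mulr_ile1// ltW.
  by rewrite (_ : m * (m / 16) / 8 = m * m / 128); [lra|field].
have P0 : 0 < 2 ^+ p * (d%:R + 1) :> R by rewrite mulr_gt0 ?exprn_gt0// ltr_wpDl.
have d1 : 1 <= d%:R + 1 :> R by rewrite lerDr.
have p1 : 1 <= 2 ^+ p :> R by rewrite exprn_ege1// ler1n.
exists (pert / (2 ^+ p * (d%:R + 1))); split.
- by rewrite divr_gt0.
- by rewrite ler_pdivrMr// mul1r (le_trans s1)// mulr_ege1.
move=> tau yk t0; rewrite ler_pdivlMr// => H.
pose x := d%:R * tau * psi yk.
have x0 : 0 <= x by rewrite !mulr_ge0// psi_ge0.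
have tp0 : 0 <= tau * psi yk by rewrite mulr_ge0// psi_ge0.
have xp : x * 2 ^+ p <= pert.
  apply: le_trans H.
  rewrite (_ : x * _ = tau * psi yk * (2 ^+ p * d%:R)); last by rewrite /x; ring.
  by rewrite ler_wpM2l// ler_wpM2l ?exprn_ge0// lerDl.
have x1 : x <= 1.
  by apply: le_trans s1; apply: le_trans xp; rewrite ler_peMr.
rewrite /small_step -/x lerBlDr; apply: le_trans (lerD xp (lexx 1)).
elim: p => [|k IH]; first by rewrite !expr0 mulr1 lerDr.
have h : (1 + x) ^+ k <= 2 ^+ k by rewrite lerXn2r ?nnegrE ?addr_ge0//; lra.
rewrite exprS mulrDl mul1r [2 ^+ k.+1]exprS; have := ler_wpM2l x0 h.
by move: IH; move: (2 ^+ k) ((1 + x) ^+ k) => a b; lra.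
Qed.

Lemma psi_max n (y : nat -> Y) : exists2 k, (k < n.+1)%N &
  forall j, (j < n.+1)%N -> psi (y j) <= psi (y k).
Proof.
elim: n => [|n [k kn H]]; first by exists 0%N => // -[].
have [le|lt] := lerP (psi (y n.+1)) (psi (y k)).
  exists k; first exact: leqW.
  by move=> j; rewrite ltnS leq_eqVlt => /predU1P[->//|]; exact: H.
exists n.+1 => // j; rewrite ltnS leq_eqVlt => /predU1P[->//|jn].
exact: le_trans (H j jn) (ltW lt).
Qed.

Definition psi_sum n (y : nat -> Y) : R := \sum_(k < n) psi (y k) ^+ p.

Lemma psi_sum_ge n y k : (k < n)%N -> psi (y k) ^+ p <= psi_sum n y.
Proof.
move=> kn; rewrite /psi_sum (bigD1 (Ordinal kn))//= lerDl sumr_ge0// => j _.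
by rewrite exprn_ge0// psi_ge0.
Qed.

Lemma psi_sum_ge1 n y : 1 <= psi_sum n.+1 y.
Proof.
apply: le_trans (psi_sum_ge y (ltn0Sn n)); exact: exprn_ege1.
Qed.

(** The weight [tau] adapted to the largest [psi (y k)] makes all steps small,
    and the return to the weight 1 costs the [p]-th power of that maximum, which
    is bounded by the sum. *)
Lemma jet_norm_unweight : exists2 K : R, 0 < K &
  forall n y (f : 'rV[R]_d -> R) th C, 0 <= C ->
  (forall tau, 0 < tau <= 1 -> (forall k, (k < n.+1)%N -> small_step tau (y k)) ->
     jet_norm tau p f th <= C) ->
  jet_norm 1 p f th <= K * C * psi_sum n.+1 y.
Proof.
have [c [c0 c1 Hc]] := small_step_threshold.
exists (c^-1 ^+ p); first by rewrite exprn_gt0// invr_gt0.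
move=> n y f th C C0 H; have [k kn kmax] := psi_max n y.
have pk0 : 0 < psi (y k) by apply: lt_le_trans (psi_ge1 _).
pose tau := c / psi (y k).
have t0 : 0 < tau by rewrite divr_gt0.
have t1 : 0 < tau <= 1.
  by rewrite t0/= ler_pdivrMr// mul1r (le_trans c1).
apply: le_trans (jet_norm_rescale _ _ _ t1) _.
apply: (@le_trans _ _ (tau^-1 ^+ p * C)).
  rewrite ler_wpM2l ?exprn_ge0 ?invr_ge0 ?(ltW t0)//; apply: H => // j jn.
  apply: Hc; first exact: ltW.
  by rewrite /tau mulrAC ler_pdivrMr// ler_wpM2l ?(ltW c0)//; exact: kmax.
rewrite /tau invf_div exprMn [_ * c^-1 ^+ p]mulrC mulrAC ler_wpM2l//.
  by rewrite mulr_ge0// exprn_ge0// invr_ge0 ltW.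
exact: psi_sum_ge.
Qed.

Lemma incr_contract_unit : exists2 C : R, 0 <= C & forall n y th, Theta th ->
  jet_norm 1 p (fun t => incr n.+1 y t - incr n y t) th <=
    C * rate ^+ n * psi_sum n.+2 y.
Proof.
have [K K0 HK] := jet_norm_unweight.
have r0 n : 0 <= rate ^+ n by have /andP[r0 _] := rate01; rewrite exprn_ge0 ?ltW.
exists (K * `|incr_const|); first by rewrite mulr_ge0// ltW.
move=> n y th Tth; rewrite -[K * _ * _]mulrA; apply: HK => [|tau /andP[t0 t1] sm].
  by rewrite mulr_ge0.
have t01 : 0 <= tau <= 1 by rewrite ltW.
apply: le_trans (incr_contract t01 Tth sm) _.
by rewrite ler_wpM2r// ler_norm.
Qed.

(** The value and the derivatives are bounded separately: the variation of the
    increment from [th] has bounded jets for the small weight, while its value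
    involves only the first observation. *)
Lemma incr_unit : exists2 C : R, 0 <= C & forall n y th, Theta th ->
  jet_norm 1 p (incr n y) th <= L (y 0%N) + C * psi_sum n.+1 y.
Proof.
have [K K0 HK] := jet_norm_unweight.
have q0 : 0 <= - ln q by rewrite oppr_ge0 ln_le0// ltW// q_lt1.
exists (- ln q + K * p%:R); first by rewrite addr_ge0// mulr_ge0// ltW.
move=> n y th Tth.
have := jet_norm_subcst Theta_open 1 (incr n y th) Tth (incr_dn n y).
rewrite subrr normr0 add0r => /eqP; rewrite eq_sym subr_eq => /eqP ->.
have H : jet_norm 1 p (fun t => incr n y t - incr n y th) th <= K * p%:R * psi_sum n.+1 y.
  apply: HK => // tau /andP[t0 t1] sm.
  by apply: incr_jet => //; rewrite ltW.
have H2 : `|incr n y th| <= L (y 0%N) - ln q by apply: incr_le.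
apply: le_trans (lerD H H2) _.
have := ler_wpM2l q0 (psi_sum_ge1 n y).
by move: (psi_sum _ _) (ln q) (K * _) (L _) => a b c e; lra.
Qed.

(** * Mean log-likelihood under a hidden Markov law *)

Lemma lik_local n (y y' : nat -> Y) : (forall i, (i < n)%N -> y i = y' i) ->
  lik n y = lik n y'.
Proof.
elim: n y y' => [//|n IH] y y' yy'; apply/funext => x; apply/funext => th.
rewrite !likS yy'// (IH (sh y) (sh y'))// => i ni; exact: yy'.
Qed.

Lemma incr_local n (y : nat -> Y) : incr n (cut n.+1 y) = incr n y.
Proof.
have E1 : lik n.+1 (cut n.+1 y) = lik n.+1 y by apply: lik_local => i ni; rewrite /cut ni.
have E2 : lik n (sh (cut n.+1 y)) = lik n (sh y).
  by apply: lik_local => i ni; rewrite /cut ltnS ni.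
by apply/funext => th; rewrite /incr E1 E2.
Qed.

Lemma incr_meas n th : Theta th -> seq_measurable (fun _ : unit => EFin \o (incr n ^~ th)).
Proof.
move=> Tth dT T b Z _ mZ; apply/measurable_EFinP.
have mx : measurable_fun setT (fun _ : T => xs) by exact: measurable_cst.
have ml k (Z' : nat -> T -> Y) : (forall i, measurable_fun setT (Z' i)) ->
    measurable_fun setT (fun t => ln (lik k (fun i => Z' i t) xs th)).
  by move=> mZ'; apply: (measurableT_comp (@measurable_ln R)); exact: lik_meas.
by apply: measurable_funB; [exact: ml|apply: (ml n (fun i => Z i.+1))].
Qed.

(** A telescoping sum: every increment drops the oldest remaining
    observation. *)
Lemma ln_lik_sum n y th : ln (lik n y xs th) =
  \sum_(m < n) incr (n.-1 - m)%N (fun i => y (m + i)%N) th.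
Proof.
elim: n y => [|n IH] y; first by rewrite big_ord0 ln1.
rewrite big_ord_recl/= subn0 -[LHS](subrK (ln (lik n (sh y) xs th))) -/(incr n y th).
rewrite IH; congr (_ + _); apply: eq_bigr => m _; rewrite /bump/= add1n.
by have -> : (n.-1 - m = n - m.+1)%N by rewrite -subn1 subnAC subn1 subnS.
Qed.

Section hidden_markov_likelihood.
Context {dO : measure_display} {Omega : measurableType dO}.
Variables (Pr : probability Omega R) (P : R.-pker X ~> X) (Q : R.-pker X ~> Y).
Variables (X_ : nat -> {mfun Omega >-> X}) (Y_ : nat -> {mfun Omega >-> Y}).
Hypothesis XY_hmm : hidden_markov Pr P Q X_ Y_.
Variables (pi : probability X R) (delta K0 M : R).
Hypotheses (delta01 : 0 < delta < 1) (K0_ge1 : 1 <= K0).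
Hypothesis P_ergodic : forall x B (n : nat), measurable B ->
  (`|kernel_pow P n x B - pi B| <= (K0 * delta ^+ n)%:E)%E.
Hypotheses (psi_meas : measurable_fun setT psi) (L_meas : measurable_fun setT L).
Hypothesis L_ge0 : forall y, 0 <= L y.
Hypothesis L_moment : forall x, (\int[Q x]_y (L y)%:E <= M%:E)%E.
Hypothesis psi_moment : forall x, (\int[Q x]_y (psi y ^+ p)%:E <= M%:E)%E.

Let obs := next_obs Y_ 0.

(** The two constants of the bounds on increments are added up so that the same
    function [e] of one observation controls the increments and their
    differences. *)
Lemma mean_ln_lik : exists l, dn p l /\ forall th, Theta th ->
  (forall n, Pr.-integrable setT (EFin \o (fun w => ln (lik n (obs w) xs th)))) /\
  exists E, forall n, `|\int[Pr]_w ln (lik n (obs w) xs th) - n%:R * l th| <= E.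
Proof.
have [C1 C10 H1] := incr_unit; have [C2 C20 H2] := incr_contract_unit.
pose e y := L y + (C1 + C2) * psi y ^+ p.
have C0 : 0 <= C1 + C2 by rewrite addr_ge0.
have psip y : 0 <= psi y ^+ p by rewrite exprn_ge0// psi_ge0.
have psis n y : 0 <= psi_sum n y by apply: sumr_ge0 => k _.
have e0 y : 0 <= e y by rewrite addr_ge0// mulr_ge0.
have mpsi : measurable_fun setT (fun y => psi y ^+ p) by exact: measurable_funX.
have me : measurable_fun setT e by apply: measurable_funD => //; exact: measurable_funM.
have ie x : (\int[Q x]_y (e y)%:E <= (M + (C1 + C2) * M)%:E)%E.
  under eq_integral do rewrite EFinD EFinM.
  rewrite ge0_integralD//; last 4 first.
  - by move=> y _; rewrite lee_fin.
  - exact/measurable_EFinP.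
  - by move=> y _; rewrite -EFinM lee_fin mulr_ge0.
  - by under eq_fun do rewrite -EFinM; apply/measurable_EFinP; exact: measurable_funM.
  rewrite ge0_integralZl//; last 2 first.
  - exact/measurable_EFinP.
  - by move=> y _; rewrite lee_fin.
  by rewrite [leRHS]EFinD [(_ * M)%:E]EFinM leeD// lee_wpmul2l// lee_fin.
have eE n y : weight_sum e n y = \sum_(k < n) L (y k) + (C1 + C2) * psi_sum n y.
  by rewrite /weight_sum /e big_split/= -mulr_sumr.
have SL n (y : nat -> Y) : L (y 0%N) <= \sum_(k < n.+1) L (y k).
  by rewrite big_ord_recl lerDl sumr_ge0.
have ctrl n : controlled Theta e n.+1 1 p (incr n).
  split=> [s|th Tth|s th Tth]; [exact: incr_dn|exact: incr_meas|].
  apply: le_trans (H1 n s th Tth) _; rewrite mul1r eE lerD//.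
  by rewrite ler_wpM2r// lerDl.
have dctrl n : controlled Theta e n.+2 (rate ^+ n) p (fun s t => incr n.+1 s t - incr n s t).
  split=> [s|th Tth|s th Tth]; [by apply: (dnB Theta_open); exact: incr_dn| |].
    move=> dT T b Z mb mZ; apply/measurable_EFinP; apply: measurable_funB.
      by apply/measurable_EFinP; exact: (incr_meas n.+1 Tth mb mZ).
    by apply/measurable_EFinP; exact: (incr_meas n Tth mb mZ).
  apply: le_trans (H2 n s th Tth) _; rewrite mulrAC mulrC ler_wpM2l//.
    by rewrite exprn_ge0// ltW//; case/andP: rate01.
  by rewrite eE ler_wpDl ?sumr_ge0// ler_wpM2r// lerDr.
have [l [dl Hl]] := mean_limit Theta_open XY_hmm delta01 K0_ge1 P_ergodic me e0 ie
  rate01 ctrl dctrl incr_local.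
exists l; split => // th Tth.
have ii m j : Pr.-integrable setT (EFin \o (fun w => incr j (next_obs Y_ m w) th)).
  have := dominated_family_integrable
    (controlled_dominated XY_hmm me e0 ie ler01 m (ctrl j)) Tth.
  by apply: eq_integrable => // w _ /=; rewrite incr_local.
have E1 n : (fun w => ln (lik n (obs w) xs th)) =
    fun w => \sum_(m < n) incr (n.-1 - m)%N (next_obs Y_ m w) th.
  apply/funext => w; exact: ln_lik_sum.
split=> [n|]; first by rewrite E1; apply: integrable_sumr => m; exact: ii.
have [E HE] := Hl th Tth; exists E => n; apply: le_trans (HE n).
rewrite E1 Rintegral_sum; last by move=> m; exact: ii.
rewrite le_eqVlt; apply/orP; left; apply/eqP; congr `|_ - _|.
apply: eq_bigr => m _; rewrite /obs_mean; apply: eq_Rintegral => w _.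
by rewrite incr_local.
Qed.

(** Two initial states give likelihoods within a factor [q] of each other; the
    normalization by the number of observations removes this bounded
    discrepancy. *)
Lemma ln_lik_average (lambda : probability X R) n y th : Theta th ->
  `|ln (\int[lambda]_x lik n y x th) - ln (lik n y xs th)| <= - ln q.
Proof.
move=> Tth; have q0 := q_gt0; have h := lik_gt0 n y xs Tth.
have cI := Rintegral_probability_cst lambda.
have il : lambda.-integrable setT (EFin \o (fun x => lik n y x th)).
  apply: (@integrable_dominated _ _ _ _ _ (fun=> q^-1 * lik n y xs th)).
  - exact: lik_meas_state.
  - move=> x; rewrite ger0_norm ?lik_ge0// ler_pdivlMl//; exact: lik_mix.
  - exact: finite_measure_integrable_cst.
have lo : q * lik n y xs th <= \int[lambda]_x lik n y x th.
  rewrite -[leLHS]cI; apply: le_Rintegral => //.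
    exact: finite_measure_integrable_cst.
  by move=> x _; exact: lik_mix.
have up : \int[lambda]_x lik n y x th <= q^-1 * lik n y xs th.
  rewrite -[leRHS]cI; apply: le_Rintegral => //.
    exact: finite_measure_integrable_cst.
  by move=> x _; rewrite ler_pdivlMl//; exact: lik_mix.
have i0 : 0 < \int[lambda]_x lik n y x th by apply: lt_le_trans lo; rewrite mulr_gt0.
have lo' : ln (q * lik n y xs th) <= ln (\int[lambda]_x lik n y x th).
  by rewrite ler_ln ?posrE// mulr_gt0.
have up' : ln (\int[lambda]_x lik n y x th) <= ln (q^-1 * lik n y xs th).
  by rewrite ler_ln ?posrE// mulr_gt0// invr_gt0.
move: lo' up'; rewrite !lnM ?posrE ?invr_gt0// lnV ?posrE// => lo' up'.
move: (ln (\int[_]_x _)) (ln (lik _ _ _ _)) (ln q) lo' up' => a b c lo' up'.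
by rewrite ler_norml; apply/andP; split; lra.
Qed.

Lemma mean_ln_lik_average : exists l, dn p l /\
  forall th (lambda : probability X R), Theta th ->
  (\int[Pr]_w (n%:R^-1 * ln (\int[lambda]_x lik n (obs w) x th))%:E)%E @[n --> \oo]
    --> (l th)%:E.
Proof.
have [l [dl Hl]] := mean_ln_lik; exists l; split => // th lambda Tth.
have [il [E HE]] := Hl th Tth.
pose f n w := ln (\int[lambda]_x lik n (obs w) x th).
pose g n w := ln (lik n (obs w) xs th).
have fg n w : `|f n w - g n w| <= - ln q by exact: ln_lik_average.
have q0 : 0 <= - ln q by exact: le_trans (fg 0%N point).
have mf n : measurable_fun setT (f n).
  apply: (measurableT_comp (@measurable_ln R)).
  apply: (@measurableT_comp _ _ _ _ _ _ fine _
    (fun w => \int[lambda]_x (lik n (obs w) x th)%:E)%E) => //.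
  apply: (@measurable_fun_fubini_tonelli_F _ _ _ _ _ lambda
    (fun z : Omega * X => (lik n (obs z.1) z.2 th)%:E)).
    apply/measurable_EFinP.
    apply: (@lik_meas n _ _ (fun i z => obs z.1 i) snd th Tth) => // i.
    exact: measurableT_comp.
  by move=> z; rewrite lee_fin lik_ge0.
have if_ n : Pr.-integrable setT (EFin \o f n).
  apply: (@integrable_dominated _ _ _ _ _ (fun w => `|g n w| + - ln q)) => //.
    move=> w; rewrite -{1}(subrK (g n w) (f n w)) addrC.
    by apply: le_trans (ler_normD _ _) _; rewrite lerD2l.
  apply: integrableDr; first exact: integrable_norm (il n).
  exact: finite_measure_integrable_cst.
have fgI n : `|\int[Pr]_w f n w - \int[Pr]_w g n w| <= - ln q.
  rewrite -RintegralB//; last exact: il.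
  have ifg : Pr.-integrable setT (EFin \o (fun w => f n w - g n w)).
    exact: (integrableBr (if_ n) (il n)).
  apply: le_trans (le_normr_Rintegral _ ifg) _ => //.
  apply: (@le_trans _ _ (\int[Pr]_w (- ln q))); last first.
    by rewrite Rintegral_probability_cst.
  apply: le_Rintegral => //; first exact: integrable_norm ifg.
  exact: finite_measure_integrable_cst.
have IE n : (\int[Pr]_w (n%:R^-1 * f n w)%:E = (n%:R^-1 * \int[Pr]_w f n w)%:E)%E.
  rewrite -RintegralZl// /Rintegral fineK//.
  by apply: (integrable_fin_num measurableT); exact: integrableZlr.
under eq_fun do rewrite IE.
apply: cvg_EFin; first exact: nearW.
apply/cvgrPdist_le => eta eta0.
near=> n.
have n0 : 0 < n%:R :> R by rewrite ltr0n; near: n; exists 1%N.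
rewrite /=.
have -> : l th - n%:R^-1 * \int[Pr]_w f n w =
    n%:R^-1 * (n%:R * l th - \int[Pr]_w g n w + (\int[Pr]_w g n w - \int[Pr]_w f n w)).
  move: (\int[Pr]_w _) (\int[Pr]_w _) => a b; field; exact: lt0r_neq0.
have ni : 0 <= n%:R^-1 :> R by rewrite invr_ge0 ltW.
rewrite normrM [`|n%:R^-1|]ger0_norm// ler_pdivrMl//.
apply: le_trans (ler_normD _ _) _; rewrite distrC [X in _ + X]distrC.
apply: le_trans (lerD (HE n) (fgI n)) _.
rewrite mulrC -ler_pdivrMl// mulrC; near: n.
exact: nbhs_infty_ger.
Unshelve. all: by end_near. Qed.

End hidden_markov_likelihood.
End likelihood_recursion.

(** * Likelihoods of the parametric model *)

(** On the set where the inequality fails, the integral of the positive function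
    [g - f] is nonpositive, so the set is negligible. *)
Lemma ae_le_of_integral {R : realType} {dT : measure_display} {T : measurableType dT}
    (mu : {measure set T -> \bar R}) (f g : T -> R) :
  mu.-integrable setT (EFin \o f) -> mu.-integrable setT (EFin \o g) ->
  (forall B, measurable B -> (\int[mu]_(x in B) (g x)%:E <= \int[mu]_(x in B) (f x)%:E)%E) ->
  {ae mu, forall x, g x <= f x}.
Proof.
move=> if_ ig H; have mf := integrable_measurable if_; have mg := integrable_measurable ig.
pose B := [set x | f x < g x].
have mB : measurable B.
  have := @measurable_lte _ _ _ setT measurableT (EFin \o f) (EFin \o g).
  rewrite setTI; apply; exact/measurable_EFinP.
have ifB : mu.-integrable B (EFin \o f) by apply: integrableS if_.
have igB : mu.-integrable B (EFin \o g) by apply: integrableS ig.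
have I0 : (\int[mu]_(x in B) `|(g x - f x)%:E| = 0)%E.
  rewrite (eq_integral (fun x => (g x - f x)%:E)); last first.
    by move=> x; rewrite inE /B/= => fg; rewrite ger0_norm// subr_ge0 ltW.
  apply/eqP; rewrite eq_le; apply/andP; split; last first.
    by apply: integral_ge0 => x fg; rewrite lee_fin subr_ge0 ltW.
  under eq_integral do rewrite EFinB.
  by rewrite integralB_EFin// leeBlDr ?add0e ?H// (integrable_fin_num mB).
have mh : measurable_fun B (fun x => (g x - f x)%:E).
  by apply/measurable_EFinP; apply: measurable_funTS; exact: measurable_funB.
have := (ae_eq_integral_abs mu mB mh).1 I0; apply: filterS => x hx.
rewrite leNgt; apply/negP => fg; have /= := hx fg.
by case=> /eqP; rewrite subr_eq0 gt_eqF.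
Qed.

Lemma normr_ln_sandwich {R : realType} (c a b v : R) : 0 < c -> 0 < a ->
  c * a <= b <= c^-1 * a -> `|ln a| <= v -> `|ln b| <= v - ln c.
Proof.
move=> c0 a0 /andP[lo up]; rewrite !ler_norml => /andP[v1 v2].
have b0 : 0 < b by apply: lt_le_trans lo; rewrite mulr_gt0.
have lo' : ln (c * a) <= ln b by rewrite ler_ln ?posrE// mulr_gt0.
have up' : ln b <= ln (c^-1 * a) by rewrite ler_ln ?posrE// mulr_gt0// invr_gt0.
move: lo' up'; rewrite !lnM ?posrE ?invr_gt0// lnV ?posrE//.
by move: (ln a) (ln b) (ln c) v1 v2 => x y z v1 v2 lo' up'; apply/andP; split; lra.
Qed.

Section finite_mass.
Context {R : realType} {dT : measure_display} {T : measurableType dT}.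
Variables (mu : {measure set T -> \bar R}) (mu_fin : (mu setT < +oo)%E).

(** The same set function, with the proof of finiteness as an argument so that
    the structure of finite measure can be attached to it. *)
Definition with_finite_mass (_ : (mu setT < +oo)%E) : set T -> \bar R := mu.

HB.instance Definition _ := Measure.on (with_finite_mass mu_fin).

HB.instance Definition _ := Measure_isFinite.Build _ _ _ (with_finite_mass mu_fin)
  (lty_fin_num_fun mu_fin).

End finite_mass.

Section likelihood_formula.
Context {R : realType} {d : nat} {dX dY : measure_display}.
Context {X : measurableType dX} {Y : measurableType dY}.
Variables (mu : {finite_measure set X -> \bar R}).
Variables (pd : 'rV[R]_d -> X -> X -> R) (qd : 'rV[R]_d -> Y -> X -> R) (th : 'rV[R]_d).
Let r y x' x t := rd pd qd t y x' x.
Hypothesis r_lik_int : forall n y0 y x, mu.-integrable setT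
  (EFin \o (fun x' => r y0 x' x th * lik mu r n y x' th)).

(** The constant [c] collects the factors of the outer integrals. The default
    value [z] of the list access is independent of the states, hence does not
    change when one passes from a state to the next. *)
Lemma iter_integral_lik n (c : R) (y : nat -> Y) z x0 :
  iter_integral mu n (fun s => (c * \prod_(1 <= k < n.+1)
     rd pd qd th (y k) (nth z (x0 :: s) k) (nth z (x0 :: s) k.-1))%:E) =
  (c * lik mu r n (fun i => y i.+1) x0 th)%:E.
Proof.
elim: n c y x0 => [|n IH] c y x0 /=; first by rewrite big_geq.
transitivity (\int[mu]_x (c * (r (y 1%N) x x0 th *
    lik mu r n (fun i => y i.+2) x th))%:E)%E.
  apply: eq_integral => x _.
  rewrite mulrA -(IH _ (fun i => y i.+1) x); congr (iter_integral _ _ _).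
  apply/funext => s; congr EFin; rewrite big_nat_recl//= mulrA.
  by congr (_ * _); apply: eq_big_nat => k /andP[k0 _]; case: k k0.
have ir := r_lik_int n (y 1%N) (fun i => y i.+2) x0.
rewrite -RintegralZl// /Rintegral fineK//.
by apply: (integrable_fin_num measurableT); exact: integrableZlr.
Qed.

Lemma qn_lik n y (lambda : probability X R) :
  qn mu pd qd n th y lambda = (\int[lambda]_x (lik mu r n (fun i => y i.+1) x th)%:E)%E.
Proof.
apply: eq_integral => x _; rewrite -[_%:E]/(_%:E) -[X in X%:E]mul1r.
rewrite -(iter_integral_lik n 1 y x x); congr (iter_integral _ _ _).
by apply/funext => s; rewrite mul1r.
Qed.

End likelihood_formula.

Theorem theorem3p1
  (R : realType) (d dx dy p : nat)
  (d_gt0 : (0 < d)%N) (dx_gt0 : (0 < dx)%N) (dy_gt0 : (0 < dy)%N)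
  (p_gt0 : (0 < p)%N)
  (Theta : set 'rV[R]_d)
  (Theta_bounded : bounded_set Theta) (Theta_open : open Theta)
  (X : set 'rV[R]_dx) (X0 : X !=set0) (X_borel : <<s @open 'rV[R]_dx >> X)
  (Y : set 'rV[R]_dy) (Y0 : Y !=set0) (Y_borel : <<s @open 'rV[R]_dy >> Y)
  (mu : {measure set (borel_on X0) -> \bar R})
  (nu : {measure set (borel_on Y0) -> \bar R})
  (pd : 'rV[R]_d -> borel_on X0 -> borel_on X0 -> R)
  (qd : 'rV[R]_d -> borel_on Y0 -> borel_on X0 -> R)
  (pd_ge0 : forall th x' x, Theta th -> 0 <= pd th x' x)
  (qd_ge0 : forall th y x, Theta th -> 0 <= qd th y x)
  (pd_meas : forall th, Theta th ->
     measurable_fun setT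
       (fun z : borel_on X0 * borel_on X0 => pd th z.1 z.2))
  (qd_meas : forall th, Theta th ->
     measurable_fun setT
       (fun z : borel_on Y0 * borel_on X0 => qd th z.1 z.2))
  (pd_int1 : forall th x, Theta th ->
     (\int[mu]_x' (pd th x' x)%:E = 1)%E)
  (qd_int1 : forall th x, Theta th ->
     (\int[nu]_y (qd th y x)%:E = 1)%E)
  (pd_diff : forall x' x, differentiable_n p (fun th => pd th x' x) Theta)
  (qd_diff : forall y x, differentiable_n p (fun th => qd th y x) Theta)
  (P : R.-pker borel_on X0 ~> borel_on X0)
  (Q : R.-pker borel_on X0 ~> borel_on Y0)
  (dO : measure_display) (Omega : measurableType dO)
  (Pr : probability Omega R)
  (X_ : nat -> {mfun Omega >-> borel_on X0})
  (Y_ : nat -> {mfun Omega >-> borel_on Y0})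
  (XY_hmm : hidden_markov Pr P Q X_ Y_)
  (eps : R) (eps01 : 0 < eps < 1)
  (muty : 'rV[R]_d -> borel_on Y0 -> {measure set (borel_on X0) -> \bar R})
  (muty_fin : forall th y, Theta th -> (0 < muty th y setT < +oo)%E)
  (muty_bounds : forall th y x B, Theta th -> measurable B ->
     (eps%:E * muty th y B <= \int[mu]_(x' in B) (rd pd qd th y x' x)%:E
        <= eps^-1%:E * muty th y B)%E)
  (psi : borel_on Y0 -> R) (psi_ge1 : forall y, 1 <= psi y)
  (psi_meas : measurable_fun setT psi)
  (psi_bound : forall th x x' y (alpha : {ffun 'I_d -> nat}), Theta th ->
     alpha != [ffun=> 0%N] -> (multi_deg alpha <= p)%N ->
     `|multi_partial alpha (fun t => rd pd qd t y x' x) th|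
       <= psi y ^+ multi_deg alpha * rd pd qd th y x' x)
  (phi : borel_on Y0 -> borel_on X0 -> R) (phi_ge1 : forall y x, 1 <= phi y x)
  (phi_meas : forall y, measurable_fun setT (phi y))
  (phi_bound : forall th x x' y, Theta th -> rd pd qd th y x' x <= phi y x')
  (phi_int : forall y, (\int[mu]_x (phi y x)%:E < +oo)%E)
  (pi : probability (borel_on X0) R)
  (delta K0 : R) (delta01 : 0 < delta < 1) (K0_ge1 : 1 <= K0)
  (P_ergodic : forall x B (n : nat), measurable B ->
     (`|kernel_pow P n x B - pi B| <= (K0 * delta ^+ n)%:E)%E)
  (varphi : borel_on Y0 -> R) (varphi_ge1 : forall y, 1 <= varphi y)
  (varphi_meas : measurable_fun setT varphi)
  (varphi_bound : forall th y, Theta th ->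
     `|ln (fine (muty th y setT))| <= varphi y)
  (M0 : R) (M0_ge1 : 1 <= M0)
  (varphi_int : forall x,
     (\int[Q x]_y (varphi y * psi y ^+ (p * (p + 1)))%:E <= M0%:E)%E)
  (psi_int : forall x,
     (\int[Q x]_y (psi y ^+ (2 * p * (p + 1)))%:E <= M0%:E)%E) :
  exists l : 'rV[R]_d -> R,
    differentiable_n p l Theta /\
    forall th (lambda : probability (borel_on X0) R), Theta th ->
      ln_mean mu pd qd Pr Y_ n th lambda @[n --> \oo] --> (l th)%:E.
Proof.
pose r y x' x t := rd pd qd t y x' x.
have /andP[e0 e1] := eps01.
have phi_ge0 y x : 0 <= phi y x by exact: le_trans (phi_ge1 y x).
(* The constant 1 is below the integrable [phi]. *)
have mu_fin : (mu setT < +oo)%E.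
  apply: le_lt_trans (phi_int point).
  rewrite -[leLHS]mul1e -integral_cst//; apply: ge0_le_integral => //.
  - exact/measurable_EFinP.
  - by move=> x _; rewrite lee_fin.
pose mu' : {finite_measure set (borel_on X0) -> \bar R} := with_finite_mass mu_fin.
have r_ge0 y x' x th : Theta th -> 0 <= r y x' x th.
  by move=> Tth; rewrite mulr_ge0 ?pd_ge0 ?qd_ge0.
have r_meas th : Theta th -> measurable_fun setT
    (fun z : (borel_on Y0 * borel_on X0) * borel_on X0 => r z.1.1 z.1.2 z.2 th).
  move=> Tth; apply: measurable_funM.
    exact: (@measurableT_comp _ _ _ _ _ _ (fun z => qd th z.1 z.2) _ fst (qd_meas th Tth)).
  apply: (@measurableT_comp _ _ _ _ _ _ (fun z => pd th z.1 z.2) _ (fun z => (z.1.2, z.2))).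
    exact: pd_meas.
  by apply: measurable_fun_pair => //; exact: measurableT_comp.
have r_dn y x' x : differentiable_n p (r y x' x) Theta.
  exact: (dnM Theta_open (qd_diff y x') (pd_diff x' x)).
have r_jet y x' x tau th : Theta th -> 0 <= tau ->
    jet_norm tau p (r y x' x) th <= r y x' x th * (1 + d%:R * tau * psi y) ^+ p.
  move=> Tth t0; apply: jet_norm_words => //; first exact: r_ge0.
    by rewrite (le_trans _ (psi_ge1 y)).
  move=> [|i w] wp; first by rewrite /= expr0 mulr1 ger0_norm// r_ge0.
  rewrite (word_partial_multi Theta_open (r_dn y x' x) wp Tth) -(multi_deg_count (i :: w)).
  rewrite mulrC; apply: psi_bound => //; last by rewrite multi_deg_count.
  by apply/eqP => /ffunP /(_ i); rewrite !ffunE/= eqxx.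
have phi_int' y : mu'.-integrable setT (EFin \o phi y).
  apply/integrableP; split; first exact/measurable_EFinP.
  by under eq_integral do rewrite /= ger0_norm//; exact: phi_int.
have r_int y x th : Theta th -> mu.-integrable setT (EFin \o (fun x' => r y x' x th)).
  move=> Tth; apply: (integrable_dominated _ _ (phi_int' y)).
    apply: (@measurableT_comp _ _ _ _ _ _
      (fun z : (borel_on Y0 * borel_on X0) * borel_on X0 => r z.1.1 z.1.2 z.2 th) _
      (fun x' => ((y, x'), x))); first exact: r_meas.
    by apply: measurable_fun_pair => //; exact: measurable_fun_pair.
  by move=> x'; rewrite ger0_norm ?r_ge0//; exact: phi_bound.
have q01 : 0 < eps * eps < 1 by rewrite mulr_gt0//= mulr_ilt1 ?ltW.
(* Both densities are compared with the common measure [muty]: it is at most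
   [eps^-1] times the integral of one and at least [eps] times that of the other. *)
have r_mix y x z th : Theta th ->
    {ae mu', forall x', eps * eps * r y x' z th <= r y x' x th}.
  move=> Tth; apply: (@ae_le_of_integral _ _ _ mu'); [exact: r_int|exact: integrableZlr (r_int _ _ _ Tth)|].
  move=> B mB; have /andP[lo _] := muty_bounds th y x B Tth mB.
  have /andP[_ up] := muty_bounds th y z B Tth mB.
  under eq_integral do rewrite EFinM.
  rewrite ge0_integralZl//; last 3 first.
  - by apply/measurable_EFinP; apply: measurable_funTS; exact: integrable_measurable (r_int _ _ _ Tth).
  - by move=> x' _; rewrite lee_fin r_ge0.
  - by rewrite lee_fin mulr_ge0// ltW.
  apply: le_trans lo; apply: (@le_trans _ _ ((eps * eps)%:E * (eps^-1%:E * muty th y B))%E).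
    by rewrite lee_wpmul2l// lee_fin mulr_ge0// ltW.
  by rewrite muleA -EFinM -mulrA mulfV ?mulr1// gt_eqF.
have r_bounds y x th : Theta th ->
    eps * fine (muty th y setT) <= \int[mu]_x' r y x' x th <= eps^-1 * fine (muty th y setT).
  move=> Tth; have /andP[m0 moo] := muty_fin th y Tth.
  have /andP[lo up] := muty_bounds th y x setT Tth measurableT.
  have mE : muty th y setT = (fine (muty th y setT))%:E by rewrite fineK// ge0_fin_numE// ltW.
  have rE : (\int[mu]_x' (r y x' x th)%:E = (\int[mu]_x' r y x' x th)%:E)%E.
    by rewrite /Rintegral fineK//; exact: (integrable_fin_num measurableT (r_int y x th Tth)).
  by move: lo up; rewrite -/(r _ _ _ _) mE [(\int[_]_(_ in _) _)%E]rE -!EFinM !lee_fin => -> ->.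
have m_gt0 y th : Theta th -> 0 < fine (muty th y setT).
  by move=> Tth; rewrite fine_gt0// muty_fin.
have r_pos y x th : Theta th -> 0 < \int[mu']_x' r y x' x th.
  move=> Tth; have /andP[lo _] := r_bounds y x th Tth.
  by apply: lt_le_trans lo; rewrite mulr_gt0// m_gt0.
(* The mass of the density is that of [muty] up to a factor [eps]. *)
pose L y := varphi y - ln eps.
have ln_eps : 0 <= - ln eps by rewrite oppr_ge0 ln_le0// ltW.
have r_mass y x th : Theta th -> `|ln (\int[mu']_x' r y x' x th)| <= L y.
  move=> Tth; have m0 := m_gt0 y th Tth.
  exact: (normr_ln_sandwich e0 m0 (r_bounds y x th Tth) (varphi_bound th y Tth)).
have r_phi y x' x th : Theta th -> r y x' x th <= phi y x' by move=> Tth; exact: phi_bound.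
have mean := mean_ln_lik_average Theta_open (mu := mu') point r_ge0 r_meas r_dn psi_ge1 r_jet
  r_phi phi_int' q01 r_mix r_pos r_mass XY_hmm delta01 K0_ge1 P_ergodic psi_meas.
have [] := mean (M0 - ln eps).
- by apply: measurable_funB.
- by move=> y; rewrite addr_ge0// (le_trans _ (varphi_ge1 y)).
- move=> x; under eq_integral do rewrite EFinD.
  rewrite ge0_integralD//; last 2 first.
  - by move=> y _; rewrite lee_fin (le_trans _ (varphi_ge1 y)).
  - exact/measurable_EFinP.
  rewrite kernel_integral_cst [leRHS]EFinD leeD2r//; apply: le_trans (varphi_int x).
  apply: ge0_le_integral => //.
  - by move=> y _; rewrite lee_fin (le_trans _ (varphi_ge1 y)).
  - exact/measurable_EFinP.
  - by apply/measurable_EFinP; apply: measurable_funM => //; exact: measurable_funX.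
  - move=> y _; rewrite lee_fin ler_peMr ?exprn_ege1//.
    by rewrite (le_trans _ (varphi_ge1 y)).
- move=> x; apply: le_trans (le_trans _ (psi_int x)) _; last by rewrite lee_fin lerDl.
  apply: ge0_le_integral => //.
  - by move=> y _; rewrite lee_fin exprn_ge0// (le_trans _ (psi_ge1 y)).
  - by apply/measurable_EFinP; exact: measurable_funX.
  - by apply/measurable_EFinP; exact: measurable_funX.
  - move=> y _; rewrite lee_fin ler_weXn2l//.
    by rewrite [X in (X * _)%N]mulnC -mulnA leq_pmulr// muln_gt0 addn1.
move=> l [dl Hl]; exists l; split => // th lambda Tth.
have := Hl th lambda Tth.
suff -> : (fun n => ln_mean mu pd qd Pr Y_ n th lambda) = fun n =>
  (\int[Pr]_w (n%:R^-1 * ln (\int[lambda]_x lik mu' r n (next_obs Y_ 0 w) x th))%:E)%E by [].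
apply/funext => n; rewrite /ln_mean unlock.
apply: eq_integral => w _; congr (_ * ln _)%:E.
rewrite /Rintegral; congr fine.
apply: (@qn_lik _ _ _ _ _ _ mu' pd qd th) => n' y0 y x.
have bl := lik_bfam Theta_open r_ge0 r_meas r_dn psi_ge1 r_jet r_phi phi_int' n' y.
exact: (r_mul_int Theta_open r_meas r_dn psi_ge1 r_jet r_phi phi_int' y0 x bl Tth).
Qed.
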